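(* The assignment $$X \mapsto k_n[X],\qquad (f\colon X\to Y)\mapsto (f^*\colon k_n[Y]\to k_n[X]),\quad f^*(g)=g\circ f,$$ defines a contravariant equivalence of categories between $\mathit{Var}_n$ and $\mathit{PI}_n$.
   Context: $k$ is an algebraically closed field of arbitrary characteristic and $n\ge 1$ is a fixed integer. All rings and algebras are associative with $1$; subrings and homomorphisms respect $1$. $\operatorname{M}_n$ is the algebra of $n\times n$ matrices over $k$; $\operatorname{PGL}_n$ acts on $(\operatorname{M}_n)^m$ by simultaneous conjugation. $U_{m,n}\subseteq(\operatorname{M}_n)^m$ is the $\operatorname{PGL}_n$-stable Zariski open set of $m$-tuples that generate $\operatorname{M}_n$ as a $k$-algebra. An $n$-variety is a $\operatorname{PGL}_n$-stable subset $X$ of some $U_{m,n}$ that is Zariski closed in $U_{m,n}$; it is irreducible if it is irreducible in the Zariski topology. The generic matrix ring $G_{m,n}=k\{X_1,\dots,X_m\}$ is the $k$-subalgebra of $\operatorname{M}_n(k[x_{i,j}^{(h)}\mid 1\le i,j\le n,\ 1\le h\le m])$ generated by the generic matrices $X_h=(x_{i,j}^{(h)})_{i,j}$; elements of $G_{m,n}$ can be evaluated at points of $(\operatorname{M}_n)^m$. For an $n$-variety $X\subseteq U_{m,n}$, $\mathcal I(X)=\{p\in G_{m,n}\mid p(a)=0\ \forall a\in X\}$ and the PI-coordinate ring is $k_n[X]=G_{m,n}/\mathcal I(X)$, whose elements are viewed as ($\operatorname{PGL}_n$-equivariant) functions $X\to\operatorname{M}_n$. If $X\subseteq U_{m,n}$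 and $Y\subseteq U_{l,n}$ are $n$-varieties, a regular map of $n$-varieties $f\colon X\to Y$ is a map of the form $x\mapsto (f_1(x),\dots,f_l(x))$ with all $f_i\in k_n[X]$. $\mathit{Var}_n$: objects are the irreducible $n$-varieties (for all $m$), morphisms are regular maps of $n$-varieties. $\mathit{PI}_n$: objects are the finitely generated prime (PI) $k$-algebras of PI-degree $n$, where a prime PI-algebra has PI-degree $n$ if its total ring of fractions is a central simple algebra of degree $n$ (dimension $n^2$ over its center). Morphisms are the $k$-algebra homomorphisms $\alpha\colon R\to S$ such that for every surjective $k$-algebra homomorphism $\phi\colon S\to\operatorname{M}_n$, the composition $\phi\circ\alpha$ is also surjective. *)

(* Defs.v *)
From HB Require Import structures.
From mathcomp Require Import all_boot all_algebra.
From mathcomp Require Import boolp.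
From mathcomp Require Import mpoly.
From mathcomp Require finmap monalg.

Set Implicit Arguments.
Unset Strict Implicit.
Unset Printing Implicit Defensive.

Import GRing.Theory.
Local Open Scope ring_scope.
Local Open Scope quotient_scope.

Definition surjective (S T : Type) (f : S -> T) : Prop :=
  forall y, exists x, f x = y.

(* [`[< P >]] is the classical truth value of [P]; thanks to it, quantifying *)
(* over [{pred A}] is quantifying over all subsets of [A].                   *)
Section GeneratedSubalgebra.
Variables (k : comNzRingType) (A : algType k) (m : nat) (s : 'I_m -> A).

Definition generated_subalg : {pred A} := fun a =>
  `[< forall B : {pred A},
        GRing.subalg_closed B -> (forall i, s i \in B) -> a \in B >].

Definition generates : Prop := forall a : A, a \in generated_subalg.

Lemma generated_subalgP a :
  reflect (forall B : {pred A},
             GRing.subalg_closed B -> (forall i, s i \in B) -> a \in B)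
          (a \in generated_subalg).
Proof. exact: asboolP. Qed.

Lemma generated_subalg_closed : GRing.subalg_closed generated_subalg.
Proof.
split.
- by apply/generated_subalgP => B [].
- move=> c x y /generated_subalgP xB /generated_subalgP yB.
  apply/generated_subalgP => B Bsub sB; case: (Bsub) => _ Blin _.
  by apply: Blin; [apply: xB | apply: yB].
- move=> x y /generated_subalgP xB /generated_subalgP yB.
  apply/generated_subalgP => B Bsub sB; case: (Bsub) => _ _ Bmul.
  by apply: Bmul; [apply: xB | apply: yB].
Qed.

HB.instance Definition _ := GRing.isSubalgClosed.Build k A generated_subalg
  (GRing.subalg_closed_semi generated_subalg_closed).

Lemma mem_generator i : s i \in generated_subalg.
Proof. by apply/generated_subalgP => B _; apply. Qed.

Record subalgebra := Subalgebra {
  subalg_val :> A;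
  subalg_valP : subalg_val \in generated_subalg
}.

HB.instance Definition _ := [isSub for subalg_val].
HB.instance Definition _ := [Choice of subalgebra by <:].
HB.instance Definition _ := [SubChoice_isSubAlgebra of subalgebra by <:].

End GeneratedSubalgebra.

(* The library's [idealr] are the proper additive subgroups stable under     *)
(* multiplication on the left, and its quotient rings are commutative.       *)
HB.mixin Record isRightAbsorbing (R : nzRingType) (S : R -> bool) := {
  absorb_mulr : forall a, {in S, forall u, u * a \in S}
}.

#[short(type="twoSidedIdeal")]
HB.structure Definition TwoSidedIdeal (R : nzRingType) :=
  {S of Idealr R S & isRightAbsorbing R S}.

Section QuotientAlgebra.
Variables (k : comNzRingType) (A : algType k) (I : twoSidedIdeal A).

Definition quotient_alg : Type := Quotient.quot I.
HB.instance Definition _ := EqQuotient.on quotient_alg.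
HB.instance Definition _ := GRing.Zmodule.on quotient_alg.

Local Notation Q := quotient_alg.
Definition qclass (x : A) : Q := \pi_(Quotient.quot I) x.
Definition qrepr (q : Q) : A := repr (q : Quotient.quot I).

Lemma qreprK q : qclass (qrepr q) = q.
Proof. exact: reprK. Qed.

Lemma qclassP x y : (qclass x = qclass y) <-> (x - y \in I).
Proof.
rewrite Quotient.idealrBE; split; first by move=> e; apply/eqP.
by move/eqP.
Qed.

Lemma qclassE x : qrepr (qclass x) - x \in I.
Proof. by apply/qclassP; rewrite qreprK. Qed.

Lemma qclassD x y : qclass (x + y) = qclass x + qclass y.
Proof. by rewrite /qclass Quotient.pi_add. Qed.

Definition qone : Q := qclass 1.
Definition qmul (x y : Q) : Q := qclass (qrepr x * qrepr y).
Definition qscale (c : k) (x : Q) : Q := qclass (c *: qrepr x).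

Lemma qmulE x y : qmul (qclass x) (qclass y) = qclass (x * y).
Proof.
apply/qclassP.
rewrite -[_ - _](subrKA (qrepr (qclass x) * y)) -mulrBr -mulrBl.
rewrite rpredD //.
  by rewrite idealMr // qclassE.
by rewrite absorb_mulr // qclassE.
Qed.

Lemma qscaleE c x : qscale c (qclass x) = qclass (c *: x).
Proof.
by apply/qclassP; rewrite -scalerBr -mulr_algl idealMr // qclassE.
Qed.

Lemma qmulA : associative qmul.
Proof.
move=> x y z; rewrite -[x]qreprK -[y]qreprK -[z]qreprK.
by rewrite !qmulE mulrA.
Qed.
Lemma qmul1 : left_id qone qmul.
Proof. by move=> x; rewrite -[x]qreprK qmulE mul1r. Qed.
Lemma qmulr1 : right_id qone qmul.
Proof. by move=> x; rewrite -[x]qreprK qmulE mulr1. Qed.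
Lemma qmulDl : left_distributive qmul +%R.
Proof.
move=> x y z; rewrite -[x]qreprK -[y]qreprK -[z]qreprK.
by rewrite -qclassD !qmulE mulrDl qclassD.
Qed.
Lemma qmulDr : right_distributive qmul +%R.
Proof.
move=> x y z; rewrite -[x]qreprK -[y]qreprK -[z]qreprK.
by rewrite -qclassD !qmulE mulrDr qclassD.
Qed.
Lemma qone_neq0 : qone != 0.
Proof.
have -> : (0 : Q) = qclass 0.
  by apply: (addIr (qclass 0)); rewrite -qclassD !add0r.
by apply/eqP => /qclassP; rewrite subr0 idealr1.
Qed.

HB.instance Definition _ := GRing.Zmodule_isNzRing.Build Q
  qmulA qmul1 qmulr1 qmulDl qmulDr qone_neq0.

Lemma qscaleA a b v : qscale a (qscale b v) = qscale (a * b) v.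
Proof. by rewrite -[v]qreprK !qscaleE scalerA. Qed.
Lemma qscale1 : left_id 1 qscale.
Proof. by move=> v; rewrite -[v]qreprK qscaleE scale1r. Qed.
Lemma qscaleDr : right_distributive qscale +%R.
Proof.
move=> c x y; rewrite -[x]qreprK -[y]qreprK.
by rewrite -qclassD !qscaleE scalerDr qclassD.
Qed.
Lemma qscaleDl v : {morph qscale^~ v : a b / a + b}.
Proof. by move=> a b; rewrite -[v]qreprK !qscaleE scalerDl qclassD. Qed.

HB.instance Definition _ := GRing.Zmodule_isLmodule.Build k Q
  qscaleA qscale1 qscaleDr qscaleDl.

Lemma qscaleAl (a : k) (u v : Q) : a *: (u * v) = (a *: u) * v.
Proof.
rewrite -[u]qreprK -[v]qreprK.
rewrite -[LHS]/(qscale a (qmul _ _)) -[RHS]/(qmul (qscale a _) _).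
by rewrite !(qmulE, qscaleE) scalerAl.
Qed.
HB.instance Definition _ := GRing.Lmodule_isLalgebra.Build k Q qscaleAl.

Lemma qscaleAr (a : k) (u v : Q) : a *: (u * v) = u * (a *: v).
Proof.
rewrite -[u]qreprK -[v]qreprK.
rewrite -[LHS]/(qscale a (qmul _ _)) -[RHS]/(qmul _ (qscale a _)).
by rewrite !(qmulE, qscaleE) scalerAr.
Qed.
HB.instance Definition _ := GRing.Lalgebra_isAlgebra.Build k Q qscaleAr.

End QuotientAlgebra.

Arguments qclass {k A} I x.

Section PIAlgebras.
Import finmap monalg.
Variables (k : fieldType).

Definition fin_generated (R : algType k) : Prop :=
  exists m (s : 'I_m -> R), generates s.

Definition prime_ring (R : nzRingType) : Prop :=
  forall a b : R, (forall r, a * r * b = 0) -> a = 0 \/ b = 0.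

(* [{malg k[{fmonom nat}]}] is the free associative algebra on countably     *)
(* many variables: its elements are combinations of words in [nat].          *)
Definition nc_eval (R : algType k) (f : {malg k[{fmonom nat}]})
    (r : nat -> R) : R :=
  \sum_(w <- (msupp f : seq _)) mcoeff w f *: \prod_(i <- (w : seq nat)) r i.

Definition PI_algebra (R : algType k) : Prop :=
  exists2 f : {malg k[{fmonom nat}]},
    f != 0 & forall r : nat -> R, nc_eval f r = 0.

Definition regular_elt (R : nzRingType) (s : R) : Prop :=
  GRing.lreg s /\ GRing.rreg s.

(* The (two-sided) classical ring of fractions of [R], obtained by inverting *)
(* all non-zero-divisors; it is unique up to unique isomorphism when it      *)
(* exists.                                                                   *)
Definition total_ring_of_fractions (R : nzRingType) (Q : unitRingType)
    (j : {rmorphism R -> Q}) : Prop :=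
  [/\ injective j,
      forall s, regular_elt s -> j s \is a GRing.unit,
      forall q, exists a s, regular_elt s /\ q = j a * (j s)^-1
    & forall q, exists a s, regular_elt s /\ q = (j s)^-1 * j a].

(* A [nzRingType] is nonzero and a [twoSidedIdeal] is proper.                *)
Definition simple_ring (Q : nzRingType) : Prop :=
  forall (I : twoSidedIdeal Q) (x : Q), x \in I -> x = 0.

Definition central (Q : nzRingType) (z : Q) : Prop := forall q, z * q = q * z.

Definition has_dim_over_center (Q : nzRingType) (d : nat) : Prop :=
  exists b : 'I_d -> Q,
    (forall q, exists2 c : 'I_d -> Q,
       forall i, central (c i) & q = \sum_i c i * b i) /\
    (forall c : 'I_d -> Q, (forall i, central (c i)) ->
       \sum_i c i * b i = 0 -> forall i, c i = 0).

Definition central_simple_of_degree (n : nat) (Q : nzRingType) : Prop :=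
  simple_ring Q /\ has_dim_over_center Q (n ^ 2).

Definition has_PI_degree (n : nat) (R : nzRingType) : Prop :=
  exists (Q : unitRingType) (j : {rmorphism R -> Q}),
    total_ring_of_fractions j /\ central_simple_of_degree n Q.

End PIAlgebras.

(* From here on the size of the matrices, and the PI-degree, is [n.+1]: the  *)
(* library only has an algebra structure on matrices of nonzero size.        *)
Section Points.
Variables (k : closedFieldType) (n m : nat).

Definition point := {ffun 'I_m -> 'M[k]_n.+1}.

Definition coord_index := ('I_m * 'I_n.+1 * 'I_n.+1)%type.
Definition ncoord : nat := #|{: coord_index}|.

Definition coords (a : point) (v : 'I_ncoord) : k :=
  let: (h, i, j) := enum_val v in a h i j.

Definition zariski_closed (Z : point -> Prop) : Prop :=
  exists P : {mpoly k[ncoord]} -> Prop,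
    forall a, Z a <-> forall p, P p -> p.@[coords a] = 0.

Definition generating (a : point) : Prop := generates a.

(* [PGL] acts through invertible matrices by simultaneous conjugation.       *)
Definition conj_point (g : 'M[k]_n.+1) (a : point) : point :=
  [ffun h => g * a h * g^-1].

Definition PGL_stable (X : point -> Prop) : Prop :=
  forall g a, g \is a GRing.unit -> X a -> X (conj_point g a).

Definition is_nvariety (X : point -> Prop) : Prop :=
  [/\ forall a, X a -> generating a, PGL_stable X
    & exists2 Z, zariski_closed Z & forall a, X a <-> generating a /\ Z a].

Definition irreducible (X : point -> Prop) : Prop :=
  (exists a, X a) /\
  forall Z1 Z2, zariski_closed Z1 -> zariski_closed Z2 ->
    (forall a, X a -> Z1 a \/ Z2 a) ->
    (forall a, X a -> Z1 a) \/ (forall a, X a -> Z2 a).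

(* Matrices over the polynomial ring, as an algebra over [k] (the library's  *)
(* algebra structure on matrices is over the ring of entries).               *)
Definition polymx : Type := 'M[{mpoly k[ncoord]}]_n.+1.
HB.instance Definition _ := GRing.NzRing.on polymx.

Definition pm_scale (c : k) (A : polymx) : polymx :=
  (c%:MP : {mpoly k[ncoord]}) *: (A : 'M_n.+1).

Lemma pm_scaleA a b v : pm_scale a (pm_scale b v) = pm_scale (a * b) v.
Proof. by rewrite /pm_scale scalerA -mpolyCM. Qed.
Lemma pm_scale1 : left_id 1 pm_scale.
Proof. by move=> v; rewrite /pm_scale mpolyC1 scale1r. Qed.
Lemma pm_scaleDr : right_distributive pm_scale +%R.
Proof. by move=> c x y; rewrite /pm_scale scalerDr. Qed.
Lemma pm_scaleDl v : {morph pm_scale^~ v : a b / a + b}.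
Proof. by move=> a b; rewrite /pm_scale mpolyCD scalerDl. Qed.
HB.instance Definition _ := GRing.Zmodule_isLmodule.Build k polymx
  pm_scaleA pm_scale1 pm_scaleDr pm_scaleDl.

Lemma pm_scaleAl (c : k) (x y : polymx) : c *: (x * y) = (c *: x) * y.
Proof. exact: scalemxAl. Qed.
HB.instance Definition _ := GRing.Lmodule_isLalgebra.Build k polymx pm_scaleAl.

Lemma pm_scaleAr (c : k) (x y : polymx) : c *: (x * y) = x * (c *: y).
Proof. exact: scalemxAr. Qed.
HB.instance Definition _ := GRing.Lalgebra_isAlgebra.Build k polymx pm_scaleAr.

Definition generic_matrix (h : 'I_m) : polymx :=
  \matrix_(i, j) 'X_(enum_rank ((h, i, j) : coord_index)).

Definition generic_ring := subalgebra generic_matrix.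
HB.instance Definition _ := GRing.Algebra.on generic_ring.

Definition polymx_eval (a : point) (p : polymx) : 'M[k]_n.+1 :=
  map_mx (meval (coords a)) p.

Definition geval (p : generic_ring) (a : point) : 'M[k]_n.+1 :=
  polymx_eval a (subalg_val p).

Lemma polymx_evalD a p q :
  polymx_eval a (p + q) = polymx_eval a p + polymx_eval a q.
Proof. exact: map_mxD. Qed.
Lemma polymx_evalM a p q :
  polymx_eval a (p * q) = polymx_eval a p * polymx_eval a q.
Proof. exact: map_mxM. Qed.
Lemma polymx_eval1 a : polymx_eval a 1 = 1.
Proof. exact: map_mx1. Qed.
Lemma polymx_evalZ a c p : polymx_eval a (c *: p) = c *: polymx_eval a p.
Proof. by rewrite /polymx_eval -[c *: p]/(pm_scale c p) map_mxZ /= mevalC. Qed.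
Lemma polymx_eval_generic a h : polymx_eval a (generic_matrix h) = a h.
Proof. by apply/matrixP => i j; rewrite !mxE mevalXU /coords enum_rankK. Qed.

Lemma gevalD p q a : geval (p + q) a = geval p a + geval q a.
Proof. exact: polymx_evalD. Qed.
Lemma gevalM p q a : geval (p * q) a = geval p a * geval q a.
Proof. exact: polymx_evalM. Qed.
Lemma geval1 a : geval 1 a = 1.
Proof. exact: polymx_eval1. Qed.
Lemma gevalZ c p a : geval (c *: p) a = c *: geval p a.
Proof. exact: polymx_evalZ. Qed.
Lemma geval0 a : geval 0 a = 0.
Proof. by apply: (addIr (geval 0 a)); rewrite -gevalD !add0r. Qed.
Lemma gevalN p a : geval (- p) a = - geval p a.
Proof. by rewrite -scaleN1r gevalZ scaleN1r. Qed.
Lemma gevalB p q a : geval (p - q) a = geval p a - geval q a.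
Proof. by rewrite gevalD gevalN. Qed.

End Points.

Arguments geval {k n m}.

Section IrreducibleVarieties.
Variables (k : closedFieldType) (n : nat).

Record irr_nvariety : Type := IrrNVariety {
  nv_dim : nat;
  nv_carrier :> point k n nv_dim -> Prop;
  nv_axiom : is_nvariety nv_carrier;
  nv_irr : irreducible nv_carrier
}.

Definition nv_point (X : irr_nvariety) : Type :=
  {a : point k n (nv_dim X) | X a}.

Section CoordinateRing.
Variable X : irr_nvariety.
Local Notation G := (generic_ring k n (nv_dim X)).

Definition vanishing_ideal : {pred G} :=
  fun p => `[< forall a, X a -> geval p a = 0 >].

Lemma vanishingP p :
  reflect (forall a, X a -> geval p a = 0) (p \in vanishing_ideal).
Proof. exact: asboolP. Qed.

Lemma vanishing_zmod : zmod_closed vanishing_ideal.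
Proof.
split; first by apply/vanishingP => a _; rewrite geval0.
move=> p q /vanishingP p0 /vanishingP q0; apply/vanishingP => a aX.
by rewrite gevalB p0 // q0 // subr0.
Qed.
HB.instance Definition _ :=
  GRing.isZmodClosed.Build G vanishing_ideal vanishing_zmod.

Lemma vanishing_proper : 1 \notin vanishing_ideal /\
  forall r, {in vanishing_ideal, forall p, r * p \in vanishing_ideal}.
Proof.
split.
  apply/negP => /vanishingP e; case: (nv_irr X) => -[a /e].
  by rewrite geval1 => /eqP; rewrite oner_eq0.
move=> r p /vanishingP p0; apply/vanishingP => a aX.
by rewrite gevalM p0 // mulr0.
Qed.
HB.instance Definition _ :=
  isProperIdeal.Build G vanishing_ideal vanishing_proper.

Lemma vanishing_absorb r : {in vanishing_ideal, forall p, p * r \in vanishing_ideal}.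
Proof.
move=> p /vanishingP p0; apply/vanishingP => a aX.
by rewrite gevalM p0 // mul0r.
Qed.
HB.instance Definition _ :=
  isRightAbsorbing.Build G vanishing_ideal vanishing_absorb.

Definition PI_coordinate_ring : algType k := quotient_alg vanishing_ideal.

(* The value at [x] of the function X -> M_n given by a class modulo the     *)
(* vanishing ideal; it does not depend on the representative, see [ev_class].*)
Definition ev (g : PI_coordinate_ring) (x : nv_point X) : 'M[k]_n.+1 :=
  geval (qrepr g) (sval x).

Lemma ev_class p x : ev (qclass vanishing_ideal p) x = geval p (sval x).
Proof.
apply/eqP; rewrite -subr_eq0 -gevalB; apply/eqP.
by have /vanishingP := qclassE vanishing_ideal p; apply; apply: (svalP x).
Qed.

Lemma ev_inj g h : (forall x, ev g x = ev h x) -> g = h.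
Proof.
move=> e; rewrite -[g]qreprK -[h]qreprK; apply/qclassP/vanishingP => a aX.
by rewrite gevalB; apply/eqP; rewrite subr_eq0; apply/eqP/(e (exist _ a aX)).
Qed.

Lemma evD g h x : ev (g + h) x = ev g x + ev h x.
Proof.
rewrite -[g]qreprK -[h]qreprK -qclassD !ev_class.
exact: gevalD.
Qed.
Lemma evM g h x : ev (g * h) x = ev g x * ev h x.
Proof.
rewrite -[g]qreprK -[h]qreprK -[_ * _]/(qmul _ _) qmulE !ev_class.
exact: gevalM.
Qed.
Lemma evZ c g x : ev (c *: g) x = c *: ev g x.
Proof.
rewrite -[g]qreprK -[_ *: qclass _ _]/(qscale _ _) qscaleE !ev_class.
exact: gevalZ.
Qed.
Lemma ev1 x : ev 1 x = 1.
Proof. rewrite -[1]/(qclass _ _) ev_class; exact: geval1. Qed.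

Definition coord_fun (h : 'I_(nv_dim X)) : PI_coordinate_ring :=
  qclass vanishing_ideal (Subalgebra (mem_generator (@generic_matrix k n _) h)).

Lemma ev_coord_fun h x : ev (coord_fun h) x = sval x h.
Proof. by rewrite ev_class; apply: polymx_eval_generic. Qed.

End CoordinateRing.

Definition is_regular_map (X Y : irr_nvariety) (f : nv_point X -> nv_point Y) :=
  exists fs : 'I_(nv_dim Y) -> PI_coordinate_ring X,
    forall x i, sval (f x) i = ev (fs i) x.

Definition regular_map (X Y : irr_nvariety) :=
  {f : nv_point X -> nv_point Y | is_regular_map f}.

Lemma pullback_ex X Y (f : regular_map X Y) (g : PI_coordinate_ring Y) :
  exists h : PI_coordinate_ring X, forall x, ev h x = ev g (sval f x).
Proof.
rewrite -[g]qreprK; move: (qrepr g) => {g} [p /= p_gen].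
pose B : {pred polymx k n (nv_dim Y)} := fun p =>
  `[< exists h : PI_coordinate_ring X,
        forall x, ev h x = polymx_eval (sval (sval f x)) p >].
suff /asboolP[h hE] : p \in B.
  by exists h => x; rewrite ev_class hE.
move/generated_subalgP: p_gen; apply.
  split.
  - by apply/asboolP; exists 1 => x; rewrite ev1 polymx_eval1.
  - move=> c u v /asboolP[h hE] /asboolP[h' h'E].
    apply/asboolP; exists (c *: h + h') => x.
    by rewrite evD evZ polymx_evalD polymx_evalZ hE h'E.
  - move=> u v /asboolP[h hE] /asboolP[h' h'E].
    by apply/asboolP; exists (h * h') => x; rewrite evM polymx_evalM hE h'E.
move=> i; apply/asboolP; case: (svalP f) => fs fsE.
by exists (fs i) => x; rewrite polymx_eval_generic fsE.
Qed.

(* The element of k_n[X] which, as a function on X, is g \o f; it is unique  *)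
(* by [ev_inj].                                                              *)
Definition pullback_fun X Y (f : regular_map X Y) (g : PI_coordinate_ring Y) :
  PI_coordinate_ring X := sval (cid (pullback_ex f g)).

Lemma pullbackE X Y (f : regular_map X Y) g x :
  ev (pullback_fun f g) x = ev g (sval f x).
Proof. exact: (svalP (cid (pullback_ex f g))). Qed.

Section PullbackMorphism.
Variables (X Y : irr_nvariety) (f : regular_map X Y).

Lemma pullback_linear : linear (pullback_fun f).
Proof. by move=> c g h; apply: ev_inj => x; rewrite !(pullbackE, evD, evZ). Qed.
Lemma pullback_monoid : monoid_morphism (pullback_fun f).
Proof.
by split=> [|g h]; apply: ev_inj => x; rewrite !(pullbackE, evM, ev1).
Qed.
HB.instance Definition _ :=
  GRing.isLinear.Build k (PI_coordinate_ring Y) (PI_coordinate_ring X) _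
    (pullback_fun f) pullback_linear.
HB.instance Definition _ :=
  GRing.isMonoidMorphism.Build (PI_coordinate_ring Y) (PI_coordinate_ring X)
    (pullback_fun f) pullback_monoid.

Definition pullback : {lrmorphism PI_coordinate_ring Y -> PI_coordinate_ring X} :=
  pullback_fun f.
End PullbackMorphism.

Lemma regular_id X : is_regular_map (@id (nv_point X)).
Proof. by exists (@coord_fun X) => x i; rewrite ev_coord_fun. Qed.

Lemma regular_comp X Y Z (g : regular_map Y Z) (f : regular_map X Y) :
  is_regular_map (sval g \o sval f).
Proof.
case: (svalP g) => gs gsE.
by exists (fun i => pullback f (gs i)) => x i; rewrite pullbackE /= gsE.
Qed.

Definition regmap_id X : regular_map X X := exist _ _ (@regular_id X).
Definition regmap_comp X Y Z (g : regular_map Y Z) (f : regular_map X Y) :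
  regular_map X Z := exist _ _ (regular_comp g f).

End IrreducibleVarieties.

Record category : Type := Category {
  obj :> Type;
  hom : obj -> obj -> Type;
  idc : forall X, hom X X;
  comp : forall X Y Z, hom Y Z -> hom X Y -> hom X Z;
  comp_idl : forall X Y (f : hom X Y), comp (idc Y) f = f;
  comp_idr : forall X Y (f : hom X Y), comp f (idc X) = f;
  comp_assoc : forall X Y Z W (h : hom Z W) (g : hom Y Z) (f : hom X Y),
    comp h (comp g f) = comp (comp h g) f
}.
Arguments hom {c}.
Arguments idc {c}.
Arguments comp {c X Y Z}.

Definition opposite (C : category) : category :=
  @Category C (fun X Y => hom Y X) (fun X => idc X)
    (fun X Y Z g f => comp f g)
    (fun X Y f => comp_idr f) (fun X Y f => comp_idl f)
    (fun X Y Z W h g f => esym (comp_assoc f g h)).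

Record functor (C D : category) : Type := Functor {
  fobj :> C -> D;
  fmap : forall X Y, hom X Y -> hom (fobj X) (fobj Y);
  fmap_id : forall X, fmap (idc X) = idc (fobj X);
  fmap_comp : forall X Y Z (g : hom Y Z) (f : hom X Y),
    fmap (comp g f) = comp (fmap g) (fmap f)
}.
Arguments fmap {C D} f0 {X Y}.

Definition functor_id (C : category) : functor C C :=
  @Functor C C id (fun X Y f => f) (fun X => erefl) (fun X Y Z g f => erefl).

Lemma fcomp_id (C D E : category) (G : functor D E) (F : functor C D) X :
  fmap G (fmap F (idc X)) = idc (G (F X)).
Proof. by rewrite !fmap_id. Qed.
Lemma fcomp_comp (C D E : category) (G : functor D E) (F : functor C D)
    X Y Z (g : hom Y Z) (f : hom X Y) :
  fmap G (fmap F (comp g f)) = comp (fmap G (fmap F g)) (fmap G (fmap F f)).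
Proof. by rewrite !fmap_comp. Qed.
Definition functor_comp (C D E : category) (G : functor D E) (F : functor C D) :
  functor C E :=
  @Functor C E (fun X => G (F X)) (fun X Y f => fmap G (fmap F f))
    (fcomp_id G F) (@fcomp_comp _ _ _ G F).

Definition is_iso (C : category) (X Y : C) (f : hom X Y) : Prop :=
  exists g : hom Y X, comp g f = idc X /\ comp f g = idc Y.

Definition naturally_isomorphic (C D : category) (F G : functor C D) : Prop :=
  exists eta : forall X, hom (F X) (G X),
    (forall X Y (f : hom X Y),
       comp (eta Y) (fmap F f) = comp (fmap G f) (eta X)) /\
    forall X, is_iso (eta X).

Definition is_equivalence (C D : category) (F : functor C D) : Prop :=
  exists G : functor D C,
    naturally_isomorphic (functor_comp G F) (functor_id C) /\
    naturally_isomorphic (functor_comp F G) (functor_id D).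

Section TheCategories.
Variables (k : closedFieldType) (n : nat).

Lemma regmap_eq (X Y : irr_nvariety k n) (f g : regular_map X Y) :
  sval f = sval g -> f = g.
Proof. by case: f g => [f fP] [g gP] /= e; apply: eq_exist. Qed.

Definition Var_n : category.
Proof.
refine (@Category (irr_nvariety k n) (@regular_map k n) (@regmap_id k n)
  (@regmap_comp k n) _ _ _).
- by move=> X Y f; apply: regmap_eq.
- by move=> X Y f; apply: regmap_eq.
- by move=> X Y Z W h g f; apply: regmap_eq.
Defined.

Definition PIn_object (R : algType k) : Prop :=
  [/\ fin_generated R, prime_ring R, PI_algebra R & has_PI_degree n.+1 R].

Record PI_algebra_n : Type := PIAlgebraN {
  pi_alg :> algType k;
  pi_axiom : PIn_object pi_alg
}.

Definition PIn_morphism (R S : algType k) (alpha : {lrmorphism R -> S}) : Prop :=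
  forall phi : {lrmorphism S -> 'M[k]_n.+1},
    surjective phi -> surjective (phi \o alpha).

Definition PIn_hom (R S : PI_algebra_n) :=
  {alpha : {lrmorphism R -> S} | PIn_morphism alpha}.

Lemma PIn_morphism_id (R : algType k) :
  PIn_morphism (idfun : {lrmorphism R -> R}).
Proof. by []. Qed.

Lemma PIn_morphism_comp (R S T : algType k) (beta : {lrmorphism S -> T})
    (alpha : {lrmorphism R -> S}) :
  PIn_morphism beta -> PIn_morphism alpha ->
  PIn_morphism (beta \o alpha : {lrmorphism R -> T}).
Proof.
move=> hb ha phi sphi.
exact: (ha (phi \o beta : {lrmorphism S -> 'M[k]_n.+1}) (hb phi sphi)).
Qed.

Definition PIn_id (R : PI_algebra_n) : PIn_hom R R :=
  exist _ _ (@PIn_morphism_id R).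
Definition PIn_comp (R S T : PI_algebra_n) (beta : PIn_hom S T)
    (alpha : PIn_hom R S) : PIn_hom R T :=
  exist _ _ (PIn_morphism_comp (svalP beta) (svalP alpha)).

Lemma lrmorphism_eq (R S : algType k) (f g : {lrmorphism R -> S}) :
  (forall x, f x = g x) -> f = g.
Proof.
case: f g => [f [[fa] [fb] [fc]]] [g [[ga] [gb] [gc]]] /= /funext e.
subst g.
by rewrite (Prop_irrelevance fa ga) (Prop_irrelevance fb gb)
  (Prop_irrelevance fc gc).
Qed.

Lemma PIn_hom_eq (R S : PI_algebra_n) (f g : PIn_hom R S) :
  (forall x, sval f x = sval g x) -> f = g.
Proof.
by case: f g => [f fP] [g gP] /= e; apply/eq_exist/lrmorphism_eq.
Qed.

Definition PI_n : category.
Proof.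
refine (@Category PI_algebra_n PIn_hom PIn_id PIn_comp _ _ _).
- by move=> X Y f; apply: PIn_hom_eq.
- by move=> X Y f; apply: PIn_hom_eq.
- by move=> X Y Z W h g f; apply: PIn_hom_eq.
Defined.

(* That k_n[X] is in PI_n and that f^* is a morphism of PI_n are part of the *)
(* theorem, hence the two parameters.                                        *)
Section CoordinateFunctor.
Variable objP : forall X : irr_nvariety k n,
  PIn_object (PI_coordinate_ring X).
Variable morP : forall (X Y : irr_nvariety k n) (f : regular_map X Y),
  PIn_morphism (pullback f).

Definition coord_obj (X : opposite Var_n) : PI_n := PIAlgebraN (objP X).
Definition coord_map (Y X : opposite Var_n) (f : hom Y X) :
  hom (coord_obj Y) (coord_obj X) := exist _ (pullback f) (morP f).

Lemma coord_map_id X : coord_map (idc X) = idc (coord_obj X).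
Proof.
by apply: PIn_hom_eq => g; apply: ev_inj => x; rewrite /= pullbackE.
Qed.
Lemma coord_map_comp (X Y Z : opposite Var_n) (g : hom Y Z) (f : hom X Y) :
  coord_map (comp g f) = comp (coord_map g) (coord_map f).
Proof.
by apply: PIn_hom_eq => p; apply: ev_inj => x; rewrite /= !pullbackE.
Qed.

Definition coordinate_functor : functor (opposite Var_n) PI_n :=
  Functor coord_map_id coord_map_comp.
End CoordinateFunctor.

End TheCategories.

Arguments PIn_object {k} n R.
Arguments PIn_morphism {k} n {R S} alpha.

(* Main.v *)
From HB Require Import structures.
From mathcomp Require Import fingroup perm.
From mathcomp Require Import all_boot all_order all_algebra.
From mathcomp Require Import generic_quotient.
From mathcomp Require Import zify ring.
From mathcomp Require Import boolp.
From mathcomp Require Import mpoly.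
From mathcomp Require finmap monalg.
Require Import Defs.

Set Implicit Arguments.
Unset Strict Implicit.
Unset Printing Implicit Defensive.

Import GRing.Theory.
Local Open Scope ring_scope.

(** Let [N = n + 1].  A morphism of coordinate rings in [PI_n] is recovered from
    its effect on points, because a surjective homomorphism from a coordinate
    ring onto [N] by [N] matrices is the evaluation at a point ([point_of_hom]).
    Hence the functor is full and faithful; it is essentially surjective because
    an algebra [R] of [PI_n] is the ring of functions on the variety of its
    surjective representations ([coord_ring_alg_variety]).  Everything rests on
    three facts.

    Separation ([separation]).  If a generating tuple [a] is not on the variety
    [X], some element of the generic matrix ring vanishes on [X] and not at [a].
    Let [p] be a polynomial vanishing on [X] and not at [a].  An alternating
    product of [N ^ 2] matrices is their determinant times a fixed matrix [C]
    (Capelli, [altprod_det]), so that polynomials in such determinants, times a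
    power of [C], belong to the generic matrix ring.  Fix an element [r] of that
    ring.  At an eigenvalue [z] of [r x], determinants in which all rows but one
    are multiples of [z - r] give linear forms [y |-> f y u], where [f] and [u]
    are eigenvectors of [r x] ([rank_one_det]).  These forms express, with
    determinants only, the coordinates of a conjugate of [x], where [p] can be
    evaluated.  The result is a polynomial in [z] which vanishes at all the
    eigenvalues of [r x] when [x] is on [X]; its [N]-th power vanishes at
    [z = r x] by the Cayley-Hamilton theorem.  This works in all
    characteristics, and over the variety itself: no eigenvalue has to be
    adjoined, since [r] takes its place.

    Representations ([PI_representation]).  A nonzero element [x] of an algebra
    [R] of [PI_n] has a nonzero image under a surjective representation of [R].
    The ring of fractions [Q] of [R] has dimension [N ^ 2] over its center, and
    left and right multiplications generate all the linear operators on it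
    (Jacobson density).  In a basis taken from [R], the right multiplications by
    the elements of [R], together with the coefficients of the operators that
    separate the basis, involve finitely many scalars.  A specialization of
    these scalars in [k] (Nullstellensatz) yields a simple algebra of dimension
    [N ^ 2] over [k], that is, the algebra of [N] by [N] matrices.  By
    separation again, and because orbits are irreducible, the variety of the
    representations of [R] is irreducible when [R] is prime.

    Coordinate rings ([coord_ring_object]).  Functions on an irreducible variety
    form a domain, with fraction field [K], and [k_n[X]] consists of matrices
    over [K].  The quotients of polynomials of the same degree in the
    determinants above form a subfield [F] of [K].  By Cramer's rule the
    coordinates of [k_n[X]] in a basis lie in [F], and powers of a Capelli
    matrix provide denominators; hence the [F]-span of [k_n[X]] is its ring of
    fractions, a central simple algebra of dimension [N ^ 2]. *)

(** * Alternating products *)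

(** The Capelli polynomial, with a multiplier on each side of every argument;
    the standard polynomial is the case where all the multipliers are [1]. *)
Definition altprod (A : nzRingType) (p : nat) (L R y : 'I_p -> A) : A :=
  \sum_(s : 'S_p) (-1) ^+ s * \prod_(l < p) (L l * y (s l) * R l).

Lemma rmorph_altprod (A B : nzRingType) (f : {rmorphism A -> B}) p
    (L R y : 'I_p -> A) :
  f (altprod L R y) = altprod (f \o L) (f \o R) (f \o y).
Proof.
rewrite rmorph_sum; apply: eq_bigr => s _.
rewrite rmorphM rmorph_sign rmorph_prod; congr (_ * _).
by apply: eq_bigr => l _; rewrite !rmorphM.
Qed.

Lemma eq_altprod (A : nzRingType) p (L L' R R' y y' : 'I_p -> A) :
  L =1 L' -> R =1 R' -> y =1 y' -> altprod L R y = altprod L' R' y'.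
Proof.
move=> eL eR ey; apply: eq_bigr => s _; congr (_ * _).
by apply: eq_bigr => l _; rewrite eL eR ey.
Qed.

Section Capelli.
Variable n : nat.

(** The cells of a matrix are numbered, so that [d] matrices can be taken as
    the rows of a square matrix and have a determinant. *)
Definition mxcells : nat := #|{: 'I_n.+1 * 'I_n.+1}|.
Local Notation d := mxcells.

Lemma mxcellsE : d = (n.+1 ^ 2)%N.
Proof. by rewrite /d card_prod card_ord. Qed.

Definition cell (i j : 'I_n.+1) : 'I_d := enum_rank (i, j).
Definition cell_row (q : 'I_d) : 'I_n.+1 := (enum_val q).1.
Definition cell_col (q : 'I_d) : 'I_n.+1 := (enum_val q).2.

Lemma cell_rowK i j : cell_row (cell i j) = i.
Proof. by rewrite /cell_row enum_rankK. Qed.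
Lemma cell_colK i j : cell_col (cell i j) = j.
Proof. by rewrite /cell_col enum_rankK. Qed.
Lemma cellK q : cell (cell_row q) (cell_col q) = q.
Proof. by rewrite /cell /cell_row /cell_col -surjective_pairing enum_valK. Qed.

Lemma cell_eq i j q : (q == cell i j) = (cell_row q == i) && (cell_col q == j).
Proof.
apply/eqP/andP => [-> | [/eqP<- /eqP<-]]; last by rewrite cellK.
by rewrite cell_rowK cell_colK.
Qed.

Definition unit_cell (K : nzRingType) (q : 'I_d) : 'M[K]_n.+1 :=
  delta_mx (cell_row q) (cell_col q).

Definition entry_row (K : nzRingType) (A : 'M[K]_n.+1) : 'rV[K]_d :=
  \row_q A (cell_row q) (cell_col q).

Definition entry_mx (K : nzRingType) p (y : 'I_p -> 'M[K]_n.+1) : 'M[K]_(p, d) :=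
  \matrix_(l, q) y l (cell_row q) (cell_col q).

Lemma sum_cells (V : nmodType) (F : 'I_n.+1 -> 'I_n.+1 -> V) :
  \sum_i \sum_j F i j = \sum_(q < d) F (cell_row q) (cell_col q).
Proof.
rewrite pair_big /= (reindex (@enum_val _ {: 'I_n.+1 * 'I_n.+1})) //=.
by apply: onW_bij; exact: enum_val_bij.
Qed.

Lemma sum_unit_cell (K : nzRingType) (A : 'M[K]_n.+1) :
  A = \sum_q A (cell_row q) (cell_col q) *: unit_cell K q.
Proof. by rewrite [LHS]matrix_sum_delta sum_cells. Qed.

Variable K : comNzRingType.
Implicit Types L R y : 'I_d -> 'M[K]_n.+1.

(** Expanding every matrix over the matrix units turns an alternating product
    into minors of the matrix of entries: the only choices of units that
    survive the alternation are those which select independent columns. *)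
Lemma altprod_minors p (L R y : 'I_p -> 'M[K]_n.+1) :
  altprod L R y = \sum_(f : {ffun 'I_p -> 'I_d})
    \det (\matrix_(l, l') entry_mx y l (f l')) *:
    \prod_(l < p) (L l * unit_cell K (f l) * R l).
Proof.
transitivity (\sum_(s : 'S_p) \sum_(f : {ffun 'I_p -> 'I_d})
   ((-1) ^+ s * \prod_l entry_mx y (s l) (f l)) *:
    \prod_(l < p) (L l * unit_cell K (f l) * R l)).
  apply: eq_bigr => s _.
  under eq_bigr => l _.
    rewrite [y (s l)]sum_unit_cell mulr_sumr mulr_suml.
    under eq_bigr => q _ do rewrite -scalerAr -scalerAl.
    over.
  rewrite bigA_distr_bigA mulr_sumr; apply: eq_bigr => f _.
  have sgnE (B : 'M[K]_n.+1) : (-1) ^+ s * B = (-1) ^+ s *: B.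
    by rewrite mulr_sign scaler_sign.
  rewrite scaler_prod sgnE scalerA.
  by under [X in _ = (_ * X) *: _]eq_bigr do rewrite mxE.
rewrite exchange_big; apply: eq_bigr => f _; rewrite -scaler_suml.
congr (_ *: _); rewrite -det_tr; apply: eq_bigr => s _; congr (_ * _).
by apply: eq_bigr => l _; rewrite !mxE.
Qed.

(** The space of matrices has dimension [d], so an alternating product of [d]
    arguments depends on them only through one determinant. *)
Lemma altprod_det L R y :
  altprod L R y = \det (entry_mx y) *: altprod L R (unit_cell K).
Proof.
rewrite !altprod_minors scaler_sumr; apply: eq_bigr => f _.
rewrite scalerA; congr (_ *: _).
rewrite -det_mulmx; congr (\det _); apply/matrixP => l l'; rewrite !mxE.
rewrite (bigD1 (f l')) //= !mxE !eqxx mulr1 big1 ?addr0 // => q /negPf qf.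
rewrite !mxE -[_ && _]/((_, _) == (_, _) :> 'I_n.+1 * 'I_n.+1).
rewrite -!surjective_pairing (inj_eq enum_val_inj) eq_sym qf.
by rewrite mulr0.
Qed.

(** All the minors vanish, as two of their columns coincide. *)
Lemma altprod_eq0 p (L R y : 'I_p -> 'M[K]_n.+1) : (d < p)%N -> altprod L R y = 0.
Proof.
move=> ltdp; rewrite altprod_minors big1 // => f _.
have /injectivePn[l [l' ll' eqf]] : ~~ injectiveb f.
  apply/negP => /injectiveP /leq_card; rewrite !card_ord leqNgt => /negP; exact.
rewrite -det_tr (determinant_alternate ll') ?scale0r // => j.
by rewrite !mxE eqf.
Qed.

Lemma expr_delta_mx00 e : (0 < e)%N ->
  (delta_mx 0 0 : 'M[K]_n.+1) ^+ e = delta_mx 0 0.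
Proof.
case: e => // e _; elim: e => [|e IH]; first by rewrite expr1.
by rewrite exprS IH -mulmxE mul_delta_mx.
Qed.

(** With the matrix units [L l = e_(0,i)] and [R l = e_(j,0)], where [(i, j)]
    is the cell [l], only the identity permutation contributes. *)
Lemma altprod_unit_cells :
  altprod (fun l => unit_cell K (cell 0 (cell_row l)))
    (fun l => unit_cell K (cell (cell_col l) 0)) (unit_cell K)
  = delta_mx 0 0.
Proof.
rewrite /altprod (bigD1 1%g) //= [X in _ + X]big1 ?addr0 => [|s sn1].
  rewrite odd_perm1 expr0 mul1r.
  rewrite (eq_bigr (fun=> delta_mx 0 0)) => [|l _]; last first.
    by rewrite perm1 /unit_cell !cell_rowK !cell_colK -!mulmxE !mul_delta_mx.
  have -> := prodr_const 'I_d (delta_mx 0 0 : 'M[K]_n.+1).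
  by rewrite card_ord expr_delta_mx00 // mxcellsE expn_gt0.
have [l sl] : exists l, s l != l.
  apply/existsP; rewrite -negb_forall; apply: contra sn1 => /forallP s1.
  by apply/eqP/perm.permP => l; rewrite perm1; apply/eqP.
suff -> : \prod_(l0 < d) (unit_cell K (cell 0 (cell_row l0)) *
   unit_cell K (s l0) * unit_cell K (cell (cell_col l0) 0)) = 0 by rewrite mulr0.
have: l \in index_enum 'I_d by rewrite mem_index_enum.
elim: (index_enum _) => [//|l1 r IH]; rewrite inE big_cons.
case: eqVneq => [<- _ | _ /IH->]; last by rewrite mulr0.
rewrite /unit_cell !cell_rowK !cell_colK -!mulmxE.
have : (s l) != cell (cell_row l) (cell_col l) by rewrite cellK.
rewrite cell_eq negb_and => /orP[ne|ne].
  by rewrite mul_delta_mx_0 ?mul0mx // eq_sym.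
by rewrite -[delta_mx 0 _ *m _ *m _]mulmxA mul_delta_mx_0 ?mulmx0 ?mul0mx.
Qed.

End Capelli.

(** * Density *)

Section Density.
Variables (M : zmodType) (E : (M -> M) -> Prop).

Definition commutes_with (delta : M -> M) : Prop :=
  {morph delta : x y / x + y} /\
  forall T, E T -> forall x, delta (T x) = T (delta x).

Hypothesis E_add : forall T, E T -> {morph T : x y / x - y}.
Hypothesis E_sub : forall T U, E T -> E U -> E (fun x => T x - U x).
Hypothesis E_comp : forall T U, E T -> E U -> E (T \o U).
Hypothesis E_simple : forall x y, x != 0 -> exists2 T, E T & T x = y.

Let E0 T : E T -> T 0 = 0.
Proof. by move=> /E_add TB; rewrite -[0 in LHS](subrr 0) TB subrr. Qed.

(** Jacobson density for a simple module [M] over the operators [E].  If the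
    operators killing the tail of [xs] do not kill its head [x], then they
    carry [x] onto any vector, and [T x |-> T y] is a well-defined map
    commuting with [E]; subtracting it from [y] removes [x] from the list. *)
Lemma density (xs : seq M) y :
  (forall T, E T -> (forall x, x \in xs -> T x = 0) -> T y = 0) ->
  exists2 delta : nat -> M -> M, (forall i, commutes_with (delta i)) &
    y = \sum_(i < size xs) delta i xs`_i.
Proof.
elim: xs y => [|x xs IH] y kill.
  have y0 : y = 0.
    apply/eqP/negP => /negP y0; have [T ET Ty] := E_simple y y0.
    by move: y0; rewrite -Ty kill // eqxx.
  exists (fun _ => id); first by [].
  by rewrite big_ord0.
pose J T := E T /\ forall z, z \in xs -> T z = 0.
have [Jx|nJx] := pselect (forall T, J T -> T x = 0).
  have [T ET Tz|delta dE ->] := IH y.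
    by apply: kill => // z; rewrite inE => /orP[/eqP->|/Tz//]; apply: Jx.
  exists (fun i => if i is i'.+1 then delta i' else fun _ => 0) => [[|i]|] //.
    by split=> [u v | T /E0]; rewrite ?addr0.
  by rewrite big_ord_recl /= add0r.
have [T0 [JT0 T0x]] : exists T, J T /\ T x != 0.
  apply: contrapT => ne; apply: nJx => T JT; apply/eqP/negP => /negP Tx.
  by apply: ne; exists T.
have choose m : exists T, J T /\ T x = m.
  have [S ES Sx] := E_simple m T0x; exists (S \o T0); split=> //; split.
    by apply: E_comp => //; case: JT0.
  by move=> z zxs /=; case: JT0 => _ ->; rewrite // E0.
have uniq T U : J T -> J U -> T x = U x -> T y = U y.
  move=> [ET Tz] [EU Uz] eTU; apply/eqP; rewrite -subr_eq0; apply/eqP.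
  apply: (kill (fun z => T z - U z)); first exact: E_sub.
  move=> z; rewrite inE => /orP[/eqP->|zxs]; first by rewrite eTU subrr.
  by rewrite Tz // Uz // subrr.
pose T_ m := sval (cid (choose m)).
have JT_ m : J (T_ m) by case: (svalP (cid (choose m))).
have T_x m : T_ m x = m by case: (svalP (cid (choose m))).
pose delta0 m := T_ m y.
have d0P U : J U -> delta0 (U x) = U y by move=> JU; apply: (uniq (T_ (U x)) U).
have JB T U : J T -> J U -> J (fun z => T z - U z).
  move=> [ET Tz] [EU Uz]; split; first exact: E_sub.
  by move=> z zxs; rewrite Tz // Uz // subrr.
have d0B : {morph delta0 : u v / u - v}.
  by move=> u v; have := d0P _ (JB _ _ (JT_ u) (JT_ v)); rewrite /= !T_x.
have d0E T : E T -> forall m, delta0 (T m) = T (delta0 m).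
  move=> ET m; have JT : J (T \o T_ m).
    case: (JT_ m) => ETm Tmz; split; first exact: E_comp.
    by move=> z zxs /=; rewrite Tmz // E0.
  by have := d0P _ JT; rewrite /= T_x.
have d00 : delta0 0 = 0 by rewrite -[0 in LHS](subrr 0) d0B subrr.
have d0D : {morph delta0 : u v / u + v}.
  by move=> u v; rewrite -[v in LHS]opprK d0B -[- v]sub0r d0B d00 sub0r opprK.
have [T ET Tz|delta dE ey] := IH (y - delta0 x).
  by rewrite (E_add ET) -d0E // d0P // subrr.
exists (fun i => if i is i'.+1 then delta i' else delta0) => [[|i]|] //.
by rewrite big_ord_recl /= -ey addrC subrK.
Qed.

End Density.

(** * Specialization of finitely many scalars *)

Section Specialization.
Variables (k : closedFieldType) (F : fieldType) (iota : {rmorphism k -> F}).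
Implicit Types (S : {pred F}) (psi : F -> k).

Definition specializes S psi : Prop :=
  [/\ {in S &, forall x y, psi (x - y) = psi x - psi y},
      {in S &, forall x y, psi (x * y) = psi x * psi y}
    & forall c, psi (iota c) = c].

Definition scalar_subring S : Prop :=
  GRing.subring_closed S /\ forall c, iota c \in S.

Definition polyover S : {pred {poly F}} := fun p => `[< forall i, p`_i \in S >].

Lemma polyoverP S (p : {poly F}) : reflect (forall i, p`_i \in S) (p \in polyover S).
Proof. exact: asboolP. Qed.

(** Avoiding any given nonzero element is what makes the existence of
    specializations propagate from a ring to an extension generated by one
    element. *)
Definition many_specializations S : Prop :=
  forall b, b \in S -> b != 0 -> exists2 psi, specializes S psi & psi b != 0.

Section SubringTheory.
Variables (S : {pred F}).
Hypothesis Ssub : scalar_subring S.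

Lemma scal1 : 1 \in S. Proof. by case: Ssub => -[]. Qed.
Lemma scalB x y : x \in S -> y \in S -> x - y \in S.
Proof. by case: Ssub => -[_ h _] _; apply: h. Qed.
Lemma scalM x y : x \in S -> y \in S -> x * y \in S.
Proof. by case: Ssub => -[_ _ h] _; apply: h. Qed.
Lemma scal0 : 0 \in S. Proof. by rewrite -(subrr 1) scalB ?scal1. Qed.
Lemma scalN x : x \in S -> - x \in S.
Proof. by move=> xS; rewrite -sub0r scalB ?scal0. Qed.
Lemma scalD x y : x \in S -> y \in S -> x + y \in S.
Proof. by move=> xS yS; rewrite -[y]opprK scalB ?scalN. Qed.

End SubringTheory.

Section OnePsi.
Variables (S : {pred F}) (psi : F -> k).
Hypotheses (Ssub : scalar_subring S) (psiS : specializes S psi).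

Let S1 := scal1 Ssub.
Let SB := scalB Ssub.
Let SM := scalM Ssub.
Let S0 := scal0 Ssub.
Let SN := scalN Ssub.
Let SD := scalD Ssub.

Lemma spec0 : psi 0 = 0.
Proof. by case: psiS => _ _ h; rewrite -(rmorph0 iota) h. Qed.
Lemma spec1 : psi 1 = 1.
Proof. by case: psiS => _ _ h; rewrite -(rmorph1 iota) h. Qed.
Lemma specB x y : x \in S -> y \in S -> psi (x - y) = psi x - psi y.
Proof. by case: psiS => h _ _; apply: h. Qed.
Lemma specM x y : x \in S -> y \in S -> psi (x * y) = psi x * psi y.
Proof. by case: psiS => _ h _; apply: h. Qed.
Lemma specN x : x \in S -> psi (- x) = - psi x.
Proof. by move=> xS; rewrite -sub0r specB // spec0 sub0r. Qed.
Lemma specD x y : x \in S -> y \in S -> psi (x + y) = psi x + psi y.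
Proof. by move=> xS yS; rewrite -[y]opprK specB ?SN // specN ?opprK // SN. Qed.

Lemma spec_sum I (r : seq I) (G : I -> F) : (forall i, G i \in S) ->
  \sum_(i <- r) G i \in S /\
  psi (\sum_(i <- r) G i) = \sum_(i <- r) psi (G i).
Proof.
move=> GS; elim: r => [|i r [IHS IH]]; first by rewrite !big_nil S0 spec0.
by rewrite !big_cons SD // specD // IH.
Qed.

Lemma specX x e : x \in S -> x ^+ e \in S /\ psi (x ^+ e) = psi x ^+ e.
Proof.
move=> xS; elim: e => [|e [IHS IH]]; first by rewrite !expr0 S1 spec1.
by rewrite !exprS SM // specM // IH.
Qed.

Lemma spec_polyM p q : p \in polyover S -> q \in polyover S ->
  map_poly psi (p * q) = map_poly psi p * map_poly psi q.
Proof.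
move=> /polyoverP pS /polyoverP qS; apply/polyP => i.
rewrite coef_map_id0 ?spec0 // !coefM.
have [|_ ->] := @spec_sum _ (index_enum 'I_i.+1)
  (fun j : 'I_i.+1 => p`_j * q`_(i - j)); first by move=> j; apply: SM.
by apply: eq_bigr => j _; rewrite !coef_map_id0 ?spec0 // specM.
Qed.

Lemma spec_polyD p q : p \in polyover S -> q \in polyover S ->
  map_poly psi (p + q) = map_poly psi p + map_poly psi q.
Proof.
move=> /polyoverP pS /polyoverP qS; apply/polyP => i.
by rewrite coef_map_id0 ?spec0 // !coefD !coef_map_id0 ?spec0 // specD.
Qed.

Lemma spec_polyB p q : p \in polyover S -> q \in polyover S ->
  map_poly psi (p - q) = map_poly psi p - map_poly psi q.
Proof.
move=> /polyoverP pS /polyoverP qS; apply/polyP => i.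
by rewrite coef_map_id0 ?spec0 // !coefB !coef_map_id0 ?spec0 // specB.
Qed.

Lemma spec_polyC c : map_poly psi c%:P = (psi c)%:P.
Proof.
by apply/polyP => i; rewrite coef_map_id0 ?spec0 // !coefC; case: ifP; rewrite ?spec0.
Qed.

Lemma spec_polyZ c p : c \in S -> p \in polyover S ->
  map_poly psi (c *: p) = psi c *: map_poly psi p.
Proof.
move=> cS /polyoverP pS; apply/polyP => i.
by rewrite coef_map_id0 ?spec0 // !coefZ coef_map_id0 ?spec0 // specM.
Qed.

Lemma polyOverS_subring : GRing.subring_closed (polyover S).
Proof.
split.
- by apply/polyoverP => i; rewrite coefC; case: ifP.
- move=> p q /polyoverP pS /polyoverP qS.
  by apply/polyoverP => i; rewrite coefB SB.
- move=> p q /polyoverP pS /polyoverP qS; apply/polyoverP => i; rewrite coefM.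
  by elim/big_ind: _ => //= j _; apply: SM.
Qed.

Lemma polyOverSC c : c \in S -> c%:P \in polyover S.
Proof. by move=> cS; apply/polyoverP => i; rewrite coefC; case: ifP. Qed.
Lemma polyOverSZ c p : c \in S -> p \in polyover S -> c *: p \in polyover S.
Proof. by move=> cS /polyoverP pS; apply/polyoverP => i; rewrite coefZ SM. Qed.
Lemma polyOverSX m : 'X^m \in polyover S.
Proof. by apply/polyoverP => i; rewrite coefXn; case: eqP. Qed.

End OnePsi.

Section Extend.
Variables (S : {pred F}) (u : F).
Hypotheses (Ssub : scalar_subring S) (Sspec : many_specializations S).
Local Notation SX := (polyover S).

Let SXB p q : p \in SX -> q \in SX -> p - q \in SX.
Proof. by move=> pS qS; case: (polyOverS_subring Ssub) => _ h _; apply: h. Qed.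
Let SXM p q : p \in SX -> q \in SX -> p * q \in SX.
Proof. by move=> pS qS; case: (polyOverS_subring Ssub) => _ _ h; apply: h. Qed.
Let SX1 : 1 \in SX.
Proof. by case: (polyOverS_subring Ssub). Qed.
Let SX0 : 0 \in SX.
Proof. by rewrite -(subrr 1) SXB. Qed.
Let SXD p q : p \in SX -> q \in SX -> p + q \in SX.
Proof. by move=> pS qS; rewrite -[q]opprK -[- q]sub0r SXB // SXB. Qed.

Definition adjoin : {pred F} := fun x => `[< exists2 p, p \in SX & x = p.[u] >].

Lemma adjoin_sub : scalar_subring adjoin.
Proof.
split; first split.
- by apply/asboolP; exists 1; rewrite ?hornerC.
- move=> x y /asboolP[p pS ->] /asboolP[q qS ->]; apply/asboolP.
  by exists (p - q); rewrite ?SXB // hornerD hornerN.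
- move=> x y /asboolP[p pS ->] /asboolP[q qS ->]; apply/asboolP.
  by exists (p * q); rewrite ?SXM // hornerM.
- move=> c; apply/asboolP; exists (iota c)%:P; rewrite ?hornerC //.
  by apply: polyOverSC => //; case: Ssub.
Qed.

Lemma adjoin_incl x : x \in S -> x \in adjoin.
Proof.
by move=> xS; apply/asboolP; exists x%:P; rewrite ?hornerC // polyOverSC.
Qed.

Lemma adjoin_gen : u \in adjoin.
Proof. by apply/asboolP; exists 'X; rewrite ?hornerX // -['X]expr1 polyOverSX. Qed.

(** A specialization extends to [u |-> t] as soon as [t] satisfies the images
    of all the relations of [u]. *)
Lemma extend_spec psi t : specializes S psi ->
  (forall p, p \in SX -> p.[u] = 0 -> (map_poly psi p).[t] = 0) ->
  exists2 psi', specializes adjoin psi' &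
    forall p, p \in SX -> psi' p.[u] = (map_poly psi p).[t].
Proof.
move=> psiS rel.
pose psi' x := if pselect (exists2 p, p \in SX & x = p.[u]) is left e
  then (map_poly psi (s2val (cid2 e))).[t] else 0.
have psi'E p : p \in SX -> psi' p.[u] = (map_poly psi p).[t].
  move=> pS; rewrite /psi'; case: pselect => [e|]; last by case; exists p.
  case: (cid2 e) => /= q qS eq; apply/eqP; rewrite -subr_eq0; apply/eqP.
  rewrite -hornerN -hornerD -(spec_polyB psiS) //.
  by apply: rel; rewrite ?SXB // hornerD hornerN eq subrr.
exists psi' => //; split.
- move=> _ _ /asboolP[p pS ->] /asboolP[q qS ->].
  by rewrite -hornerN -hornerD !psi'E ?SXB // (spec_polyB psiS) // hornerD hornerN.
- move=> _ _ /asboolP[p pS ->] /asboolP[q qS ->].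
  by rewrite -hornerM !psi'E ?SXM // (spec_polyM Ssub psiS) // hornerM.
- move=> c; rewrite -[iota c](hornerC _ u) psi'E; last first.
    by apply: polyOverSC => //; case: Ssub.
  by rewrite (spec_polyC psiS) hornerC; case: psiS.
Qed.

(** Division with a remainder, the leading coefficient of [f] being not
    invertible in [S]. *)
Lemma pseudo_division f p : f != 0 -> f \in SX -> p \in SX ->
  exists e q r, [/\ q \in SX, r \in SX, lead_coef f ^+ e *: p = q * f + r
    & (size r < size f)%N].
Proof.
move=> f0 fS; have [m] := ubnP (size p); elim: m p => // m IH p ltm pS.
have [ltpf|lefp] := ltnP (size p) (size f).
  by exists 0, 0, p; rewrite expr0 scale1r mul0r add0r.
have p0 : p != 0 by rewrite -size_poly_gt0 (leq_trans _ lefp) // size_poly_gt0.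
have lS g : g \in SX -> lead_coef g \in S by move/polyoverP; apply.
pose h := lead_coef p *: 'X^(size p - size f).
have hS : h \in SX by rewrite polyOverSZ ?lS ?polyOverSX.
pose p1 := lead_coef f *: p - h * f.
have p1S : p1 \in SX by rewrite SXB ?SXM // polyOverSZ ?lS.
have ltp1 : (size p1 < m)%N.
  have sp : (0 < size p)%N by rewrite size_poly_gt0.
  suff lt : (size p1 < size p)%N by apply: leq_trans lt _; rewrite -ltnS.
  rewrite -(prednK sp) ltnS; apply/leq_sizeP => j lej.
  rewrite /p1 /h -scalerAl coefB !coefZ coefXnM.
  have sf : (0 < size f)%N by rewrite size_poly_gt0.
  have [ltj|gej] := ltnP j (size p - size f).
    have arith a b : (a.-1 <= j)%N -> (0 < b)%N -> (b <= a)%N -> (j < a - b)%N ->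
      False by clear; lia.
    by case: (arith _ _ lej sf lefp ltj).
  move: lej; rewrite leq_eqVlt => /orP[/eqP<-|ltj].
    have arith a b : (0 < b)%N -> (b <= a)%N -> (a.-1 - (a - b) = b.-1)%N by clear; lia.
    rewrite arith //.
    by rewrite -!lead_coefE mulrC subrr.
  have arith a b : (b <= a)%N -> (a.-1 < j)%N -> (a - b <= j)%N ->
      ((b <= j - (a - b)) && (a <= j))%N by clear; lia.
  have /andP[lef lep] := arith _ _ lefp ltj gej.
  by rewrite !nth_default ?mulr0 ?subr0.
have [e [q [r [qS rS er ltr]]]] := IH p1 ltp1 p1S.
exists e.+1, (lead_coef f ^+ e *: h + q), r; split=> //.
  rewrite SXD // polyOverSZ //.
  by elim: (e) => [|e' IHe]; rewrite ?expr0 ?exprS;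
     case: Ssub => -[S1 _ SM] _ //; rewrite SM ?lS.
rewrite exprSr -scalerA -[lead_coef f *: p](subrK (h * f)) -/p1 scalerDr er.
by rewrite mulrDl scalerAl addrC addrA.
Qed.

(** If [u] is transcendental over [S], any [t] will do, except the roots of the
    specialized polynomial [g].  If [u] is algebraic, let [f] be a relation of
    minimal degree and [t] a root of its specialization.  Since all relations
    are multiples of [f] up to a power of its leading coefficient, they hold at
    [t] if that coefficient does not specialize to [0].  Moreover some
    combination of [g] and [f] is a nonzero constant [a1]; if [a1] does not
    specialize to [0] either, then [g] does not vanish at [t]. *)
Lemma specialize_adjoin : many_specializations adjoin.
Proof.
move=> _ /asboolP[g gS ->] gu0.
have lS p : p \in SX -> lead_coef p \in S by move/polyoverP; apply.
have SM x y : x \in S -> y \in S -> x * y \in S by case: Ssub => -[_ _ h] _; apply: h.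
have [trans|alg] := pselect (forall p, p \in SX -> p.[u] = 0 -> p = 0).
  have g0 : g != 0 by apply: contraNneq gu0 => ->; rewrite horner0.
  have [|psi psiS psig] := Sspec (lS g gS); first by rewrite lead_coef_eq0.
  have : map_poly psi g != 0.
    apply: contraNneq psig => /(congr1 (fun p : {poly k} => p`_(size g).-1)).
    by rewrite coef0 coef_map_id0 ?(spec0 psiS) // -lead_coefE => ->.
  move=> /closed_nonrootP[t]; rewrite rootE => gt.
  have [p pS pu|psi' psi'S psi'E] := @extend_spec psi t psiS.
    by rewrite (trans p pS pu) map_poly0 horner0.
  by exists psi'; rewrite // psi'E.
(* a relation of minimal degree *)
have exf : exists m, `[< exists p, [/\ p \in SX, p.[u] = 0, p != 0 & size p = m] >].
  apply: contrapT => ne; apply: alg => p pS pu; apply/eqP/negP => /negP p0.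
  by apply: ne; exists (size p); apply/asboolP; exists p.
case: (ex_minnP exf) => _ /asboolP[f [fS fu f0 <-]] minf.
have small p : p \in SX -> p.[u] = 0 -> (size p < size f)%N -> p = 0.
  move=> pS pu; rewrite ltnNge => /negP lep; apply/eqP/negP => /negP p0.
  by apply: lep; apply: minf; apply/asboolP; exists p.
(* a combination of minimal degree among those that do not vanish at u *)
pose comb w := exists h l, [/\ h \in SX, l \in SX & w = h * g + l * f].
have combS w : comb w -> w \in SX.
  by move=> [h [l [hS lS' ->]]]; rewrite SXD ?SXM.
have exw : exists m, `[< exists w, [/\ comb w, w.[u] != 0 & size w = m] >].
  exists (size g); apply/asboolP; exists g; split=> //; exists 1, 0.
  by rewrite mul1r mul0r addr0.
case: (ex_minnP exw) => _ /asboolP[w [wc wu <-]] minw.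
have w0 : w != 0 by apply: contraNneq wu => ->; rewrite horner0.
have minw' w' : comb w' -> (size w' < size w)%N -> w'.[u] = 0.
  move=> w'c; rewrite ltnNge => /negP lt; apply/eqP/negP => /negP w'u.
  by apply: lt; apply: minw; apply/asboolP; exists w'.
have lX p e : p \in SX -> lead_coef p ^+ e \in S.
  move=> pS; elim: e => [|e IH]; rewrite ?expr0 ?exprS; last by rewrite SM ?lS.
  by case: Ssub => -[].
have sw : (size w < size f)%N.
  rewrite ltnNge; apply/negP => lefw.
  have [e [q [r [qS rS er ltr]]]] := pseudo_division f0 fS (combS w wc).
  have erE : r = lead_coef f ^+ e *: w - q * f by rewrite er addrC addKr.
  have rc : comb r.
    case: wc => h [l [hS lS' wE]]; exists (lead_coef f ^+ e *: h).
    exists (lead_coef f ^+ e *: l - q).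
    rewrite polyOverSZ ?lX // SXB ?polyOverSZ ?lX //; split=> //.
    by rewrite erE wE scalerDr !scalerAl mulrBl addrA.
  have := minw' r rc (leq_trans ltr lefw).
  rewrite erE hornerD hornerN hornerM fu mulr0 subr0 hornerZ => /eqP.
  by rewrite mulf_eq0 (negPf wu) orbF expf_eq0 lead_coef_eq0 (negPf f0) andbF.
have sw1 : size w = 1%N.
  have [e [q [r [qS rS er ltr]]]] := pseudo_division w0 (combS w wc) fS.
  have rE : r = lead_coef w ^+ e *: f - q * w by rewrite er addrC addKr.
  have rc : comb r.
    case: wc => h [l [hS lS' wE]].
    exists (- (q * h)), ((lead_coef w ^+ e)%:P - q * l).
    rewrite -sub0r SXB ?SXM // SXB ?SXM //; last first.
      by rewrite polyOverSC // lX // combS //; exists h, l.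
    split=> //; rewrite rE -mul_polyC; move: (_%:P) => c.
    by rewrite wE; ring.
  have ru := minw' r rc ltr.
  have r0 : r = 0 by apply: small => //; apply: ltn_trans sw.
  move: er; rewrite r0 addr0 => er.
  have qu : q.[u] = 0.
    move/(congr1 (horner^~ u)): er; rewrite hornerZ fu mulr0 hornerM => /esym/eqP.
    by rewrite mulf_eq0 (negPf wu) orbF => /eqP.
  have lw0 : lead_coef w ^+ e != 0 by rewrite expf_neq0 // lead_coef_eq0.
  have q0 : q != 0.
    apply: contraNneq f0 => q0; move: er; rewrite q0 mul0r => /eqP.
    by rewrite scaler_eq0 (negPf lw0).
  have : (size f <= size q)%N.
    by rewrite leqNgt; apply/negP => /(small _ qS qu) /eqP; rewrite (negPf q0).
  rewrite -(size_scale _ lw0) er size_mul // => le.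
  have arith a b : ((a + b).-1 <= a)%N -> (0 < b)%N -> (0 < a)%N -> b = 1%N by clear; lia.
  by apply: arith le _ _; rewrite size_poly_gt0.
have [a1 a10 wE] := size_poly1P _ (introT eqP sw1).
have a1S : a1 \in S by have := lS _ (combS _ wc); rewrite wE lead_coefC.
have [|psi psiS] := Sspec (SM _ _ (lS f fS) a1S).
  by rewrite mulf_neq0 // lead_coef_eq0.
rewrite (specM psiS) ?lS // mulf_eq0 negb_or => /andP[psif psia1].
have sf : (1 < size f)%N.
  rewrite ltnNge; apply/negP => /size1_polyC fE; move: fu f0.
  by rewrite fE hornerC => ->; rewrite eqxx.
have sizef : size (map_poly psi f) = size f.
  apply: size_poly_eq; rewrite -lead_coefE //.
have [t] : exists t, root (map_poly psi f) t.
  by apply/closed_rootP; rewrite sizef; case: (size f) sf => [|[]].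
rewrite rootE => /eqP ft.
have [p pS pu|psi' psi'S psi'E] := @extend_spec psi t psiS.
  have [e [q [r [qS rS er ltr]]]] := pseudo_division f0 fS pS.
  have r0 : r = 0.
    apply: small => //; have : r = lead_coef f ^+ e *: p - q * f.
      by rewrite er addrC addKr.
    by move=> ->; rewrite hornerD hornerN hornerM hornerZ pu fu !mulr0 subrr.
  move: er; rewrite r0 addr0 => /(congr1 (fun p => (map_poly psi p).[t])).
  rewrite (spec_polyZ psiS) ?lX // (spec_polyM Ssub psiS) // hornerM ft mulr0.
  rewrite hornerZ => /eqP; rewrite mulf_eq0 => /orP[|/eqP //].
  have [_ ->] := specX Ssub psiS e (lS f fS).
  by rewrite expf_eq0 (negPf psif) andbF.
exists psi' => //; rewrite psi'E //; apply: contraNneq psia1 => gt.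
case: wc => h [l [hS lS' eqw]].
move: eqw; rewrite wE => /(congr1 (fun p => (map_poly psi p).[t])).
rewrite (spec_polyD Ssub psiS) ?SXM // !(spec_polyM Ssub psiS) //.
by rewrite hornerD !hornerM gt ft !mulr0 addr0 (spec_polyC psiS) hornerC => ->.
Qed.

End Extend.

Definition scalars : {pred F} := fun x => `[< exists c, x = iota c >].

Lemma scalars_sub : scalar_subring scalars.
Proof.
split; last by move=> c; apply/asboolP; exists c.
split.
- by apply/asboolP; exists 1; rewrite rmorph1.
- move=> _ _ /asboolP[x ->] /asboolP[y ->]; apply/asboolP.
  by exists (x - y); rewrite rmorphB.
- move=> _ _ /asboolP[x ->] /asboolP[y ->]; apply/asboolP.
  by exists (x * y); rewrite rmorphM.
Qed.

Lemma specialize_scalars : many_specializations scalars.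
Proof.
pose psi x := if pselect (exists c, x = iota c) is left e then sval (cid e) else 0.
have psiE c : psi (iota c) = c.
  rewrite /psi; case: pselect => [e|]; last by case; exists c.
  by case: (cid e) => /= c' /fmorph_inj.
move=> _ /asboolP[c ->]; rewrite fmorph_eq0 => c0; exists psi; last by rewrite psiE.
split=> // _ _ /asboolP[x ->] /asboolP[y ->].
  by rewrite -rmorphB !psiE.
by rewrite -rmorphM !psiE.
Qed.

(** A form of the Nullstellensatz.  To keep an element away from [0], its
    inverse is listed with it. *)
Lemma specialization (us : seq F) :
  exists S psi, [/\ scalar_subring S, forall u, u \in us -> u \in S
    & specializes S psi].
Proof.
suff [S [Ssub usS Sspec]] : exists S, [/\ scalar_subring S,
    forall u, u \in us -> u \in S & many_specializations S].
  have [|psi psiS _] := Sspec 1 _ (oner_neq0 _); first by case: Ssub => -[].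
  by exists S, psi.
elim: us => [|u us [S [Ssub usS Sspec]]].
  exists scalars; split=> //; [exact: scalars_sub | exact: specialize_scalars].
exists (adjoin S u); split.
- exact: adjoin_sub.
- move=> v; rewrite inE => /orP[/eqP->|/usS vS]; first exact: adjoin_gen.
  exact: adjoin_incl.
- exact: specialize_adjoin.
Qed.

End Specialization.

(** * The center of a simple ring *)

Section IdealOfPred.
Variables (R : nzRingType) (S : {pred R}).
Hypotheses (S_zmod : zmod_closed S) (S_proper : 1 \notin S)
  (S_left : forall a x, x \in S -> a * x \in S)
  (S_right : forall a x, x \in S -> x * a \in S).

(** The proofs are arguments, so that the ideal structure can be attached to
    the predicate. *)
Definition ideal_set of zmod_closed S & 1 \notin S
    & (forall a x, x \in S -> a * x \in S)
    & (forall a x, x \in S -> x * a \in S) : {pred R} := S.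
Local Notation I := (ideal_set S_zmod S_proper S_left S_right).
HB.instance Definition _ := GRing.isZmodClosed.Build R I S_zmod.
HB.instance Definition _ := isProperIdeal.Build R I (conj S_proper S_left).
HB.instance Definition _ := isRightAbsorbing.Build R I S_right.

Definition ideal_of_pred : twoSidedIdeal R := I.

End IdealOfPred.

(** Membership of [1] is more convenient than triviality: it is how elements of
    a simple ring are reached from a nonzero one. *)
Lemma simple_ring_unit (Q : nzRingType) (S : {pred Q}) x : simple_ring Q ->
  zmod_closed S -> (forall a y, y \in S -> a * y \in S) ->
  (forall a y, y \in S -> y * a \in S) -> x \in S -> x != 0 -> 1 \in S.
Proof.
move=> simpQ Sz Sl Sr xS; apply: contraNT => S1.
by apply/eqP; apply: (simpQ (ideal_of_pred Sz S1 Sl Sr)).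
Qed.

Section Center.
Variable Q : unitRingType.

Definition center_pred : {pred Q} := fun z => `[< central z >].

Lemma center_divring : divring_closed center_pred.
Proof.
split.
- by apply/asboolP => q; rewrite mul1r mulr1.
- move=> x y /asboolP xC /asboolP yC; apply/asboolP => q.
  by rewrite mulrBl mulrBr xC yC.
- move=> x y /asboolP xC /asboolP yC; apply/asboolP => q.
  by apply/commr_sym/commrM; [apply/commr_sym/xC | apply/commrV/commr_sym/yC].
Qed.
HB.instance Definition _ := GRing.isDivringClosed.Build Q center_pred center_divring.

Record center := Center { center_val :> Q; _ : center_val \in center_pred }.
HB.instance Definition _ := [isSub for center_val].
HB.instance Definition _ := [Choice of center by <:].
HB.instance Definition _ := [SubChoice_isSubUnitRing of center by <:].

Lemma center_valP (z : center) : central (val z).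
Proof. by have /asboolP := valP z. Qed.

Lemma center_mulC : commutative (@GRing.mul center).
Proof. by move=> x y; apply: val_inj; rewrite /= center_valP. Qed.
HB.instance Definition _ := GRing.PzRing_hasCommutativeMul.Build center center_mulC.

Section Simple.
Hypothesis simpQ : simple_ring Q.

(** Simplicity is an argument, so that the field structure can be attached to
    the center. *)
Definition center_field of simple_ring Q : Type := center.
HB.instance Definition _ := GRing.ComUnitRing.on (center_field simpQ).

Lemma center_unit : GRing.field_axiom (center_field simpQ).
Proof.
move=> z z0; pose S : {pred Q} := fun x => `[< exists q, x = val z * q >].
have vz0 : val z != 0 by apply: contraNneq z0 => vz; apply/eqP/val_inj.
have /asboolP[q eq] : 1 \in S.
  apply: (simple_ring_unit simpQ _ _ _ _ vz0).
  - split; first by apply/asboolP; exists 0; rewrite mulr0.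
    move=> _ _ /asboolP[x ->] /asboolP[y ->]; apply/asboolP.
    by exists (x - y); rewrite mulrBr.
  - move=> a _ /asboolP[x ->]; apply/asboolP; exists (a * x).
    by rewrite !mulrA center_valP.
  - move=> a _ /asboolP[x ->]; apply/asboolP; exists (x * a).
    by rewrite mulrA.
  - by apply/asboolP; exists 1; rewrite mulr1.
have uz : val z \is a GRing.unit.
  by apply/unitrP; exists q; rewrite -center_valP -eq.
by apply/unitrP; exists z^-1; split; apply: val_inj; rewrite /= ?mulVr ?mulrV.
Qed.
HB.instance Definition _ := GRing.ComUnitRing_isField.Build (center_field simpQ) center_unit.
End Simple.

End Center.

(** * Coordinates in a central simple ring *)

Section CentralSimple.
Variables (Q : unitRingType) (simpQ : simple_ring Q).
Local Notation F := (center_field simpQ).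
Local Notation inQ := (fun z : F => (val z : Q)).
Variables (d : nat) (b : 'I_d -> Q).
Hypothesis b_span : forall q, exists c : 'I_d -> F, q = \sum_i inQ (c i) * b i.
Hypothesis b_free : forall c : 'I_d -> F,
  \sum_i inQ (c i) * b i = 0 -> forall i, c i = 0.

Definition comb (c : 'rV[F]_d) : Q := \sum_i inQ (c 0 i) * b i.

Lemma comb_inj : injective comb.
Proof.
move=> c c' e; apply/rowP => i; apply/eqP; rewrite -subr_eq0; apply/eqP.
apply: (b_free (c := fun i => c 0 i - c' 0 i)).
under eq_bigr => l _ do rewrite /= mulrBl.
by rewrite sumrB -/(comb c) e subrr.
Qed.

Definition qcoord (q : Q) : 'rV[F]_d := \row_i sval (cid (b_span q)) i.

Lemma qcoordE q : q = comb (qcoord q).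
Proof.
rewrite {1}(svalP (cid (b_span q))); apply: eq_bigr => i _.
by rewrite mxE.
Qed.

Lemma combK : cancel comb qcoord.
Proof. by move=> c; apply: comb_inj; rewrite -qcoordE. Qed.

Lemma comb_linear (z : F) c c' : comb (z *: c + c') = inQ z * comb c + comb c'.
Proof.
rewrite mulr_sumr -big_split; apply: eq_bigr => i _.
by rewrite !mxE /= mulrDl mulrA.
Qed.

Lemma combD c c' : comb (c + c') = comb c + comb c'.
Proof. by have := comb_linear 1 c c'; rewrite scale1r mul1r. Qed.

Lemma comb0 : comb 0 = 0.
Proof. by have := combD 0 0; rewrite addr0 -[LHS]addr0 => /addrI. Qed.

Lemma combZ (z : F) c : comb (z *: c) = inQ z * comb c.
Proof. by have := comb_linear z c 0; rewrite comb0 !addr0. Qed.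

Lemma comb_sum I (r : seq I) (G : I -> 'rV[F]_d) :
  comb (\sum_(i <- r) G i) = \sum_(i <- r) comb (G i).
Proof. exact: (big_morph comb combD comb0). Qed.

Lemma qcoord_linear (z : F) q q' :
  qcoord (inQ z * q + q') = z *: qcoord q + qcoord q'.
Proof. by apply: comb_inj; rewrite comb_linear -!qcoordE. Qed.

Lemma qcoordD q q' : qcoord (q + q') = qcoord q + qcoord q'.
Proof. by have := qcoord_linear 1 q q'; rewrite scale1r mul1r. Qed.

Lemma qcoord0 : qcoord 0 = 0.
Proof. by have := qcoordD 0 0; rewrite addr0 -[LHS]addr0 => /addrI. Qed.

Lemma qcoordZ (z : F) q : qcoord (inQ z * q) = z *: qcoord q.
Proof. by have := qcoord_linear z q 0; rewrite qcoord0 !addr0. Qed.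

Lemma qcoord_sum I (r : seq I) (G : I -> Q) :
  qcoord (\sum_(i <- r) G i) = \sum_(i <- r) qcoord (G i).
Proof. by apply: (big_morph qcoord qcoordD qcoord0). Qed.

(** Right multiplication in coordinates; since vectors of coordinates are rows,
    this is a ring morphism. *)
Definition regrep (q : Q) : 'M[F]_d := \matrix_i qcoord (b i * q).

Lemma qcoordM q r : qcoord (q * r) = qcoord q *m regrep r.
Proof.
rewrite {1}[q]qcoordE mulr_suml qcoord_sum mulmx_sum_row; apply: eq_bigr => i _.
by rewrite -mulrA qcoordZ rowK.
Qed.

Lemma regrepM q r : regrep (q * r) = regrep q *m regrep r.
Proof. by apply/row_matrixP => i; rewrite rowK mulrA qcoordM row_mul rowK. Qed.

Lemma regrep1 : regrep 1 = 1%:M.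
Proof.
apply/row_matrixP => i; rewrite rowK mulr1 row1; apply: comb_inj.
rewrite -qcoordE /comb (bigD1 i) //= mxE !eqxx mul1r big1 ?addr0 // => l /negPf li.
by rewrite mxE eqxx li mul0r.
Qed.

Lemma regrepD q r : regrep (q + r) = regrep q + regrep r.
Proof.
by apply/row_matrixP => i; rewrite linearD /= !rowK mulrDr qcoordD.
Qed.

Lemma regrepZ (z : F) q : regrep (inQ z * q) = z *: regrep q.
Proof.
apply/row_matrixP => i; rewrite linearZ /= !rowK -qcoordZ.
by rewrite mulrA -(center_valP z) mulrA.
Qed.

Lemma regrep_sum I (r : seq I) (G : I -> Q) :
  regrep (\sum_(i <- r) G i) = \sum_(i <- r) regrep (G i).
Proof.
apply: (big_morph regrep regrepD); apply/row_matrixP => i.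
by rewrite rowK mulr0 qcoord0 row0.
Qed.

Lemma regrep_coord q : regrep q = \sum_i qcoord q 0 i *: regrep (b i).
Proof.
rewrite {1}[q]qcoordE regrep_sum; apply: eq_bigr => i _.
by rewrite regrepZ.
Qed.

Definition two_sided_op (s : seq (Q * Q)) (q : Q) : Q :=
  \sum_(p <- s) p.1 * q * p.2.

(** This is density for [Q] as a module over its left and right
    multiplications: a map commuting with all of them is the multiplication by
    a central element, and the basis is free over the center. *)
Lemma separating_op i : exists s, forall l, two_sided_op s (b l) = (l == i)%:R.
Proof.
pose E T := exists s, T = two_sided_op s.
have op0 s : two_sided_op s 0 = 0.
  by rewrite /two_sided_op big1 // => p _; rewrite mulr0 mul0r.
have E_comp T U : E T -> E U -> E (T \o U).
  move=> [s ->] [t ->]; exists [seq (p.1 * p'.1, p'.2 * p.2) | p <- s, p' <- t].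
  apply/funext => q /=; rewrite /two_sided_op big_allpairs_dep.
  apply: eq_bigr => p _; rewrite mulr_sumr mulr_suml; apply: eq_bigr => p' _.
  by rewrite !mulrA.
have E_sub T U : E T -> E U -> E (fun x => T x - U x).
  move=> [s ->] [t ->]; exists (s ++ [seq (- p.1, p.2) | p <- t]).
  apply/funext => q; rewrite /two_sided_op big_cat big_map -sumrN /=; congr (_ + _).
  by apply: eq_bigr => p _; rewrite !mulNr.
have E_add T : E T -> {morph T : x y / x - y}.
  move=> [s ->] x y; rewrite /two_sided_op -sumrB; apply: eq_bigr => p _.
  by rewrite mulrBr mulrBl.
have E_mul u v : E (fun q => u * q * v).
  by exists [:: (u, v)]; apply/funext => q; rewrite /two_sided_op big_seq1.
have E_simple x y : x != 0 -> exists2 T, E T & T x = y.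
  move=> x0; pose S : {pred Q} := fun z => `[< exists2 T, E T & T x = z >].
  have /asboolP[T ET Tx] : 1 \in S.
    apply: (simple_ring_unit simpQ _ _ _ _ x0).
    - split; first by apply/asboolP; exists (fun q => 0 * q * 0);
          [exact: E_mul | rewrite mulr0].
      move=> _ _ /asboolP[T ET <-] /asboolP[U EU <-]; apply/asboolP.
      by exists (fun q => T q - U q); first exact: E_sub.
    - move=> a _ /asboolP[T ET <-]; apply/asboolP.
      exists ((fun q => a * q * 1) \o T); first exact: E_comp.
      by rewrite /= mulr1.
    - move=> a _ /asboolP[T ET <-]; apply/asboolP.
      exists ((fun q => 1 * q * a) \o T); first exact: E_comp.
      by rewrite /= mul1r.
    - by apply/asboolP; exists (fun q => 1 * q * 1); [exact: E_mul | rewrite mulr1 mul1r].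
  exists ((fun q => y * q * 1) \o T); first exact: E_comp.
  by rewrite /= Tx !mulr1.
pose xs := [seq b l | l <- enum 'I_d & l != i].
have [T ET [Txs Tb]] : exists2 T, E T & (forall x, x \in xs -> T x = 0) /\ T (b i) != 0.
  apply: contrapT => ne.
  have [T ET Txs|delta dE bE] := density E_add E_sub E_comp E_simple (xs := xs) (y := b i).
    by apply/eqP/negP => /negP Tb; apply: ne; exists T.
  have deltaE t q : delta t q = delta t 1 * q.
    by have [_ h] := dE t; have := h _ (E_mul 1 q) 1; rewrite !mul1r.
  have deltaC t : delta t 1 \in center_pred (Q := Q).
    apply/asboolP => q; rewrite -deltaE.
    by have [_ h] := dE t; have := h _ (E_mul q 1) 1; rewrite !mulr1.
  pose z t : F := Center (deltaC t).
  have sumE : b i = comb (\sum_(t < size xs) z t *: qcoord xs`_t).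
    rewrite {1}bE comb_sum; apply: eq_bigr => t _.
    by rewrite combZ -qcoordE deltaE.
  have bl l : qcoord (b l) = delta_mx 0 l.
    by rewrite -[b l]mulr1 -row1 -regrep1 rowK.
  move/(congr1 qcoord)/rowP/(_ i): sumE; rewrite combK bl summxE mxE !eqxx.
  rewrite big1 => [/eqP|t _]; first by rewrite oner_eq0.
  have /mapP[l] : xs`_t \in xs by apply: mem_nth.
  rewrite mem_filter => /andP[li _] ->; rewrite bl !mxE eqxx /=.
  by rewrite [i == l]eq_sym (negPf li) mulr0.
have [U [t ->] UT1] := E_simple (T (b i)) 1 Tb.
case: ET Txs Tb UT1 => s -> Txs Tb UT1.
have [st stE] : E (two_sided_op t \o two_sided_op s) by apply: E_comp; [exists t|exists s].
exists st => l; rewrite -stE /=; case: eqVneq => [->//|li].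
by rewrite Txs ?op0 // map_f // mem_filter li mem_enum.
Qed.

(** The same in coordinates: the separating operators are described by finitely
    many central elements, which can be specialized. *)
Lemma separating_coefs : exists tau : 'I_d -> 'M[F]_d, forall i l,
  \sum_u \sum_v inQ (tau i u v) * (b u * b l * b v) = (l == i)%:R.
Proof.
have [s sE] := choice separating_op.
exists (fun i => \sum_(p <- s i) (qcoord p.1)^T *m qcoord p.2) => i l.
rewrite -sE /two_sided_op.
transitivity (\sum_u \sum_v \sum_(p <- s i)
    inQ (qcoord p.1 0 u) * b u * b l * (inQ (qcoord p.2 0 v) * b v)).
  apply: eq_bigr => u _; apply: eq_bigr => v _.
  rewrite summxE raddf_sum mulr_suml; apply: eq_bigr => p _.
  rewrite mxE big_ord1 [_^T _ _]mxE /= -!mulrA; congr (_ * _).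
  by rewrite !(center_valP (qcoord p.2 0 v)) !mulrA.
under eq_bigr do rewrite exchange_big.
rewrite exchange_big; apply: eq_bigr => p _.
rewrite {2}[p.1]qcoordE {2}[p.2]qcoordE /comb !mulr_suml; apply: eq_bigr => u _.
by rewrite mulr_sumr.
Qed.

End CentralSimple.

(** * Simple algebras over an algebraically closed field *)

Section SimpleMatrixAlgebra.
Variables (k : closedFieldType) (R : algType k) (d : nat).
Hypothesis d_gt0 : (0 < d)%N.

Definition mx_rep m (rho : R -> 'M[k]_m) : Prop :=
  [/\ forall c x y, rho (c *: x + y) = c *: rho x + rho y,
      forall x y, rho (x * y) = rho x *m rho y & rho 1 = 1%:M].

Lemma mx_repD m (rho : R -> 'M[k]_m) : mx_rep rho -> {morph rho : x y / x + y}.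
Proof. by case=> lin _ _ x y; rewrite -[x]scale1r lin !scale1r. Qed.

Lemma mx_rep0 m (rho : R -> 'M[k]_m) : mx_rep rho -> rho 0 = 0.
Proof.
by move=> /mx_repD D; have := D 0 0; rewrite addr0 -[LHS]addr0 => /addrI.
Qed.

Lemma mx_repZ m (rho : R -> 'M[k]_m) : mx_rep rho ->
  forall c x, rho (c *: x) = c *: rho x.
Proof.
by move=> h c x; case: (h) => lin _ _; rewrite -[c *: x]addr0 lin (mx_rep0 h) addr0.
Qed.

Lemma mx_rep_sum m (rho : R -> 'M[k]_m) : mx_rep rho ->
  forall I (r : seq I) (G : I -> R), rho (\sum_(i <- r) G i) = \sum_(i <- r) rho (G i).
Proof.
by move=> h I r G; rewrite (big_morph rho (mx_repD h) (mx_rep0 h)).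
Qed.

(** Burnside: by density, the matrices of an irreducible representation are all
    the matrices, because an additive map commuting with them has an eigenvalue
    and is therefore a scalar. *)
Lemma burnside m (rho : R -> 'M[k]_m) : (0 < m)%N -> mx_rep rho ->
  (forall v w : 'rV_m, v != 0 -> exists y, v *m rho y = w) ->
  forall A, exists y, rho y = A.
Proof.
move=> m0 h irr; case: (h) => lin mul one.
pose E (T : 'rV[k]_m -> 'rV[k]_m) := exists y, T = fun v => v *m rho y.
have E_add T : E T -> {morph T : x y / x - y}.
  by move=> [y ->] u v; rewrite mulmxBl.
have E_sub T U : E T -> E U -> E (fun x => T x - U x).
  move=> [y ->] [z ->]; exists (y - z); apply/funext => v.
  by rewrite (mx_repD h) -[- z]scaleN1r (mx_repZ h) scaleN1r mulmxBr.
have E_comp T U : E T -> E U -> E (T \o U).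
  by move=> [y ->] [z ->]; exists (z * y); apply/funext => v; rewrite mul mulmxA.
have E_simple x y : x != 0 -> exists2 T, E T & T x = y.
  by move=> x0; have [z <-] := irr x y x0; exists (fun v => v *m rho z) => //; exists z.
have scalar_comm delta : commutes_with E delta -> exists a, forall v, delta v = a *: v.
  move=> [dD dE].
  have dR y v : delta (v *m rho y) = delta v *m rho y.
    by apply: (dE (fun v => v *m rho y)); exists y.
  have dZ c v : delta (c *: v) = c *: delta v.
    have eqc u : u *m rho (c *: 1) = c *: u.
      by rewrite (mx_repZ h) one -scalemxAr mulmx1.
    by rewrite -eqc dR eqc.
  have d0 : delta 0 = 0 by rewrite -(scale0r 0) dZ !scale0r.
  pose D : 'M[k]_m := \matrix_i delta (delta_mx 0 i).
  have DE v : delta v = v *m D.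
    rewrite {1}[v]row_sum_delta (big_morph delta dD d0) mulmx_sum_row.
    by apply: eq_bigr => i _; rewrite dZ rowK.
  have [a] : exists a, root (char_poly D) a.
    by apply/closed_rootP; rewrite size_char_poly; case: (m) m0.
  rewrite -eigenvalue_root_char => /eigenvalueP[u uD u0].
  exists a => v; have [y <-] := irr u v u0.
  by rewrite dR DE uD -scalemxAl.
have sep i : exists2 y, delta_mx 0 i *m rho y != 0 :> 'rV_m &
    forall l, l != i -> delta_mx 0 l *m rho y = 0 :> 'rV_m.
  pose xs : seq 'rV[k]_m := [seq delta_mx 0 l | l <- enum 'I_m & l != i].
  apply: contrapT => ne.
  have [_ [y ->] Txs|delta dE dE'] :=
      density E_add E_sub E_comp E_simple (xs := xs) (y := delta_mx 0 i).
    apply/eqP/negP => /negP Ti; apply: ne; exists y => // l li.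
    by apply: Txs; rewrite map_f // mem_filter li mem_enum.
  move/rowP/(_ i)/eqP: dE'; rewrite summxE mxE !eqxx big1 ?oner_eq0 // => t _.
  have [a ->] := scalar_comm _ (dE t).
  have /mapP[l] : xs`_t \in xs by apply: mem_nth.
  rewrite mem_filter => /andP[li _] ->; rewrite !mxE eqxx /=.
  by rewrite [i == l]eq_sym (negPf li) mulr0.
have units i l : exists y, rho y = delta_mx i l.
  have [y yi yl] := sep i; have [z zE] := irr _ (delta_mx 0 l) yi.
  exists (y * z); apply/row_matrixP => t; rewrite rowE mul mulmxA.
  have [->|ti] := eqVneq t i; first by rewrite zE rowE mul_delta_mx.
  by rewrite yl // mul0mx rowE mul_delta_mx_0.
move=> A; have [f fE] := choice (fun p : 'I_m * 'I_m => units p.1 p.2).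
exists (\sum_i \sum_l A i l *: f (i, l)).
rewrite [RHS]matrix_sum_delta (mx_rep_sum h); apply: eq_bigr => i _.
rewrite (mx_rep_sum h); apply: eq_bigr => l _.
by rewrite (mx_repZ h) fE.
Qed.

Variables (Phi : R -> 'M[k]_d) (e : 'I_d -> R) (c : R -> 'I_d -> k).
Variable tau : 'I_d -> 'M[k]_d.
Hypothesis Phi_rep : mx_rep Phi.
Hypothesis Phi_span : forall y, Phi y = \sum_i c y i *: Phi (e i).
Hypothesis Phi_sep : forall i l,
  \sum_u \sum_v tau i u v *: (Phi (e u) *m Phi (e l) *m Phi (e v)) = (l == i)%:R%:M.

(** The separating identities make the image of [Phi] a simple algebra of
    dimension [d]: it acts faithfully on a minimal invariant subspace, of
    dimension [m] say, where it consists of all matrices by Burnside's theorem;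
    comparing dimensions gives [m * m = d]. *)
Lemma simple_mx_algebra : exists m (rho : R -> 'M[k]_m),
  [/\ (m * m = d)%N, mx_rep rho, forall A, exists y, rho y = A
    & forall y i, c y i != 0 -> rho y != 0].
Proof.
case: (Phi_rep) => lin mul one.
pose stable (W : 'M[k]_d) := forall y, (W *m Phi y <= W)%MS.
have exW : exists m, `[< exists2 W, stable W & (0 < \rank W)%N /\ \rank W = m >].
  exists d; apply/asboolP; exists 1%:M; last by rewrite mxrank1.
  by move=> y; rewrite mul1mx submx1.
case: (ex_minnP exW) => _ /asboolP[W Wst [W0 <-]] minW.
set m := \rank W in W0 minW *.
have [B [Bfree BW]] : exists B : 'M_(m, d), row_free B /\ (B :=: W)%MS.
  by exists (row_base W); split; [apply: row_base_free | apply: eq_row_base].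
have [rho rhoE] : exists rho, forall y, rho y *m B = B *m Phi y.
  exists (fun y => B *m Phi y *m pinvmx B) => y.
  by apply: mulmxKpV; rewrite BW (submx_trans _ (Wst y)) // submxMr // BW.
have Binj q : injective (mulmxr B : 'M_(q, _) -> _) by apply: row_free_inj.
have rho_rep : mx_rep rho.
  split=> [a x y|x y|]; apply: (Binj m); rewrite /= rhoE.
  - by rewrite lin mulmxDl -scalemxAl !rhoE mulmxDr -scalemxAr.
  - by rewrite mul mulmxA -rhoE -mulmxA -rhoE mulmxA.
  - by rewrite one mulmx1 mul1mx.
have rho_span y : rho y = \sum_i c y i *: rho (e i).
  apply: (Binj m); rewrite /= rhoE Phi_span mulmx_sumr mulmx_suml.
  by apply: eq_bigr => i _; rewrite -scalemxAr -scalemxAl rhoE.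
have rho_sep i l :
    \sum_u \sum_v tau i u v *: (rho (e u) *m rho (e l) *m rho (e v)) = (l == i)%:R%:M.
  apply: (Binj m); rewrite /= mul_scalar_mx -mul_mx_scalar -(Phi_sep i l).
  rewrite mulmx_suml mulmx_sumr; apply: eq_bigr => u _.
  rewrite mulmx_suml mulmx_sumr; apply: eq_bigr => v _.
  rewrite -scalemxAl -scalemxAr -!mulmxA; congr (_ *: _).
  by rewrite rhoE (mulmxA (rho (e l)) B) rhoE -[B *m _ *m _]mulmxA
    (mulmxA (rho (e u)) B) rhoE -mulmxA.
have irr : forall v w : 'rV[k]_m, v != 0 -> exists y, v *m rho y = w.
  move=> v w v0; pose V : 'M[k]_(d, m) := \matrix_i (v *m rho (e i)).
  have VE y : v *m rho y = (\row_i c y i) *m V.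
    rewrite rho_span mulmx_sumr mulmx_sum_row; apply: eq_bigr => i _.
    by rewrite rowK mxE -scalemxAr.
  have vV : (v <= V)%MS.
    by case: rho_rep => _ _ one'; rewrite -[v]mulmx1 -one' VE submxMl.
  have VB : (V *m B <= W)%MS by rewrite -BW submxMl.
  have Vst : stable (V *m B).
    move=> y; apply/row_subP => i; rewrite -mulmxA row_mul rowK -rhoE mulmxA.
    rewrite -(mulmxA v); case: rho_rep => _ <- _.
    by rewrite VE -mulmxA submxMl.
  have V0 : (0 < \rank (V *m B))%N.
    rewrite mxrankMfree // lt0n mxrank_eq0; apply: contraNneq v0 => V0.
    by move: vV; rewrite (V0 : V = 0) => /submx0null ->.
  have rankV : (m <= \rank V)%N.
    by rewrite -(mxrankMfree V Bfree) minW //; apply/asboolP; exists (V *m B).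
  have /submxP[u ->] : (w <= V)%MS.
    by apply: submx_full; rewrite /row_full eqn_leq rank_leq_col.
  exists (\sum_i u 0 i *: e i).
  rewrite (mx_rep_sum rho_rep) mulmx_sumr mulmx_sum_row; apply: eq_bigr => i _.
  by rewrite (mx_repZ rho_rep) rowK -scalemxAr.
have rho_surj := burnside W0 rho_rep irr.
have rho_c i (a : 'I_d -> k) : \sum_u \sum_v tau i u v *:
    (rho (e u) *m (\sum_l a l *: rho (e l)) *m rho (e v)) = (a i)%:M.
  transitivity (\sum_l a l *: ((l == i)%:R%:M : 'M[k]_m)); last first.
    rewrite (bigD1 i) //= eqxx scale_scalar_mx mulr1 big1 ?addr0 // => l /negPf ->.
    by rewrite mulr0n raddf0 scaler0.
  under [RHS]eq_bigr => l _ do rewrite -(rho_sep i l) scaler_sumr.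
  rewrite [RHS]exchange_big; apply: eq_bigr => u _.
  under [RHS]eq_bigr => l _ do rewrite scaler_sumr.
  rewrite [RHS]exchange_big; apply: eq_bigr => v _.
  rewrite mulmx_sumr mulmx_suml scaler_sumr; apply: eq_bigr => l _.
  by rewrite -scalemxAr -scalemxAl !scalerA mulrC.
have scalar0 (a : k) : (a%:M : 'M[k]_m) = 0 -> a = 0.
  move=> /matrixP; case: (m) W0 => // m' _ /(_ 0 0).
  by rewrite !mxE eqxx.
exists m, rho; split=> //; last first.
  move=> y i; apply: contraNneq => y0; apply/eqP/scalar0.
  rewrite -(rho_c i (c y)) -rho_span y0 big1 // => u _; rewrite big1 // => v _.
  by rewrite mulmx0 mul0mx scaler0.
pose X : 'M[k]_(d, m * m) := \matrix_i mxvec (rho (e i)).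
have XE (a : 'rV_d) : a *m X = mxvec (\sum_i a 0 i *: rho (e i)).
  rewrite mulmx_sum_row linear_sum; apply: eq_bigr => i _.
  by rewrite rowK linearZ.
have Xfree : row_free X.
  rewrite -kermx_eq0; apply/rowV0P => a /sub_kermxP; rewrite XE => /(canRL mxvecK).
  rewrite linear0 => a0; apply/rowP => i; rewrite mxE; apply: scalar0.
  rewrite -(rho_c i (fun l => a 0 l)) a0 big1 // => u _; rewrite big1 // => v _.
  by rewrite mulmx0 mul0mx scaler0.
have Xfull : row_full X.
  rewrite -sub1mx; apply/row_subP => i; rewrite -[row i _]vec_mxK.
  have [y <-] := rho_surj (vec_mx (row i 1%:M)).
  rewrite rho_span; have := XE (\row_i c y i).
  by under eq_bigr do rewrite mxE; move=> <-; rewrite submxMl.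
by move: Xfull Xfree; rewrite /row_full /row_free => /eqP -> /eqP.
Qed.

End SimpleMatrixAlgebra.

(** * Representations of a prime algebra of PI-degree n + 1 *)

Section MorphismOfFun.
Variables (A B : nzRingType) (f : A -> B).
Hypotheses (f_zmod : zmod_morphism f) (f_mul : monoid_morphism f).
(** The proofs are arguments, so that the morphism structure can be attached to
    the function. *)
Definition morphism_fun of zmod_morphism f & monoid_morphism f := f.
Local Notation g := (morphism_fun f_zmod f_mul).
HB.instance Definition _ := GRing.isZmodMorphism.Build A B g f_zmod.
HB.instance Definition _ := GRing.isMonoidMorphism.Build A B g f_mul.
Definition rmorphism_of_fun : {rmorphism A -> B} := g.
End MorphismOfFun.

Section AlgMorphismOfFun.
Variables (k : comNzRingType) (A B : algType k) (f : A -> B).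
Hypotheses (f_lin : linear f) (f_mul : monoid_morphism f).
Definition alg_morphism_fun of linear f & monoid_morphism f := f.
Local Notation g := (alg_morphism_fun f_lin f_mul).
HB.instance Definition _ := GRing.isLinear.Build k A B _ g f_lin.
HB.instance Definition _ := GRing.isMonoidMorphism.Build A B g f_mul.
Definition lrmorphism_of_fun : {lrmorphism A -> B} := g.
End AlgMorphismOfFun.

Section SpecializeMatrices.
Variables (k : closedFieldType) (F : fieldType) (iota : {rmorphism k -> F}).
Variables (S : {pred F}) (psi : F -> k).
Hypotheses (Ssub : scalar_subring iota S) (psiS : specializes iota S psi).

Definition mx_in m p (A : 'M[F]_(m, p)) : Prop := forall i j, A i j \in S.

Lemma spec_mulmx m p q (A : 'M_(m, p)) (B : 'M_(p, q)) : mx_in A -> mx_in B ->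
  mx_in (A *m B) /\ map_mx psi (A *m B) = map_mx psi A *m map_mx psi B.
Proof.
move=> AS BS.
have h i j := spec_sum Ssub psiS (index_enum _)
  (G := fun l => A i l * B l j) (fun l => scalM Ssub (AS i l) (BS l j)).
split=> [i j|]; first by rewrite mxE; case: (h i j).
apply/matrixP => i j; rewrite !mxE; have [_ ->] := h i j.
by apply: eq_bigr => l _; rewrite !mxE (specM psiS).
Qed.

Lemma spec_scalemx m p a (A : 'M_(m, p)) : a \in S -> mx_in A ->
  mx_in (a *: A) /\ map_mx psi (a *: A) = psi a *: map_mx psi A.
Proof.
move=> aS AS; split=> [i j|]; first by rewrite mxE (scalM Ssub).
by apply/matrixP => i j; rewrite !mxE (specM psiS).
Qed.

Lemma spec_summx I (r : seq I) m p (A : I -> 'M_(m, p)) : (forall i, mx_in (A i)) ->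
  mx_in (\sum_(i <- r) A i) /\
  map_mx psi (\sum_(i <- r) A i) = \sum_(i <- r) map_mx psi (A i).
Proof.
move=> AS.
have h i j := spec_sum Ssub psiS r (G := fun l => A l i j) (fun l => AS l i j).
split=> [i j|]; first by rewrite summxE; case: (h i j).
apply/matrixP => i j; rewrite !mxE !summxE; have [_ ->] := h i j.
by apply: eq_bigr => l _; rewrite mxE.
Qed.

End SpecializeMatrices.

Lemma regular_mul (R : nzRingType) (s t : R) :
  regular_elt s -> regular_elt t -> regular_elt (s * t).
Proof. by move=> [sl sr] [tl tr]; split; [exact: lregM | exact: rregM]. Qed.

(** Denominators are added one at a time: if [s] works for some elements and [t]
    is a denominator of [b s], then [s t] works for [b] as well. *)
Lemma common_denominator (R : nzRingType) (Q : unitRingType) (j : {rmorphism R -> Q}) :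
  total_ring_of_fractions j -> forall d (b : 'I_d -> Q),
  exists2 s, regular_elt s & exists e : 'I_d -> R, forall i, b i * j s = j (e i).
Proof.
move=> [jinj junit jr _] d b.
suff [s sreg sP] : exists2 s, regular_elt s &
    forall i, i \in enum 'I_d -> exists a, b i * j s = j a.
  have [e eE] := choice (fun i => sP i (mem_enum _ i)).
  by exists s => //; exists e.
elim: (enum _) => [|i r [s sreg IH]].
  by exists 1 => //; split=> x y; rewrite ?mul1r ?mulr1.
have [a [t [treg eq]]] := jr (b i * j s).
exists (s * t); first exact: regular_mul.
move=> l; rewrite inE => /orP[/eqP->|/IH[a' e']].
  by exists a; rewrite rmorphM mulrA eq mulrVK // junit.
by exists (a' * t); rewrite !rmorphM mulrA e'.
Qed.

Section CentralScalars.
Variables (k : fieldType) (R : algType k) (Q : unitRingType) (j : {rmorphism R -> Q}).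
Hypotheses (jfrac : total_ring_of_fractions j) (simpQ : simple_ring Q).

Let scalar_central (c : k) : j c%:A \in center_pred (Q := Q).
Proof.
apply/asboolP => q; case: jfrac => _ _ /(_ q) [a [s [_ ->]]] _.
have cj x : j c%:A * j x = j x * j c%:A by rewrite -!rmorphM mulr_algl mulr_algr.
by rewrite mulrA cj -!mulrA; congr (_ * _); apply: commrV; apply: cj.
Qed.

Let central_scalar_fun (c : k) : center_field simpQ := Center (scalar_central c).

Let central_scalar_zmod : zmod_morphism central_scalar_fun.
Proof. by move=> a b; apply: val_inj; rewrite /= scalerBl rmorphB. Qed.

Let central_scalar_monoid : monoid_morphism central_scalar_fun.
Proof.
split; first by apply: val_inj; rewrite /= scale1r rmorph1.
by move=> a b; apply: val_inj; rewrite /= -rmorphM mulr_algl scalerA.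
Qed.

(** [R] is an algebra over [k] while [Q] is only a ring: [k] acts on [Q] through
    central elements. *)
Definition central_scalar : {rmorphism k -> center_field simpQ} :=
  rmorphism_of_fun central_scalar_zmod central_scalar_monoid.

Lemma central_scalarE c : val (central_scalar c) = j c%:A.
Proof. by []. Qed.

End CentralScalars.

(** In a basis of [Q] over its center taken from [R], right multiplication by an
    element of [R] has its entries in a finitely generated ring of scalars.
    Specializing these scalars in [k], together with the coefficients of the
    separating operators, gives a simple algebra of dimension [(n + 1) ^ 2]. *)
Lemma PI_representation (k : closedFieldType) (n : nat) (R : algType k) (r : R) :
  PIn_object n R -> r != 0 ->
  exists2 phi : {lrmorphism R -> 'M[k]_n.+1}, surjective phi & phi r != 0.
Proof.
move=> [[m [s gen]] _ _ [Q [j [jfrac [simpQ [b [bspan bfree]]]]]]] r0.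
set d := (n.+1 ^ 2)%N in b bspan bfree.
case: (jfrac) => jinj junit _ _.
have [s0 s0reg [e eE]] := common_denominator jfrac b.
have us0 : j s0 \is a GRing.unit by apply: junit.
pose F := center_field simpQ.
have e_span q : exists c : 'I_d -> F, q = \sum_i (val (c i) : Q) * j (e i).
  have [c cC qE] := bspan (q / j s0).
  exists (fun i => Center (introT (asboolP _) (cC i)) : F).
  rewrite -[q](mulrVK us0) qE mulr_suml; apply: eq_bigr => i _.
  by rewrite -mulrA eE.
have e_free (c : 'I_d -> F) :
    \sum_i (val (c i) : Q) * j (e i) = 0 -> forall i, c i = 0.
  move=> c0 i; apply: val_inj; apply: (bfree (fun i => val (c i))).
    by move=> l; apply: center_valP.
  apply: (mulIr us0); rewrite mul0r; apply: etrans c0.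
  rewrite mulr_suml; apply: eq_bigr => l _.
  by rewrite -mulrA eE.
have [tau tauE] := @separating_coefs Q simpQ d _ e_span e_free.
pose kap := @qcoord Q simpQ d _ e_span; pose L := @regrep Q simpQ d _ e_span.
have LM : forall q q', L (q * q') = L q *m L q' := @regrepM Q simpQ d _ e_span e_free.
have LD : forall q q', L (q + q') = L q + L q' := @regrepD Q simpQ d _ e_span e_free.
have LZ : forall (z : F) q, L (val z * q) = z *: L q := @regrepZ Q simpQ d _ e_span e_free.
have L1 : L 1 = 1%:M := @regrep1 Q simpQ d _ e_span e_free.
have Lsum := @regrep_sum Q simpQ d _ e_span e_free; rewrite -/L in Lsum.
pose iota := central_scalar jfrac simpQ.
(* The scalars to specialize: the generators of R in coordinates, the
   coefficients of the separating operators, the coordinates of 1, from which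
   those of any element of R follow, and the inverses of the nonzero coordinates
   of r, which keep the image of r away from 0. *)
pose us : seq F :=
  [seq L (j (s p.1.1)) p.1.2 p.2 | p : 'I_m * 'I_d * 'I_d] ++
  [seq tau p.1.1 p.1.2 p.2 | p : 'I_d * 'I_d * 'I_d] ++
  [seq kap 1 0 i | i : 'I_d] ++ [seq (kap (j r) 0 i)^-1 | i : 'I_d].
have [S [psi [Ssub usS psiS]]] := specialization iota us.
have LsS h : mx_in S (L (j (s h))).
  move=> i l; apply: usS; rewrite mem_cat; apply/orP; left.
  exact: (codom_f (fun p : 'I_m * 'I_d * 'I_d => L (j (s p.1.1)) p.1.2 p.2) (h, i, l)).
have tauS i : mx_in S (tau i).
  move=> u v; apply: usS; rewrite !mem_cat; apply/orP; right; apply/orP; left.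
  exact: (codom_f (fun p : 'I_d * 'I_d * 'I_d => tau p.1.1 p.1.2 p.2) (i, u, v)).
have kap1S : mx_in S (kap 1).
  move=> z i; rewrite (ord1 z); apply: usS; rewrite !mem_cat; do 2![apply/orP; right].
  by apply/orP; left; exact: (codom_f (fun i => kap 1 0 i)).
have kaprS i : (kap (j r) 0 i)^-1 \in S.
  apply: usS; rewrite !mem_cat; do 3![apply/orP; right].
  exact: (codom_f (fun i => (kap (j r) 0 i)^-1)).
have jZ c x : j (c *: x) = val (iota c) * j x.
  by rewrite central_scalarE -rmorphM mulr_algl.
have LS y : mx_in S (L (j y)).
  pose B : {pred R} := fun y => `[< mx_in S (L (j y)) >].
  suff /asboolP : y \in B by [].
  move/generated_subalgP: (gen y); apply; last by move=> h; apply/asboolP/LsS.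
  split=> [|c x z /asboolP xS /asboolP zS|x z /asboolP xS /asboolP zS]; apply/asboolP.
  - by move=> i l; rewrite rmorph1 L1 mxE; case: eqP; rewrite ?(scal1 Ssub) ?(scal0 Ssub).
  - rewrite rmorphD jZ LD LZ => i l; rewrite mxE [X in X + _]mxE.
    by rewrite (scalD Ssub) ?(scalM Ssub) //; case: Ssub.
  - by rewrite rmorphM LM; case: (spec_mulmx Ssub psiS xS zS).
have kapS y : mx_in S (kap (j y)).
  rewrite -[j y]mul1r /kap (@qcoordM Q simpQ d _ e_span e_free).
  by case: (spec_mulmx Ssub psiS kap1S (LS y)).
pose Phi y : 'M[k]_d := map_mx psi (L (j y)).
have Phi_rep : mx_rep Phi.
  split.
  - move=> c x y; apply/matrixP => i l; rewrite [LHS]mxE [RHS]mxE [X in _ = X + _]mxE /Phi ![map_mx _ _ _ _]mxE.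
    rewrite rmorphD jZ LD LZ mxE [X in psi (X + _)]mxE.
    have iS : iota c \in S by case: Ssub.
    have iLS : iota c * L (j x) i l \in S by apply: (scalM Ssub) => //; apply: LS.
    rewrite (specD Ssub psiS iLS (LS y i l)) (specM psiS iS (LS x i l)).
    by case: psiS => _ _ ->.
  - by move=> x y; rewrite /Phi rmorphM LM; case: (spec_mulmx Ssub psiS (LS x) (LS y)).
  - rewrite /Phi rmorph1 L1; apply/matrixP => i l; rewrite !mxE.
    by case: eqP; rewrite ?(spec1 psiS) ?(spec0 psiS).
pose c y i := psi (kap (j y) 0 i).
have Phi_span y : Phi y = \sum_i c y i *: Phi (e i).
  rewrite /Phi {1}/L (@regrep_coord Q simpQ d _ e_span e_free (j y)) -/L -/kap.
  have h i := spec_scalemx Ssub psiS (kapS y 0 i) (LS (e i)).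
  have [_ ->] := spec_summx Ssub psiS (index_enum _) (fun i => (h i).1).
  by apply: eq_bigr => i _; case: (h i).
have Phi_sep i l : \sum_u \sum_v map_mx psi (tau i) u v *:
    (Phi (e u) *m Phi (e l) *m Phi (e v)) = (l == i)%:R%:M.
  have hM u := spec_mulmx Ssub psiS (LS (e u)) (LS (e l)).
  have hMM u v := spec_mulmx Ssub psiS (hM u).1 (LS (e v)).
  have hZ u v := spec_scalemx Ssub psiS (tauS i u v) (hMM u v).1.
  have hs u := spec_summx Ssub psiS (index_enum _) (fun v => (hZ u v).1).
  have hss := spec_summx Ssub psiS (index_enum _) (fun u => (hs u).1).
  have tauL : \sum_u \sum_v tau i u v *: (L (j (e u)) *m L (j (e l)) *m L (j (e v)))
      = (l == i)%:R%:M.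
    transitivity (L (l == i)%:R); last first.
      have L0 : L 0 = 0 by have := LZ 0 1; rewrite mul0r scale0r.
      by case: eqP => _; rewrite ?L1 // mulr0n L0 raddf0.
    rewrite -(tauE i l) Lsum; apply: eq_bigr => u _.
    by rewrite Lsum; apply: eq_bigr => v _; rewrite LZ !LM.
  have := congr1 (map_mx psi) tauL; rewrite hss.2.
  have -> : map_mx psi ((l == i)%:R%:M : 'M_d) = (l == i)%:R%:M.
    apply/matrixP => u v; rewrite !mxE.
    by case: (l == i); case: (u == v); rewrite ?mulr1n ?mulr0n ?(spec1 psiS) ?(spec0 psiS).
  move=> <-; apply: eq_bigr => u _; rewrite (hs u).2; apply: eq_bigr => v _.
  by rewrite (hZ u v).2 (hMM u v).2 (hM u).2 mxE.
have d0 : (0 < d)%N by rewrite expn_gt0.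
have [p [rho [pd rho_rep rho_surj rho_c]]] :=
  simple_mx_algebra d0 Phi_rep Phi_span Phi_sep.
have pE : p = n.+1.
  by apply/eqP; rewrite -(eqn_exp2r _ _ (ltn0Sn 1)) -/d -pd mulnn.
subst p; case: (rho_rep) => lin mul one.
have mon : monoid_morphism rho by split.
exists (lrmorphism_of_fun lin mon); first exact: rho_surj.
have [i ki] : exists i, kap (j r) 0 i != 0.
  apply: contrapT => ne; move: r0; rewrite -(inj_eq jinj) rmorph0 => /negP; apply.
  rewrite [j r](@qcoordE Q simpQ d _ e_span) -/kap /comb big1 // => i _.
  have -> : kap (j r) 0 i = 0 by apply/eqP/negP => /negP ki; apply: ne; exists i.
  by rewrite mul0r.
apply: (rho_c r i); rewrite /c; apply/negP => /eqP c0.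
have := specM psiS (kapS r 0 i) (kaprS i).
by rewrite mulfV // c0 mul0r (spec1 psiS) => /eqP; rewrite oner_eq0.
Qed.

(** * Separating a point from a variety *)

Section PolynomialFunctions.
Variables (k : closedFieldType) (n m : nat).
Local Notation G := (generic_ring k n m).
Local Notation pt := (point k n m).
Local Notation "'Mz'" := 'M[{poly k}]_n.+1.

Definition geval_mor (a : pt) : {lrmorphism G -> 'M[k]_n.+1} :=
  @lrmorphism_of_fun k G 'M[k]_n.+1 (fun p => geval p a)
    (fun c p q => etrans (gevalD _ _ _) (congr1 (+%R^~ _) (gevalZ _ _ _)))
    (conj (geval1 a) (fun p q => gevalM p q a)).

Lemma geval_morE a p : geval_mor a p = geval p a.
Proof. by []. Qed.

Definition generic_elt (h : 'I_m) : G := Subalgebra (mem_generator (@generic_matrix k n m) h).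

Lemma geval_generic h a : geval (generic_elt h) a = a h.
Proof. exact: polymx_eval_generic. Qed.

Lemma generating_surj (a : pt) : generating a -> forall B, exists p : G, geval p a = B.
Proof.
move=> gen B; pose D : {pred 'M[k]_n.+1} := fun B => `[< exists p : G, geval p a = B >].
suff /asboolP : B \in D by [].
move/generated_subalgP: (gen B); apply.
  split=> [|c _ _ /asboolP[p <-] /asboolP[q <-]|_ _ /asboolP[p <-] /asboolP[q <-]];
    apply/asboolP.
  - by exists 1; rewrite geval1.
  - by exists (c *: p + q); rewrite gevalD gevalZ.
  - by exists (p * q); rewrite gevalM.
by move=> h; apply/asboolP; exists (generic_elt h); rewrite geval_generic.
Qed.

Lemma surj_generating (a : pt) : (forall B, exists p : G, geval p a = B) -> generating a.
Proof.
move=> surj B; have [[p pgen] <-] := surj B; rewrite /geval /=.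
pose D : {pred polymx k n m} := fun p => `[< polymx_eval a p \in generated_subalg a >].
suff /asboolP : p \in D by [].
have [c1 clin cmul] := generated_subalg_closed a.
move/generated_subalgP: pgen; apply.
  split=> [|c x y /asboolP xD /asboolP yD|x y /asboolP xD /asboolP yD]; apply/asboolP.
  - by rewrite polymx_eval1.
  - by rewrite polymx_evalD polymx_evalZ clin.
  - by rewrite polymx_evalM cmul.
by move=> h; apply/asboolP; rewrite polymx_eval_generic mem_generator.
Qed.

(** Functions of a point and of a scalar [z] that are polynomial in [z], with
    coefficients in the generic matrix ring; [z] is the polynomial variable. *)
Definition poly_value (l : seq (nat * G)) (x : pt) : Mz :=
  \sum_(p <- l) 'X^(p.1) *: map_mx polyC (geval p.2 x).

Definition polyrep (H : pt -> Mz) : Prop := exists l, forall x, H x = poly_value l x.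

Lemma polyrep_const p : polyrep (fun x => map_mx polyC (geval p x)).
Proof. by exists [:: (0%N, p)] => x; rewrite /poly_value big_seq1 expr0 scale1r. Qed.

Lemma polyrepX : polyrep (fun=> 'X%:M).
Proof.
exists [:: (1%N, 1)] => x; rewrite /poly_value big_seq1 expr1 geval1 map_mx1.
by rewrite scalemx1.
Qed.

Lemma polyrepD H K : polyrep H -> polyrep K -> polyrep (fun x => H x + K x).
Proof.
by move=> [l lE] [l' l'E]; exists (l ++ l') => x; rewrite lE l'E /poly_value big_cat.
Qed.

Lemma polyrepM H K : polyrep H -> polyrep K -> polyrep (fun x => H x * K x).
Proof.
move=> [l lE] [l' l'E].
exists [seq ((p.1 + p'.1)%N, p.2 * p'.2) | p <- l, p' <- l'] => x.
rewrite lE l'E /poly_value big_allpairs_dep mulr_suml; apply: eq_bigr => p _.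
rewrite mulr_sumr; apply: eq_bigr => p' _.
by rewrite -scalerAl -scalerAr scalerA -exprD gevalM map_mxM.
Qed.

Lemma eq_polyrep H K : H =1 K -> polyrep H -> polyrep K.
Proof. by move=> e [l lE]; exists l => x; rewrite -e. Qed.

Lemma polyrep_sum I (r : seq I) (H : I -> pt -> Mz) :
  (forall i, polyrep (H i)) -> polyrep (fun x => \sum_(i <- r) H i x).
Proof.
move=> HP; elim: r => [|i r IH].
  by apply: eq_polyrep (polyrep_const 0) => x; rewrite geval0 map_mx0 big_nil.
by apply: eq_polyrep (polyrepD (HP i) IH) => x; rewrite big_cons.
Qed.

Lemma polyrep_prod I (r : seq I) (H : I -> pt -> Mz) :
  (forall i, polyrep (H i)) -> polyrep (fun x => \prod_(i <- r) H i x).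
Proof.
move=> HP; elim: r => [|i r IH].
  by apply: eq_polyrep (polyrep_const 1) => x; rewrite geval1 map_mx1 big_nil.
by apply: eq_polyrep (polyrepM (HP i) IH) => x; rewrite big_cons.
Qed.

Lemma polyrepZ c H : polyrep H -> polyrep (fun x => c%:P *: H x).
Proof.
move=> HP; apply: eq_polyrep (polyrepM (polyrep_const c%:A) HP) => x.
by rewrite gevalZ geval1 map_mxZ map_mx1 -scalerAl mul1r.
Qed.

Lemma polyrep_altprod q (L R y : 'I_q -> pt -> Mz) :
  (forall l, polyrep (L l)) -> (forall l, polyrep (R l)) -> (forall l, polyrep (y l)) ->
  polyrep (fun x => altprod (L^~ x) (R^~ x) (y^~ x)).
Proof.
move=> LP RP yP; apply: polyrep_sum => s; apply: polyrepM.
  apply: eq_polyrep (polyrep_const ((-1) ^+ s)) => x.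
  by rewrite -geval_morE !rmorph_sign.
by apply: polyrep_prod => l; apply: polyrepM => //; apply: polyrepM.
Qed.

(** The powers of the substituted matrix are put on the left of the
    coefficients, with which they need not commute. *)
Definition left_subst (rho : 'M[k]_n.+1) (A : Mz) : 'M[k]_n.+1 :=
  \sum_i \sum_j horner_mx rho (A i j) * delta_mx i j.

Lemma left_substD rho : {morph left_subst rho : A B / A + B}.
Proof.
move=> A B; rewrite -big_split; apply: eq_bigr => i _; rewrite -big_split.
by apply: eq_bigr => j _; rewrite mxE rmorphD mulrDl.
Qed.

Lemma left_subst0 rho : left_subst rho 0 = 0.
Proof.
by rewrite /left_subst big1 // => i _; rewrite big1 // => j _; rewrite mxE rmorph0 mul0r.
Qed.

Lemma left_substZ rho p B : left_subst rho (p *: map_mx polyC B) = horner_mx rho p * B.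
Proof.
rewrite [B in RHS]matrix_sum_delta mulr_sumr; apply: eq_bigr => i _.
rewrite mulr_sumr; apply: eq_bigr => j _.
rewrite !mxE rmorphM /= horner_mx_C -mulrA; congr (_ * _).
by rewrite -mulmxE mul_scalar_mx.
Qed.

(** The coefficients of [H] being elements of the generic matrix ring, so is the
    sum of their products by the powers of [r]. *)
Lemma left_subst_geval (r : G) H : polyrep H ->
  exists f : G, forall x, geval f x = left_subst (geval r x) (H x).
Proof.
move=> [l lE]; exists (\sum_(p <- l) r ^+ p.1 * p.2) => x.
rewrite lE /poly_value (big_morph _ (left_substD _) (left_subst0 _)).
rewrite -geval_morE rmorph_sum; apply: eq_bigr => p _.
by rewrite left_substZ rmorphM !rmorphXn /= horner_mx_X.
Qed.

End PolynomialFunctions.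

Section Homogenization.
Variables (k : closedFieldType) (nv : nat).

(** This is [Delta ^ e * p (Y / Delta)] with its denominators cleared, which is
    possible because [e = msize p] exceeds the degree of [p]. *)
Definition homogenize (p : {mpoly k[nv]}) (Delta : {poly k}) (Y : 'I_nv -> {poly k}) :=
  \sum_(e <- msupp p) p@_e *: (Delta ^+ (msize p - mdeg e) * \prod_i Y i ^+ e i).

Lemma homogenize_horner p Delta Y t : Delta.[t] != 0 ->
  (homogenize p Delta Y).[t] =
  Delta.[t] ^+ msize p * p.@[fun i => (Y i).[t] / Delta.[t]].
Proof.
move=> D0; rewrite mevalE mulr_sumr /homogenize horner_sum.
rewrite [LHS]big_seq [RHS]big_seq; apply: eq_bigr => e /msize_mdeg_lt lte.
rewrite hornerZ hornerM horner_exp horner_prod [RHS]mulrCA; congr (_ * _).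
have -> : \prod_i ((Y i).[t] / Delta.[t]) ^+ e i =
    (\prod_i (Y i).[t] ^+ e i) / Delta.[t] ^+ mdeg e.
  rewrite mdegE -prodrXr -prodf_div.
  by apply: eq_bigr => i _; rewrite expr_div_n.
rewrite -[msize p in RHS](subnK (ltnW lte)) exprD mulrACA mulfV ?expf_neq0 // mulr1.
by congr (_ * _); apply: eq_bigr => i _; rewrite horner_exp.
Qed.

End Homogenization.

Section RankOne.
Variables (k : fieldType) (n : nat).

(** Let [f] and [u] be eigenvectors of [rho], on the left and on the right.  The
    rows [w] lie in the hyperplane of the matrices [y] such that [f y u] is [0],
    so the determinant, as a linear form in the remaining row [y], is
    proportional to [f y u]. *)
Lemma rank_one_det (rho : 'M[k]_n.+1) t q0 (w : 'I_(mxcells n) -> 'M[k]_n.+1) :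
  root (char_poly rho) t ->
  (forall q, q != q0 -> exists A, w q = (t%:M - rho) * A \/ w q = A * (t%:M - rho)) ->
  exists f : 'rV_n.+1, exists u : 'cV_n.+1, forall y,
    \det (entry_mx (fun q => if q == q0 then y else w q)) = (f *m y *m u) 0 0.
Proof.
move=> rt wE.
have det0 : \det (t%:M - rho) = 0.
  move: rt; rewrite rootE => /eqP <-; rewrite -horner_evalE -det_map_mx.
  congr (\det _); apply/matrixP => i j; rewrite !mxE /= horner_evalE.
  by rewrite hornerD hornerN hornerC hornerMn hornerX.
have [f f0 fE] : exists2 f : 'rV_n.+1, f != 0 & f *m (t%:M - rho) = 0.
  by apply/det0P/eqP.
have [v v0 vE] : exists2 v : 'rV_n.+1, v != 0 & v *m (t%:M - rho)^T = 0.
  by apply/det0P; rewrite det_tr det0.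
pose u := v^T; have uE : (t%:M - rho) *m u = 0.
  by apply: trmx_inj; rewrite trmx_mul /u trmxK vE trmx0.
pose phi (y : 'M[k]_n.+1) := (f *m y *m u) 0 0.
have phiE y : phi y = \sum_q y (cell_row q) (cell_col q) * (f 0 (cell_row q) * v 0 (cell_col q)).
  rewrite -(sum_cells (fun i j => y i j * (f 0 i * v 0 j))) exchange_big /phi mxE.
  apply: eq_bigr => j _; rewrite !mxE mulr_suml; apply: eq_bigr => i _.
  by rewrite mulrCA mulrA.
have phiw q : q != q0 -> phi (w q) = 0.
  move=> /wE[A [->|->]]; rewrite /phi -mulmxE.
    by rewrite mulmxA fE !mul0mx mxE.
  by rewrite -!mulmxA uE !mulmx0 mxE.
pose D y := \det (entry_mx (fun q => if q == q0 then y else w q)).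
have D_phi0 y : phi y = 0 -> D y = 0.
  move=> py; apply/eqP; rewrite /D -det_tr; apply/det0P.
  exists (\row_q (f 0 (cell_row q) * v 0 (cell_col q))).
    have [i fi] : exists i, f 0 i != 0 by apply/rV0Pn.
    have [j vj] : exists j, v 0 j != 0 by apply/rV0Pn.
    by apply/rV0Pn; exists (cell i j); rewrite mxE cell_rowK cell_colK mulf_neq0.
  apply/rowP => q; rewrite !mxE.
  transitivity (phi (if q == q0 then y else w q)).
    by rewrite phiE; apply: eq_bigr => q' _; rewrite !mxE mulrC.
  by case: eqP => [//|/eqP/phiw].
have D_lin a y y' : D (a *: y + y') = a * D y + D y'.
  rewrite -[D y']mul1r; apply: (determinant_multilinear (i0 := q0)).
  - by apply/rowP => q; rewrite !mxE eqxx !mxE mul1r.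
  - apply/matrixP => q q'; rewrite !mxE; case: eqP => // e.
    by have := neq_lift q0 q; rewrite e eqxx.
  - apply/matrixP => q q'; rewrite !mxE; case: eqP => // e.
    by have := neq_lift q0 q; rewrite e eqxx.
have [y1 y1E] : exists y1, phi y1 = 1.
  have [i fi] : exists i, f 0 i != 0 by apply/rV0Pn.
  have [j vj] : exists j, v 0 j != 0 by apply/rV0Pn.
  exists ((f 0 i * v 0 j)^-1 *: delta_mx i j).
  rewrite phiE (bigD1 (cell i j)) //= big1 => [|q qij].
    by rewrite !mxE cell_rowK cell_colK !eqxx mulr1 addr0 mulVf // mulf_neq0.
  move: qij; rewrite cell_eq negb_and !mxE => /orP[/negPf->|/negPf->].
    by rewrite mulr0 mul0r.
  by rewrite andbF mulr0 mul0r.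
exists (D y1 *: f), u => y.
have phiB : phi (- phi y *: y1 + y) = 0.
  rewrite /phi mulmxDr mulmxDl mxE -scalemxAr -scalemxAl mxE -/(phi y) -/(phi y1).
  by rewrite y1E mulr1 addNr.
have := D_phi0 _ phiB; rewrite D_lin mulNr addrC => /eqP; rewrite subr_eq0 => /eqP.
rewrite -/(D y) => ->.
by rewrite -!scalemxAl mxE mulrC.
Qed.

End RankOne.

Section Separation.
Variables (k : closedFieldType) (n m : nat).
Local Notation G := (generic_ring k n m).
Local Notation pt := (point k n m).
Local Notation d := (mxcells n).
Local Notation "'Mz'" := 'M[{poly k}]_n.+1.
(** Elements whose values at the point to be separated are the matrix units. *)
Variable g : 'I_n.+1 -> 'I_n.+1 -> G.

Definition const_mx_at (p : G) (x : pt) : Mz := map_mx polyC (geval p x).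

(** The fixed matrix that accompanies determinants in alternating products. *)
Definition capelli_coef (x : pt) : 'M[k]_n.+1 :=
  altprod (fun l => geval (g 0 (cell_row l)) x) (fun l => geval (g (cell_col l) 0) x)
    (@unit_cell n k).
Local Notation C := capelli_coef.

(** A determinant comes from the generic matrix ring only after multiplication
    by [C], hence a product of [e] determinants after multiplication by the
    [e]-th power of [C]: this is a grading. *)
Definition scalar_rep e (s : pt -> {poly k}) : Prop :=
  polyrep (fun x => s x *: map_mx polyC (C x ^+ e)).

Lemma eq_scalar_rep e s t : s =1 t -> scalar_rep e s -> scalar_rep e t.
Proof. by move=> st; apply: eq_polyrep => x; rewrite st. Qed.

Lemma scalar_repM e f s t : scalar_rep e s -> scalar_rep f t ->
  scalar_rep (e + f) (fun x => s x * t x).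
Proof.
move=> sP tP; apply: eq_polyrep (polyrepM sP tP) => x.
by rewrite -scalerAl -scalerAr scalerA exprD map_mxM.
Qed.

Lemma scalar_rep1 : scalar_rep 0 (fun=> 1).
Proof.
apply: eq_polyrep (polyrep_const 1) => x.
by rewrite geval1 expr0 scale1r.
Qed.

Lemma scalar_repZ c e s : scalar_rep e s -> scalar_rep e (fun x => c *: s x).
Proof.
by move=> sP; apply: eq_polyrep (polyrepZ c sP) => x; rewrite scalerA mul_polyC.
Qed.

Lemma scalar_rep_sum e I (r : seq I) (s : I -> pt -> {poly k}) :
  (forall i, scalar_rep e (s i)) -> scalar_rep e (fun x => \sum_(i <- r) s i x).
Proof.
move=> sP; apply: eq_polyrep (polyrep_sum r sP) => x.
by rewrite scaler_suml.
Qed.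

Lemma scalar_rep_prod I (r : seq I) (e : I -> nat) (s : I -> pt -> {poly k}) :
  (forall i, scalar_rep (e i) (s i)) ->
  scalar_rep (\sum_(i <- r) e i) (fun x => \prod_(i <- r) s i x).
Proof.
move=> sP; elim: r => [|i r IH].
  by rewrite big_nil; apply: eq_scalar_rep scalar_rep1 => x; rewrite big_nil.
rewrite big_cons; apply: eq_scalar_rep (scalar_repM (sP i) IH) => x.
by rewrite big_cons.
Qed.

Lemma scalar_repX e q s : scalar_rep e s -> scalar_rep (e * q) (fun x => s x ^+ q).
Proof.
move=> sP; have := scalar_rep_prod (index_enum 'I_q) (e := fun=> e) (fun _ : 'I_q => sP).
rewrite sum_nat_const card_ord mulnC; apply: eq_scalar_rep => x.
by rewrite prodr_const card_ord.
Qed.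

Lemma scalar_rep_det e q (A : pt -> 'M[{poly k}]_q) :
  (forall i j, scalar_rep e (fun x => A x i j)) ->
  scalar_rep (q * e) (fun x => \det (A x)).
Proof.
move=> AP; apply: scalar_rep_sum => s.
have := scalar_rep_prod (index_enum 'I_q) (e := fun=> e) (fun i => AP i (s i)).
rewrite sum_nat_const card_ord => /(scalar_repZ ((-1) ^+ s)).
by apply: eq_scalar_rep => x; rewrite scaler_sign mulr_sign.
Qed.

Lemma scalar_rep_entries (y : 'I_d -> pt -> Mz) : (forall l, polyrep (y l)) ->
  scalar_rep 1 (fun x => \det (entry_mx (y^~ x))).
Proof.
move=> yP.
have := polyrep_altprod (fun l => polyrep_const (g 0 (cell_row l)))
  (fun l => polyrep_const (g (cell_col l) 0)) yP.
apply: eq_polyrep => x; rewrite altprod_det expr1; congr (_ *: _).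
rewrite [RHS]rmorph_altprod; apply: eq_altprod => // l.
by rewrite /= /unit_cell map_delta_mx.
Qed.

Lemma scalar_rep_homogenize nv (p : {mpoly k[nv]}) e Delta Y :
  scalar_rep e Delta -> (forall i, scalar_rep e (Y i)) ->
  scalar_rep (e * msize p) (fun x => homogenize p (Delta x) (fun i => Y i x)).
Proof.
move=> DP YP; rewrite /homogenize.
pose s (f : 'X_{1..nv}) x :=
  if (mdeg f < msize p)%N then p@_f *: (Delta x ^+ (msize p - mdeg f) * \prod_i Y i x ^+ f i)
  else 0.
apply: (@eq_scalar_rep _ (fun x => \sum_(f <- msupp p) s f x)) => [x|].
  rewrite [LHS]big_seq [RHS]big_seq; apply: eq_bigr => f /msize_mdeg_lt lt.
  by rewrite /s lt.
apply: scalar_rep_sum => f; rewrite /s; case lt: (mdeg f < msize p)%N; last first.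
  apply: eq_polyrep (polyrep_const 0) => x.
  by rewrite geval0 map_mx0 scale0r.
apply: scalar_repZ.
have -> : (e * msize p = e * (msize p - mdeg f) + \sum_(i < nv) e * f i)%N.
  by rewrite -big_distrr /= -mdegE -mulnDr subnK // ltnW.
apply: scalar_repM; first exact: scalar_repX.
by apply: scalar_rep_prod => i; apply: scalar_repX.
Qed.

Local Notation r := (g 0 0).
Local Notation zr := (fun x => 'X%:M - const_mx_at r x).

(** All the rows but one are multiples of [z - r], on the left or on the right;
    where [z = 1] and the [g i j] are the matrix units, they are the matrix units
    other than the first one, which is [r]. *)
Definition eigen_rows (y : pt -> Mz) (q : 'I_d) (x : pt) : Mz :=
  if q == cell 0 0 then y x
  else if cell_row q != 0 then zr x * const_mx_at (g (cell_row q) (cell_col q)) x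
  else const_mx_at (g (cell_row q) (cell_col q)) x * zr x.

Definition eigen_form (y : G) (x : pt) : {poly k} :=
  \det (entry_mx (fun q => eigen_rows (const_mx_at y) q x)).

Lemma scalar_rep_eigen_form y : scalar_rep 1 (eigen_form y).
Proof.
apply: scalar_rep_entries => q.
have zrP : polyrep zr.
  have := polyrepD (@polyrepX k n m) (polyrepZ (-1) (polyrep_const r)).
  by apply: eq_polyrep => x; rewrite /= rmorphN rmorph1 scaleN1r.
rewrite /eigen_rows; case: eqP => _; first exact: polyrep_const.
by case: eqP => _ /=; apply: polyrepM => //; apply: polyrep_const.
Qed.

(** Where [z] is an eigenvalue of [r], the entries are of the form [f g_(0,i) y
    g_(j,0) u], so that the frame of [y] is [V y W], where [V] has the rows
    [f g_(0,i)] and [W] the columns [g_(j,0) u].  The frame of a generator [x],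
    multiplied by the inverse of the frame [V W] of [1], is therefore a conjugate
    of [x]; the adjugate avoids the denominators. *)
Definition frame_mx (y : G) (x : pt) : 'M[{poly k}]_n.+1 :=
  \matrix_(i, j) eigen_form (g 0 i * y * g j 0) x.

Definition frame_det x := \det (frame_mx 1 x).

Definition frame_coord (x : pt) (v : 'I_(ncoord n m)) : {poly k} :=
  let: (h, i, j) := enum_val v in
  (\adj (frame_mx 1 x) *m frame_mx (generic_elt k n h) x) i j.

Lemma scalar_rep_frame_det : scalar_rep n.+1 frame_det.
Proof.
rewrite -[n.+1]muln1; apply: scalar_rep_det => i j.
apply: eq_scalar_rep (scalar_rep_eigen_form (g 0 i * 1 * g j 0)) => x.
by rewrite mxE.
Qed.

Lemma scalar_rep_frame_coord v : scalar_rep n.+1 (frame_coord^~ v).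
Proof.
rewrite /frame_coord; case: (enum_val v) => [[h i] j] /=.
refine (@eq_scalar_rep _ (fun x => \sum_(l < n.+1)
   ((-1) ^+ (l + i) *: \det (row' l (col' i (frame_mx 1 x)))) *
   frame_mx (generic_elt k n h) x l j) _ _ _) => [x|].
  rewrite mxE; apply: eq_bigr => l _; rewrite [X in _ = X * _]mxE /cofactor.
  by rewrite -[in LHS]signr_odd -[in RHS]signr_odd scaler_sign mulr_sign.
apply: scalar_rep_sum => l.
have minorP : scalar_rep (n * 1) (fun x => \det (row' l (col' i (frame_mx 1 x)))).
  apply: scalar_rep_det => a b.
  apply: eq_scalar_rep (scalar_rep_eigen_form (g 0 (lift l a) * 1 * g (lift i b) 0)) => x.
  by rewrite !mxE.
have entryP : scalar_rep 1 (fun x => frame_mx (generic_elt k n h) x l j).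
  apply: eq_scalar_rep (scalar_rep_eigen_form (g 0 l * generic_elt k n h * g j 0)) => x.
  by rewrite mxE.
have := scalar_repM (scalar_repZ ((-1) ^+ (l + i)) minorP) entryP.
by rewrite muln1 addn1.
Qed.

Definition eigen_rows_at t (y : 'M[k]_n.+1) (x : pt) (q : 'I_d) : 'M[k]_n.+1 :=
  if q == cell 0 0 then y
  else if cell_row q != 0 then (t%:M - geval r x) * geval (g (cell_row q) (cell_col q)) x
  else geval (g (cell_row q) (cell_col q)) x * (t%:M - geval r x).

Lemma eigen_form_horner t y x :
  (eigen_form y x).[t] = \det (entry_mx (eigen_rows_at t (geval y x) x)).
Proof.
rewrite -horner_evalE /eigen_form -det_map_mx; congr (\det _).
have evC (A : 'M[k]_n.+1) : map_mx (horner_eval t) (map_mx polyC A) = A.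
  by apply/matrixP => i j; rewrite !mxE /= horner_evalE hornerC.
have evz : map_mx (horner_eval t) (zr x) = t%:M - geval r x.
  apply/matrixP => i j; rewrite !mxE /= horner_evalE.
  by rewrite hornerD hornerN hornerC hornerMn hornerX.
apply/matrixP => q q'; rewrite !mxE /eigen_rows /eigen_rows_at.
transitivity (map_mx (horner_eval t) (if q == cell 0 0 then const_mx_at y x
  else if cell_row q != 0 then zr x * const_mx_at (g (cell_row q) (cell_col q)) x
  else const_mx_at (g (cell_row q) (cell_col q)) x * zr x) (cell_row q') (cell_col q')).
  by rewrite [RHS]mxE.
by case: (q == cell 0 0); [|case: (cell_row q != 0)]; rewrite ?map_mxM ?evz ?evC.
Qed.

(** The conjugation is by the matrix [W] above, which is invertible because the
    determinant of [V W] is not zero. *)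
Lemma frame_conj x t : root (char_poly (geval r x)) t -> (frame_det x).[t] != 0 ->
  exists2 b, b \is a GRing.unit &
    (fun v => (frame_coord x v).[t] / (frame_det x).[t]) =1 coords (conj_point b x).
Proof.
move=> rt D0.
have [f [u fuE]] : exists f : 'rV_n.+1, exists u : 'cV_n.+1, forall y,
    \det (entry_mx (eigen_rows_at t y x)) = (f *m y *m u) 0 0.
  apply: (rank_one_det rt) => q _; exists (geval (g (cell_row q) (cell_col q)) x).
  by case: (cell_row q != 0); [left | right].
pose V : 'M[k]_n.+1 := \matrix_i (f *m geval (g 0 i) x).
pose W : 'M[k]_n.+1 := \matrix_(i, j) (geval (g j 0) x *m u) i 0.
have frameE y : map_mx (horner_eval t) (frame_mx y x) = V *m geval y x *m W.
  apply/matrixP => i j.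
  have -> : (V *m geval y x *m W) i j = (row i V *m geval y x *m col j W) 0 0.
    rewrite -row_mul [LHS]mxE [RHS]mxE; apply: eq_bigr => l _.
    by rewrite [X in _ = X * _]mxE [X in _ = _ * X]mxE.
  have -> : col j W = geval (g j 0) x *m u.
    by apply/colP => l; rewrite mxE [LHS]mxE.
  rewrite rowK [LHS]mxE /= horner_evalE [frame_mx y x i j]mxE eigen_form_horner fuE !gevalM -!mulmxE.
  by rewrite !mulmxA.
have frame1 : map_mx (horner_eval t) (frame_mx 1 x) = V *m W.
  by rewrite frameE geval1 mulmx1.
have detE : (frame_det x).[t] = \det V * \det W.
  by rewrite -horner_evalE -det_map_mx frame1 det_mulmx.
move: (D0); rewrite detE mulf_eq0 negb_or => /andP[V0 W0].
have Wu : W \in unitmx by rewrite unitmxE unitfE.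
have Vu : V \in unitmx by rewrite unitmxE unitfE.
exists W^-1; first by rewrite unitrV.
move=> v; rewrite /frame_coord /coords; case: (enum_val v) => [[h i] j] /=.
rewrite ffunE invrK -[W^-1]/(invmx W).
have -> : ((\adj (frame_mx 1 x) *m frame_mx (generic_elt k n h) x) i j).[t] =
    (\adj (V *m W) *m (V *m x h *m W)) i j.
  rewrite -frame1 -[x h](geval_generic h) -frameE -map_mx_adj -map_mxM [RHS]mxE.
  by rewrite /= horner_evalE.
rewrite -det_mulmx mulrC.
have VWu : V *m W \in unitmx by rewrite unitmx_mul Vu.
transitivity ((invmx (V *m W) *m (V *m x h *m W)) i j).
  by rewrite /invmx VWu -scalemxAl [RHS]mxE.
have -> : invmx (V *m W) = invmx W *m invmx V := invrM Vu Wu.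
by rewrite -!mulmxA mulKmx // !mulmxA.
Qed.

(** The value of [p] at the conjugate of [x] given by the frame.  The factor
    [frame_det x] makes it vanish at the eigenvalues for which there is no
    frame. *)
Definition conj_value (p : {mpoly k[ncoord n m]}) (x : pt) : {poly k} :=
  frame_det x * homogenize p (frame_det x) (frame_coord x).

Lemma scalar_rep_conj_value p :
  scalar_rep (n.+1 + n.+1 * msize p) (conj_value p).
Proof.
apply: scalar_repM; first exact: scalar_rep_frame_det.
exact: (scalar_rep_homogenize p scalar_rep_frame_det scalar_rep_frame_coord).
Qed.

(** Each root of the characteristic polynomial, taken with its multiplicity,
    contributes a factor [s], so the characteristic polynomial divides the power
    of [s]; then Cayley-Hamilton applies. *)
Lemma char_poly_dvd_exp (rho : 'M[k]_n.+1) (s : {poly k}) :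
  (forall t, root (char_poly rho) t -> s.[t] = 0) -> horner_mx rho (s ^+ n.+1) = 0.
Proof.
move=> sroot; have [ts tsE] := closed_field_poly_normal (char_poly rho).
move: tsE; rewrite (monicP (char_poly_monic rho)) scale1r => tsE.
have size_ts : size ts = n.+1.
  have := congr1 (fun p : {poly k} => size p) tsE.
  by rewrite size_char_poly size_prod_XsubC => -[].
suff /dvdpP[q ->] : char_poly rho %| s ^+ n.+1.
  by rewrite rmorphM /= Cayley_Hamilton mulr0.
have ts_root t : t \in ts -> s.[t] = 0.
  by move=> tts; apply: sroot; rewrite tsE root_prod_XsubC.
rewrite tsE -size_ts; elim: (ts) ts_root => [|t ts' IH] ts_root.
  by rewrite big_nil dvd1p.
rewrite big_cons exprS dvdp_mul //; last first.
  by apply: IH => t' tt'; apply: ts_root; rewrite inE tt' orbT.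
by rewrite dvdp_XsubCl rootE ts_root // inE eqxx.
Qed.

Lemma horner_mx_eigen (rho B : 'M[k]_n.+1) c (s : {poly k}) :
  rho * B = c *: B -> horner_mx rho s * B = s.[c] *: B.
Proof.
move=> rB; elim/poly_ind: s => [|s a IH].
  by rewrite rmorph0 mul0r horner0 scale0r.
rewrite rmorphD rmorphM /= horner_mx_X horner_mx_C mulrDl -mulrA rB.
rewrite -scalerAr IH scalerA hornerMXaddC scalerDl mulrC; congr (_ + _).
exact: mul_scalar_mx.
Qed.

Section AtMatrixUnits.
Variable a : pt.
Hypothesis ga : forall i j, geval (g i j) a = delta_mx i j.

Lemma capelli_coef_units : C a = delta_mx 0 0.
Proof.
rewrite -(altprod_unit_cells n k); apply: eq_altprod => // l.
  by rewrite ga /unit_cell cell_rowK cell_colK.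
by rewrite ga /unit_cell cell_rowK cell_colK.
Qed.

Lemma eigen_form_units y : (eigen_form y a).[1] = geval y a 0 0.
Proof.
rewrite eigen_form_horner.
have rowsE q : q != cell 0 0 -> eigen_rows_at 1 (geval y a) a q = unit_cell k q.
  move=> q0; rewrite /eigen_rows_at (negPf q0) !ga.
  move: q0; rewrite cell_eq negb_and /unit_cell.
  case: eqVneq => [->|r0] /= c0; rewrite -!mulmxE.
    by rewrite mulmxBr mul_mx_scalar scale1r mul_delta_mx_0 // subr0.
  by rewrite mulmxBl mul_scalar_mx scale1r mul_delta_mx_0 1?eq_sym // subr0.
have eqE q q' : unit_cell k q (cell_row q') (cell_col q') = (q' == q)%:R.
  by rewrite mxE -[q in RHS]cellK cell_eq.
set A := entry_mx _.
have AE q q' : q != cell 0 0 -> A q q' = (q' == q)%:R.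
  by move=> q0; rewrite mxE rowsE // eqE.
rewrite (expand_det_col A (cell 0 0)) (bigD1 (cell 0 0)) //= big1 ?addr0.
  rewrite mxE /eigen_rows_at eqxx cell_rowK cell_colK /cofactor -signr_odd oddD addbb.
  rewrite expr0 mul1r (_ : row' _ _ = 1%:M) ?det1 ?mulr1 //.
  apply/matrixP => q q'; rewrite mxE [LHS]mxE AE ?(inj_eq lift_inj) 1?eq_sym ?neq_lift //.
  by rewrite !mxE eq_sym.
by move=> q q0; rewrite AE // eq_sym (negPf q0) mul0r.
Qed.

Lemma frame_units y : map_mx (horner_eval 1) (frame_mx y a) = geval y a.
Proof.
apply/matrixP => i j; rewrite mxE /= horner_evalE mxE eigen_form_units.
rewrite !gevalM !ga -!mulmxE mxE (bigD1 j) //= big1 ?addr0 => [|l lj].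
  rewrite [delta_mx j 0 _ _]mxE !eqxx mulr1 mxE (bigD1 i) //= big1 ?addr0 => [|l li].
    by rewrite mxE !eqxx mul1r.
  by rewrite mxE (negPf li) andbF mul0r.
by rewrite [delta_mx j 0 _ _]mxE (negPf lj) mulr0.
Qed.

Lemma conj_value_units p : (conj_value p a).[1] = p.@[coords a].
Proof.
have D1 : (frame_det a).[1] = 1.
  by rewrite -horner_evalE -det_map_mx frame_units geval1 det1.
rewrite hornerM homogenize_horner D1 ?oner_neq0 // expr1n !mul1r.
apply: meval_eq => v; rewrite divr1 /frame_coord /coords.
case: (enum_val v) => [[h i] j].
have E1 : map_mx (horner_eval 1) (frame_mx 1 a) = 1%:M.
  exact: etrans (frame_units 1) (geval1 a).
have E2 : map_mx (horner_eval 1) (frame_mx (generic_elt k n h) a) = a h.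
  exact: etrans (frame_units (generic_elt k n h)) (geval_generic h a).
move: (frame_mx 1 a) (frame_mx (generic_elt k n h) a) E1 E2 => A B E1 E2.
transitivity (map_mx (horner_eval 1) (\adj A *m B) i j).
  by rewrite [RHS]mxE /= horner_evalE.
by rewrite map_mxM map_mx_adj E1 E2 adj1 mul1mx.
Qed.

(** The [n.+1]-th power of [conj_value p], with [r] in place of [z], vanishes on
    [X] by Cayley-Hamilton.  At [a], the matrix [r] is the first matrix unit,
    with eigenvalue [1], and the conjugate given by the frame is [a] itself. *)
Lemma separate_at (X : pt -> Prop) (p : {mpoly k[ncoord n m]}) : PGL_stable X ->
  (forall x, X x -> p.@[coords x] = 0) -> p.@[coords a] != 0 ->
  exists2 f : G, forall x, X x -> geval f x = 0 & geval f a != 0.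
Proof.
move=> Xst pX pa.
have sP := scalar_repX n.+1 (scalar_rep_conj_value p).
have [f fE] := left_subst_geval r sP.
exists f => [x xX|]; rewrite fE left_substZ.
  rewrite char_poly_dvd_exp ?mul0r // => t rt.
  rewrite hornerM; have [->|D0] := eqVneq (frame_det x).[t] 0; first by rewrite mul0r.
  have [b bu bE] := frame_conj rt D0.
  by rewrite homogenize_horner // (meval_eq _ bE) pX ?mulr0 //; apply: Xst.
rewrite capelli_coef_units expr_delta_mx00; last by rewrite muln_gt0 addn_gt0.
rewrite ga (@horner_mx_eigen _ _ 1); last first.
  by rewrite scale1r -mulmxE mul_delta_mx.
rewrite horner_exp conj_value_units scaler_eq0 expf_eq0 (negPf pa) andbF /=.
by apply/eqP => /matrixP/(_ 0 0)/eqP; rewrite !mxE !eqxx oner_eq0.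
Qed.

End AtMatrixUnits.
End Separation.

(** In other words, a variety is determined by the noncommutative functions
    that vanish on it. *)
Lemma separation (k : closedFieldType) (n m : nat) (X : point k n m -> Prop) a :
  is_nvariety X -> generating a -> ~ X a ->
  exists2 f : generic_ring k n m, forall x, X x -> geval f x = 0 & geval f a != 0.
Proof.
move=> [_ Xst [Z [P PE] XE]] gen nXa.
have [p Pp pa] : exists2 p, P p & p.@[coords a] != 0.
  apply: contrapT => ne; apply: nXa; apply/XE; split=> //; apply/PE => p Pp.
  by apply/eqP/negP => /negP pa; apply: ne; exists p.
have [g gE] := choice (fun ij : 'I_n.+1 * 'I_n.+1 =>
  generating_surj gen (delta_mx ij.1 ij.2)).
apply: (separate_at (g := fun i j => g (i, j)) _ Xst _ pa) => [i j|x /XE[_ /PE]].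
  exact: (gE (i, j)).
exact.
Qed.

(** * Points and homomorphisms *)

Lemma subalgebra_ind (k : comNzRingType) (A : algType k) m (s : 'I_m -> A)
    (P : subalgebra s -> Prop) :
  P 1 -> (forall c x y, P x -> P y -> P (c *: x + y)) ->
  (forall x y, P x -> P y -> P (x * y)) ->
  (forall i, P (Subalgebra (mem_generator s i))) -> forall x, P x.
Proof.
move=> P1 Plin PM Pgen x.
pose B : {pred A} := fun a => `[< exists2 y : subalgebra s, val y = a & P y >].
have /asboolP[y /val_inj -> //] : val x \in B.
have /generated_subalgP := subalg_valP x; apply.
  split=> [|c _ _ /asboolP[y <- Py] /asboolP[z <- Pz]|
    _ _ /asboolP[y <- Py] /asboolP[z <- Pz]]; apply/asboolP.
  - by exists 1.
  - by exists (c *: y + z); [|exact: Plin].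
  - by exists (y * z); [|exact: PM].
by move=> i; apply/asboolP; exists (Subalgebra (mem_generator s i)).
Qed.

Lemma generated_ind (k : comNzRingType) (A : algType k) m (s : 'I_m -> A)
    (P : A -> Prop) : generates s ->
  P 1 -> (forall c x y, P x -> P y -> P (c *: x + y)) ->
  (forall x y, P x -> P y -> P (x * y)) -> (forall i, P (s i)) -> forall x, P x.
Proof.
move=> gen P1 Plin PM Pgen x; pose B : {pred A} := fun a => `[< P a >].
suff /asboolP : x \in B by [].
move/generated_subalgP: (gen x); apply; last by move=> i; apply/asboolP.
split=> [|c y z /asboolP yB /asboolP zB|y z /asboolP yB /asboolP zB]; apply/asboolP => //.
  exact: Plin.
exact: PM.
Qed.

Section QuotientMorphism.
Variables (k : comNzRingType) (A : algType k) (I : twoSidedIdeal A).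

Lemma qclass_lin c x y : qclass I (c *: x + y) = c *: qclass I x + qclass I y.
Proof. by rewrite qclassD -qscaleE. Qed.

Lemma qclassM x y : qclass I (x * y) = qclass I x * qclass I y.
Proof. by rewrite -qmulE. Qed.

Lemma qclass1 : qclass I 1 = 1.
Proof. by []. Qed.

End QuotientMorphism.

Section Points.
Variables (k : closedFieldType) (n : nat).
Implicit Types X Y : irr_nvariety k n.

Lemma coord_ring_generates X : generates (@coord_fun k n X).
Proof.
move=> g; rewrite -[g]qreprK; elim/subalgebra_ind: (qrepr g).
- by rewrite qclass1; case: (generated_subalg_closed (@coord_fun k n X)).
- move=> c x y xP yP; rewrite qclass_lin.
  by case: (generated_subalg_closed (@coord_fun k n X)) => _ h _; apply: h.
- move=> x y xP yP; rewrite qclassM.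
  by case: (generated_subalg_closed (@coord_fun k n X)) => _ _ h; apply: h.
- by move=> i; apply: mem_generator.
Qed.

Lemma ev0 X (x : nv_point X) : ev 0 x = 0.
Proof. by apply: (addrI (ev 0 x)); rewrite -evD !addr0. Qed.

Definition ev_mor X (x : nv_point X) :
    {lrmorphism PI_coordinate_ring X -> 'M[k]_n.+1} :=
  @lrmorphism_of_fun k (PI_coordinate_ring X) 'M[k]_n.+1 (fun g => ev g x)
    (fun c g h => etrans (evD _ _ _) (congr1 (+%R^~ _) (evZ _ _ _)))
    (conj (ev1 x) (fun g h => evM g h x)).

Lemma ev_surj X (x : nv_point X) : surjective (fun g => ev g x).
Proof.
move=> B; case: (nv_axiom X) => gen _ _.
have [p <-] := generating_surj (gen _ (svalP x)) B.
by exists (qclass _ p); rewrite ev_class.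
Qed.

(** The images of the generators form a generating tuple at which every element
    of the generic matrix ring that vanishes on [X] vanishes; by separation, this
    tuple is a point of [X]. *)
Lemma point_of_hom X (phi : {lrmorphism PI_coordinate_ring X -> 'M[k]_n.+1}) :
  surjective phi -> exists x : nv_point X, forall g, phi g = ev g x.
Proof.
move=> phi_surj; pose a : point k n (nv_dim X) := [ffun h => phi (coord_fun h)].
have phiE p : phi (qclass (vanishing_ideal (X := X)) p) = geval p a.
  elim/subalgebra_ind: p => [|c p q IHp IHq|p q IHp IHq|h].
  - by rewrite qclass1 rmorph1 geval1.
  - by rewrite qclass_lin linearP /= IHp IHq gevalD gevalZ.
  - by rewrite qclassM rmorphM /= IHp IHq gevalM.
  - by rewrite geval_generic ffunE.
have aX : X a.
  apply: contrapT => nXa.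
  have gen : generating a.
    apply: surj_generating => B; have [g <-] := phi_surj B.
    by exists (qrepr g); rewrite -phiE qreprK.
  have [f fX fa] := separation (nv_axiom X) gen nXa.
  move: fa; rewrite -phiE (_ : qclass _ f = 0) ?rmorph0 ?eqxx //.
  by apply: ev_inj => x; rewrite ev_class fX ?ev0 //; apply: (svalP x).
exists (exist _ a aX) => g.
by rewrite -[g]qreprK phiE ev_class.
Qed.

Lemma pullback_morphism X Y (f : regular_map X Y) : PIn_morphism n (pullback f).
Proof.
move=> phi /point_of_hom[x phiE] B.
have [g <-] := ev_surj (sval f x) B.
by exists g; rewrite /= phiE pullbackE.
Qed.

End Points.

(** * The variety of a prime algebra *)

Section ConjugatePolynomial.
Variables (k : closedFieldType) (n m : nat).
Implicit Types (x : point k n m) (p : {mpoly k[ncoord n m]}).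

(** Up to a power of the determinant, the value of [p] at the conjugate of [x]
    by the matrix of parameter [z] on the line from [g1] to [g2]. *)
Definition line_value (g1 g2 : 'M[k]_n.+1) p x : {poly k} :=
  let h := map_mx polyC g1 + 'X *: map_mx polyC (g2 - g1) in
  homogenize p (\det h) (fun v => let: (l, i, j) := enum_val v in
    (h *m map_mx polyC (x l) *m \adj h) i j).

Definition line_det (g1 g2 : 'M[k]_n.+1) : {poly k} :=
  \det (map_mx polyC g1 + 'X *: map_mx polyC (g2 - g1)).

Lemma line_mx_horner (g1 g2 : 'M[k]_n.+1) t :
  map_mx (horner_eval t) (map_mx polyC g1 + 'X *: map_mx polyC (g2 - g1)) =
  g1 + t *: (g2 - g1).
Proof.
by apply/matrixP => i j; rewrite !mxE /= horner_evalE !hornerE.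
Qed.

Lemma line_det_horner g1 g2 t : (line_det g1 g2).[t] = \det (g1 + t *: (g2 - g1)).
Proof. by rewrite -horner_evalE -det_map_mx line_mx_horner. Qed.

Lemma line_value_horner g1 g2 p x t : (line_det g1 g2).[t] != 0 ->
  (line_value g1 g2 p x).[t] = (line_det g1 g2).[t] ^+ msize p *
    p.@[coords (conj_point (g1 + t *: (g2 - g1)) x)].
Proof.
move=> D0; rewrite homogenize_horner //; congr (_ * _); apply: meval_eq => v.
move: (D0) (line_mx_horner g1 g2 t); rewrite line_det_horner /line_det => h0.
move: (map_mx polyC g1 + _) (g1 + _) h0 => H h h0 Hh.
rewrite /coords; case: (enum_val v) => [[l i] j]; rewrite ffunE.
have -> : ((H *m map_mx polyC (x l) *m \adj H) i j).[t] = (h *m x l *m \adj h) i j.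
  transitivity (map_mx (horner_eval t) (H *m map_mx polyC (x l) *m \adj H) i j).
    by rewrite [RHS]mxE /= horner_evalE.
  rewrite !map_mxM map_mx_adj Hh; congr ((_ *m _ *m _) i j).
  by apply/matrixP => a b; rewrite !mxE /= horner_evalE hornerC.
have hu : h \in unitmx by rewrite unitmxE unitfE.
rewrite -[h^-1]/(invmx h) /invmx hu mulrC -!mulmxE -scalemxAr [RHS]mxE.
by [].
Qed.

(** Orbits are irreducible: on the line joining two conjugators, the
    determinant and both values are nonzero polynomials of the parameter, hence
    have a common nonroot. *)
Lemma orbit_irreducible x p1 p2 g1 g2 :
  g1 \is a GRing.unit -> g2 \is a GRing.unit ->
  p1.@[coords (conj_point g1 x)] != 0 -> p2.@[coords (conj_point g2 x)] != 0 ->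
  exists g, [/\ g \is a GRing.unit, p1.@[coords (conj_point g x)] != 0
    & p2.@[coords (conj_point g x)] != 0].
Proof.
move=> u1 u2 p1x p2x.
have unit_det (h : 'M[k]_n.+1) : (h \is a GRing.unit) = (\det h != 0).
  by rewrite -unitfE -unitmxE.
have D0 : (line_det g1 g2).[0] = \det g1.
  by rewrite line_det_horner scale0r addr0.
have D1 : (line_det g1 g2).[1] = \det g2.
  by rewrite line_det_horner scale1r addrC subrK.
have := u1; have := u2; rewrite !unit_det => d2 d1.
have v1 : line_value g1 g2 p1 x != 0.
  suff : (line_value g1 g2 p1 x).[0] != 0 by apply: contraNneq => ->; rewrite horner0.
  rewrite line_value_horner D0 // scale0r addr0 mulf_neq0 ?expf_neq0 //.
have v2 : line_value g1 g2 p2 x != 0.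
  suff : (line_value g1 g2 p2 x).[1] != 0 by apply: contraNneq => ->; rewrite horner0.
  by rewrite line_value_horner D1 // scale1r addrC subrK mulf_neq0 ?expf_neq0.
have d0 : line_det g1 g2 != 0 by apply: contraNneq d1 => d0; rewrite -D0 d0 horner0.
have : line_det g1 g2 * (line_value g1 g2 p1 x * line_value g1 g2 p2 x) != 0.
  by rewrite !mulf_neq0.
move=> /closed_nonrootP[t]; rewrite rootE !hornerM !mulf_eq0 !negb_or => /and3P[dt].
rewrite !line_value_horner // !mulf_eq0 !negb_or => /andP[_ p1t] /andP[_ p2t].
exists (g1 + t *: (g2 - g1)); split=> //.
by rewrite unit_det -line_det_horner.
Qed.

End ConjugatePolynomial.

Section VarietyOfAlgebra.
Variables (k : closedFieldType) (n : nat) (R : algType k).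
Hypothesis RP : PIn_object n R.
Variables (m : nat) (s : 'I_m -> R).
Hypothesis s_gen : generates s.
Local Notation G := (generic_ring k n m).
Local Notation pt := (point k n m).
Local Notation rep := {lrmorphism R -> 'M[k]_n.+1}.

Lemma reps_faithful (r : R) : (forall phi : rep, surjective phi -> phi r = 0) -> r = 0.
Proof.
move=> h; apply/eqP/negP => /negP r0.
by have [phi phis] := PI_representation RP r0; rewrite h ?eqxx.
Qed.

(** The relation between the values in the generic matrix ring and in [R] of a
    same noncommutative polynomial.  Matrix representations separate the
    elements of [R], hence it is the graph of a homomorphism. *)
Inductive same_word : G -> R -> Prop :=
| same_word1 : same_word 1 1
| same_word_gen h : same_word (generic_elt k n h) (s h)
| same_word_lin c p q x y : same_word p x -> same_word q y ->
    same_word (c *: p + q) (c *: x + y)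
| same_wordM p q x y : same_word p x -> same_word q y -> same_word (p * q) (x * y).

Definition rep_point (phi : rep) : pt := [ffun h => phi (s h)].

Lemma same_word_rep p x : same_word p x ->
  forall phi : rep, geval p (rep_point phi) = phi x.
Proof.
move=> w phi; elim: w => [|h|c p' q' x' y' _ IHp _ IHq|p' q' x' y' _ IHp _ IHq].
- by rewrite geval1 rmorph1.
- by rewrite geval_generic ffunE.
- by rewrite gevalD gevalZ IHp IHq linearP.
- by rewrite gevalM IHp IHq rmorphM.
Qed.

Lemma same_word_fun p x y : same_word p x -> same_word p y -> x = y.
Proof.
move=> /same_word_rep wx /same_word_rep wy; apply/eqP; rewrite -subr_eq0; apply/eqP.
by apply: reps_faithful => phi _; rewrite rmorphB /= -wx -wy subrr.
Qed.

Lemma same_word_total p : exists x, same_word p x.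
Proof.
elim/subalgebra_ind: p => [|c p q [x wx] [y wy]|p q [x wx] [y wy]|h].
- by exists 1; constructor.
- by exists (c *: x + y); constructor.
- by exists (x * y); constructor.
- by exists (s h); constructor.
Qed.

Lemma same_word_onto x : exists p, same_word p x.
Proof.
move: x; apply: (generated_ind (P := fun x => exists p, same_word p x) s_gen)
  => [|c x y [p wp] [q wq]|x y [p wp] [q wq]|h].
- by exists 1; constructor.
- by exists (c *: p + q); constructor.
- by exists (p * q); constructor.
- by exists (generic_elt k n h); constructor.
Qed.

Definition generic_value (p : G) : R := sval (cid (same_word_total p)).
Local Notation theta := generic_value.

Lemma thetaP p : same_word p (theta p).
Proof. exact: svalP (cid (same_word_total p)). Qed.

Lemma theta_lin c p q : theta (c *: p + q) = c *: theta p + theta q.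
Proof. by apply: same_word_fun (thetaP _) _; constructor; apply: thetaP. Qed.

Lemma thetaM p q : theta (p * q) = theta p * theta q.
Proof. by apply: same_word_fun (thetaP _) _; constructor; apply: thetaP. Qed.

Lemma theta1 : theta 1 = 1.
Proof. by apply: same_word_fun (thetaP _) _; constructor. Qed.

Lemma theta_gen h : theta (generic_elt k n h) = s h.
Proof. by apply: same_word_fun (thetaP _) _; constructor. Qed.

Lemma thetaB p q : theta (p - q) = theta p - theta q.
Proof. by rewrite -scaleN1r addrC theta_lin scaleN1r addrC. Qed.

Lemma theta_surj x : exists p, theta p = x.
Proof.
have [p wp] := same_word_onto x; exists p.
exact: same_word_fun (thetaP _) wp.
Qed.

Lemma theta_rep p (phi : rep) : phi (theta p) = geval p (rep_point phi).
Proof. by rewrite (same_word_rep (thetaP p)). Qed.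

(** A surjective representation of [R] is determined by the images of the
    generators. *)
Definition alg_points (a : pt) : Prop := exists2 phi : rep, surjective phi & rep_point phi = a.

Lemma alg_points_generating a : alg_points a -> generating a.
Proof.
move=> [phi phi_surj <-]; apply: surj_generating => B.
have [x <-] := phi_surj B; have [p <-] := theta_surj x.
by exists p; rewrite theta_rep.
Qed.

(** A generating tuple satisfying the relations of [R] gives a representation by
    substitution, which is surjective since the tuple generates. *)
Lemma alg_pointsE a :
  alg_points a <-> generating a /\ forall p, theta p = 0 -> geval p a = 0.
Proof.
split=> [aX|[gen rel]].
  split; first exact: alg_points_generating.
  by case: aX => phi _ <- p p0; rewrite -theta_rep p0 rmorph0.
pose f x := geval (sval (cid (theta_surj x))) a.
have fE p : f (theta p) = geval p a.
  rewrite /f; case: (cid _) => q /= qE.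
  apply/eqP; rewrite -subr_eq0 -gevalB; apply/eqP; apply: rel.
  by rewrite thetaB qE subrr.
have f_lin : linear f.
  move=> c x y; have [p <-] := theta_surj x; have [q <-] := theta_surj y.
  by rewrite -theta_lin !fE gevalD gevalZ.
have f_mon : monoid_morphism f.
  split; first by rewrite -theta1 fE geval1.
  move=> x y; have [p <-] := theta_surj x; have [q <-] := theta_surj y.
  by rewrite -thetaM !fE gevalM.
exists (lrmorphism_of_fun f_lin f_mon).
  move=> B; have [p <-] := generating_surj gen B.
  by exists (theta p); apply: fE.
by apply/ffunP => h; rewrite ffunE -theta_gen -[LHS]/(f _) fE geval_generic.
Qed.

Lemma alg_points_PGL : PGL_stable alg_points.
Proof.
move=> g a gu /alg_pointsE[gen rel]; apply/alg_pointsE.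
have conjE p : geval p (conj_point g a) = g * geval p a * g^-1.
  elim/subalgebra_ind: p => [|c p q IHp IHq|p q IHp IHq|h].
  - by rewrite !geval1 mulr1 mulrV.
  - by rewrite !gevalD !gevalZ IHp IHq mulrDr mulrDl -scalerAr -scalerAl.
  - by rewrite !gevalM IHp IHq !mulrA mulrVK.
  - by rewrite !geval_generic ffunE.
split=> [|p p0]; last by rewrite conjE rel // mulr0 mul0r.
apply: surj_generating => B; have [p pE] := generating_surj gen (g^-1 * B * g).
by exists p; rewrite conjE pE !mulrA mulrV // mul1r mulrK.
Qed.

Lemma alg_points_nvariety : is_nvariety alg_points.
Proof.
split; [exact: alg_points_generating | exact: alg_points_PGL |].
exists (fun a => forall p, theta p = 0 -> geval p a = 0); last exact: alg_pointsE.
exists (fun q => exists p i j, theta p = 0 /\ q = (subalg_val p : 'M_n.+1) i j) => a.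
split=> [rel _ [p [i [j [p0 ->]]]]|rel p p0].
  by have /matrixP/(_ i j) := rel p p0; rewrite !mxE.
apply/matrixP => i j; rewrite mxE [RHS]mxE; apply: rel.
by exists p, i, j.
Qed.

(** Two closed sets covering the variety give two stable closed sets covering
    it, because orbits are irreducible.  If neither contained the variety,
    the elements of [R] separating them from a point would contradict
    primeness. *)
Lemma alg_points_irreducible : irreducible alg_points.
Proof.
split.
  have [phi phi_surj _] := PI_representation RP (oner_neq0 R).
  by exists (rep_point phi); exists phi.
move=> Z1 Z2 [P1 Z1E] [P2 Z2E] cover; apply: contrapT => /not_orP[n1 n2].
have escape (Z : pt -> Prop) P : (forall a, Z a <-> forall p, P p -> p.@[coords a] = 0) ->
    ~ (forall a, alg_points a -> Z a) ->
    exists p, exists2 a, alg_points a & (forall b, Z b -> p.@[coords b] = 0) /\ p.@[coords a] != 0.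
  move=> ZE nZ; apply: contrapT => ne; apply: nZ => a aX; apply/ZE => p Pp.
  apply/eqP/negP => /negP pa; apply: ne; exists p, a => //; split=> //.
  by move=> b /ZE; apply.
have [p1 [a1 a1X [p1Z p1a]]] := escape _ _ Z1E n1.
have [p2 [a2 a2X [p2Z p2a]]] := escape _ _ Z2E n2.
pose X p (x : pt) := alg_points x /\
  forall g, g \is a GRing.unit -> p.@[coords (conj_point g x)] = 0.
have conj1 x : conj_point 1 x = x :> pt.
  by apply/ffunP => h; rewrite ffunE mul1r invr1 mulr1.
have separate p a : alg_points a -> p.@[coords a] != 0 ->
    exists2 f : G, forall x, X p x -> geval f x = 0 & geval f a != 0.
  move=> aX pa; have gen := alg_points_generating aX.
  have [g gE] := choice (fun ij : 'I_n.+1 * 'I_n.+1 =>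
    generating_surj gen (delta_mx ij.1 ij.2)).
  apply: (separate_at (g := fun i j => g (i, j)) _ _ _ pa).
  - by move=> i j; apply: (gE (i, j)).
  - move=> g0 x g0u [xX px]; split; first exact: alg_points_PGL.
    move=> g' g'u; have -> : conj_point g' (conj_point g0 x) = conj_point (g' * g0) x.
      by apply/ffunP => h; rewrite !ffunE invrM // !mulrA.
    by apply: px; rewrite unitrMr.
  - by move=> x [_ /(_ 1 (unitr1 _))]; rewrite conj1.
have [f1 f1X f1a] := separate p1 a1 a1X p1a.
have [f2 f2X f2a] := separate p2 a2 a2X p2a.
have coverX x : alg_points x -> X p1 x \/ X p2 x.
  move=> xX; apply: contrapT => /not_orP[nX1 nX2].
  have nX p : ~ X p x -> exists2 g, g \is a GRing.unit & p.@[coords (conj_point g x)] != 0.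
    move=> nXp; apply: contrapT => ne; apply: nXp; split=> // g gu.
    by apply/eqP/negP => /negP pg; apply: ne; exists g.
  have [g1 g1u h1] := nX _ nX1; have [g2 g2u h2] := nX _ nX2.
  have [g [gu q1 q2]] := orbit_irreducible g1u g2u h1 h2.
  case: (cover _ (alg_points_PGL gu xX)) => [/p1Z|/p2Z] e; first by rewrite e eqxx in q1.
  by rewrite e eqxx in q2.
have thetaX f a : alg_points a -> geval f a != 0 -> theta f <> 0.
  by move=> [phi _ <-] fa f0; move: fa; rewrite -theta_rep f0 rmorph0 eqxx.
case: RP => _ prime _ _.
have [|/(thetaX _ _ a1X f1a)//|/(thetaX _ _ a2X f2a)//] := prime (theta f1) (theta f2).
move=> r; apply: reps_faithful => phi phi_surj.
rewrite !rmorphM /= !theta_rep.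
have phiX : alg_points (rep_point phi) by exists phi.
by case: (coverX _ phiX) => [/f1X->|/f2X->]; rewrite ?mulr0 ?mul0r.
Qed.

Definition alg_variety : irr_nvariety k n :=
  IrrNVariety alg_points_nvariety alg_points_irreducible.

Lemma theta_eq0 p : theta p = 0 <-> p \in vanishing_ideal (X := alg_variety).
Proof.
split=> [p0|/vanishingP p0].
  by apply/vanishingP => a /alg_pointsE[_]; apply.
apply: reps_faithful => phi phi_surj; rewrite theta_rep p0 //.
by exists phi.
Qed.

Lemma qclass_theta p q :
  theta p = theta q <-> qclass (vanishing_ideal (X := alg_variety)) p = qclass _ q.
Proof.
rewrite qclassP -theta_eq0 thetaB; split=> [->|/eqP]; first by rewrite subrr.
by rewrite subr_eq0 => /eqP.
Qed.

(** Both rings are quotients of the generic matrix ring, with the same kernel by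
    [theta_eq0]. *)
Lemma coord_ring_alg_variety :
  exists (alpha : {lrmorphism PI_coordinate_ring alg_variety -> R})
    (beta : {lrmorphism R -> PI_coordinate_ring alg_variety}),
    cancel alpha beta /\ cancel beta alpha.
Proof.
pose A := PI_coordinate_ring alg_variety.
pose cls : G -> A := qclass (vanishing_ideal (X := alg_variety)).
pose f (x : A) : R := theta (qrepr x).
have fE p : f (cls p) = theta p by apply/qclass_theta; rewrite qreprK.
pose h (x : R) : A := cls (sval (cid (theta_surj x))).
have hE p : h (theta p) = cls p.
  by apply/qclass_theta; rewrite (svalP (cid (theta_surj (theta p)))).
have f_lin : linear f.
  move=> c x y; rewrite -[x]qreprK -[y]qreprK -!/(cls _) -qclass_lin -/(cls _) !fE.
  exact: theta_lin.
have f_mon : monoid_morphism f.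
  split; first by rewrite -[1]/(cls 1) fE theta1.
  move=> x y; rewrite -[x]qreprK -[y]qreprK -!/(cls _) -qclassM -/(cls _) !fE.
  exact: thetaM.
have h_lin : linear h.
  move=> c x y; have [p <-] := theta_surj x; have [q <-] := theta_surj y.
  by rewrite -theta_lin !hE /cls qclass_lin.
have h_mon : monoid_morphism h.
  split; first by rewrite -theta1 hE.
  move=> x y; have [p <-] := theta_surj x; have [q <-] := theta_surj y.
  by rewrite -thetaM !hE /cls qclassM.
exists (lrmorphism_of_fun f_lin f_mon), (lrmorphism_of_fun h_lin h_mon); split.
  by move=> x; rewrite -[LHS]/(h (f x)) -[x]qreprK -/(cls _) fE hE.
by move=> x; rewrite -[LHS]/(f (h x)); have [p <-] := theta_surj x; rewrite hE fE.
Qed.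

End VarietyOfAlgebra.

(** * Equivalences of categories *)

Lemma fully_faithful_equivalence (C D : category) (F : functor C D) :
  (forall X Y (f g : hom X Y), fmap F f = fmap F g -> f = g) ->
  (forall X Y (h : hom (F X) (F Y)), exists f, fmap F f = h) ->
  (forall R : D, exists X (e : hom (F X) R), is_iso e) ->
  is_equivalence F.
Proof.
move=> faith full ess.
pose G0 R : C := sval (cid (ess R)).
have essR R : exists e : hom (F (G0 R)) R, is_iso e by apply: (svalP (cid (ess R))).
pose e R : hom (F (G0 R)) R := sval (cid (essR R)).
have eP R : is_iso (e R) by apply: (svalP (cid (essR R))).
pose e' R : hom R (F (G0 R)) := sval (cid (eP R)).
have e'e R : comp (e' R) (e R) = idc _ by case: (svalP (cid (eP R))).
have ee' R : comp (e R) (e' R) = idc _ by case: (svalP (cid (eP R))).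
pose G1 R S (h : hom R S) : hom (G0 R) (G0 S) :=
  sval (cid (full _ _ (comp (e' S) (comp h (e R))))).
have FG1 R S (h : hom R S) : fmap F (G1 R S h) = comp (e' S) (comp h (e R)).
  exact: (svalP (cid (full _ _ (comp (e' S) (comp h (e R)))))).
have G1_id R : G1 R R (idc R) = idc (G0 R).
  by apply: faith; rewrite FG1 comp_idl e'e fmap_id.
have G1_comp R S T (h : hom S T) (h' : hom R S) :
    G1 R T (comp h h') = comp (G1 S T h) (G1 R S h').
  apply: faith; rewrite fmap_comp !FG1 -!comp_assoc; congr (comp _ (comp _ _)).
  by rewrite comp_assoc ee' comp_idl.
exists (Functor G1_id G1_comp); split.
- pose eta X : hom (G0 (F X)) X := sval (cid (full _ _ (e (F X)))).
  have etaE X : fmap F (eta X) = e (F X) by apply: (svalP (cid (full _ _ (e (F X))))).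
  exists eta; split=> [X Y f|X].
    by apply: faith; rewrite !fmap_comp /= FG1 !etaE comp_assoc ee' comp_idl.
  have [g gE] := full _ _ (e' (F X)); exists g.
  by split; apply: faith; rewrite fmap_comp gE etaE fmap_id ?e'e ?ee'.
- exists e; split=> [R S h|R]; last exact: eP.
  by rewrite /= FG1 comp_assoc ee' comp_idl.
Qed.

Section Equivalence.
Variables (k : closedFieldType) (n : nat).
Hypothesis objP : forall X : irr_nvariety k n, PIn_object n (PI_coordinate_ring X).

Lemma nv_point_inj (X : irr_nvariety k n) (u v : nv_point X) : sval u = sval v -> u = v.
Proof. by case: u v => [u p] [v q] /= e; apply: eq_exist. Qed.

(** The evaluation at a point of [X] composed with [alpha] is still surjective,
    hence it is the evaluation at a point of [Y]: this is the image of the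
    point. *)
Lemma pullback_full (X Y : irr_nvariety k n)
    (alpha : {lrmorphism PI_coordinate_ring Y -> PI_coordinate_ring X}) :
  PIn_morphism n alpha -> exists f : regular_map X Y, forall g, pullback f g = alpha g.
Proof.
move=> alphaP.
have image x : exists y : nv_point Y, forall g, ev (alpha g) x = ev g y.
  by apply: (point_of_hom (phi := ev_mor x \o alpha)); apply: alphaP; apply: ev_surj.
pose f x := sval (cid (image x)).
have fE x g : ev (alpha g) x = ev g (f x) by apply: (svalP (cid (image x))).
have f_reg : is_regular_map f.
  by exists (fun i => alpha (coord_fun i)) => x i; rewrite fE ev_coord_fun.
exists (exist _ f f_reg) => g; apply: ev_inj => x.
by rewrite pullbackE fE.
Qed.

Lemma coordinate_equivalence :
  is_equivalence (coordinate_functor objP (@pullback_morphism k n)).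
Proof.
apply: fully_faithful_equivalence => [X Y f g fg|X Y h|R].
- apply: regmap_eq; apply/funext => x.
  apply: nv_point_inj; apply/ffunP => i.
  rewrite -!ev_coord_fun -!pullbackE.
  have e : pullback f = pullback g := congr1 sval fg.
  have -> : pullback_fun f (coord_fun i) = pullback_fun g (coord_fun i) :=
    congr1 (fun h : {lrmorphism _ -> _} => h (coord_fun i)) e.
  by [].
- have [f fE] := pullback_full (svalP h).
  by exists f; apply: PIn_hom_eq => g; apply: fE.
- case: (pi_axiom R) => -[m [s s_gen]] _ _ _.
  have [alpha [beta [alphaK betaK]]] := coord_ring_alg_variety (pi_axiom R) s_gen.
  have alphaP : PIn_morphism n alpha.
    by move=> phi phi_surj B; have [r <-] := phi_surj B; exists (beta r); rewrite /= betaK.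
  have betaP : PIn_morphism n beta.
    by move=> phi phi_surj B; have [r <-] := phi_surj B; exists (alpha r); rewrite /= alphaK.
  exists (alg_variety (pi_axiom R) s_gen), (exist _ alpha alphaP), (exist _ beta betaP).
  by split; apply: PIn_hom_eq => x /=; [apply: alphaK | apply: betaK].
Qed.

End Equivalence.

(** * Coordinate rings *)

Section StandardPolynomial.
Import finmap monalg.
Variables (k : fieldType) (p : nat).

Definition standard_word (s : 'S_p) : {fmonom nat} :=
  FMonom [seq (s l : nat) | l <- index_enum 'I_p].

Definition standard_poly : {malg k[{fmonom nat}]} :=
  \sum_(s : 'S_p) << (-1) ^+ s *g standard_word s >>.

Lemma standard_poly_eval (R : algType k) (r : nat -> R) :
  nc_eval standard_poly r = altprod (fun=> 1) (fun=> 1) (fun l : 'I_p => r l).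
Proof.
pose h (w : {fmonom nat}) : R := \prod_(i <- (w : seq nat)) r i.
transitivity (mmap (in_alg R) h standard_poly).
  by apply: eq_bigr => w _; rewrite mulr_algl.
rewrite raddf_sum; apply: eq_bigr => s _; rewrite /= mmapU.
have -> : h (standard_word s) = \prod_(l < p) (1 * r (s l) * 1).
  rewrite /h /standard_word /= big_map; apply: eq_bigr => l _.
  by rewrite mul1r mulr1.
by rewrite mulr_algl scaler_sign mulr_sign.
Qed.

Lemma standard_poly_neq0 : standard_poly != 0.
Proof.
apply/eqP => /(congr1 (mcoeff (standard_word 1%g))).
rewrite mcoeff0 raddf_sum (bigD1 1%g) //= mcoeffUU odd_perm1 expr0.
rewrite big1 ?addr0 => [/eqP|s sn1]; first by rewrite oner_eq0.
rewrite mcoeffU; case: eqP => // -[] /eq_in_map es; case/eqP: sn1.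
apply/perm.permP => l; apply: val_inj; rewrite perm1.
by have := es l (mem_index_enum _); rewrite perm1.
Qed.

End StandardPolynomial.

Section CoordinateRing.
Variables (k : closedFieldType) (n : nat) (X : irr_nvariety k n).
Local Notation R := (PI_coordinate_ring X).
Local Notation N := n.+1.

Lemma coord_ring_fin_generated : fin_generated R.
Proof. by exists (nv_dim X), (@coord_fun k n X); exact: coord_ring_generates. Qed.

Lemma coord_ring_PI : PI_algebra R.
Proof.
exists (standard_poly k (mxcells n).+1); first exact: standard_poly_neq0.
move=> r; rewrite standard_poly_eval; apply: ev_inj => x.
by rewrite ev0 -[LHS]/(ev_mor x _) rmorph_altprod altprod_eq0.
Qed.

Lemma irreducible_domain (f g : {mpoly k[ncoord n (nv_dim X)]}) :
  (forall a, X a -> f.@[coords a] * g.@[coords a] = 0) ->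
  (forall a, X a -> f.@[coords a] = 0) \/ (forall a, X a -> g.@[coords a] = 0).
Proof.
move=> fg; have [_ irr] := nv_irr X.
have closed (h : {mpoly k[ncoord n (nv_dim X)]}) :
    zariski_closed (fun a : point k n (nv_dim X) => h.@[coords a] = 0).
  by exists (eq h) => a; split=> [e _ <- // | e]; apply: e.
apply: (irr _ _ (closed f) (closed g)) => a /fg /eqP.
by rewrite mulf_eq0 => /orP[] /eqP; [left | right].
Qed.

(** At each point the values form a full matrix algebra, which is prime; the
    points where a given element vanishes form a closed set. *)
Lemma coord_ring_prime : prime_ring R.
Proof.
move=> u v uv; have [_ irr] := nv_irr X.
have closed (w : R) : zariski_closed (fun a => geval (qrepr w) a = 0).
  exists (fun q => exists i j, q = (subalg_val (qrepr w) : 'M_N) i j) => a.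
  split=> [e _ [i [j ->]]|e]; first by have /matrixP/(_ i j) := e; rewrite !mxE.
  by apply/matrixP => i j; rewrite mxE [RHS]mxE; apply: e; exists i, j.
have mx_prime (A B : 'M[k]_N) : (forall C, A * C * B = 0) -> A = 0 \/ B = 0.
  move=> ACB; have [->|/matrix0Pn[i [j Aij]]] := eqVneq A 0; first by left.
  right; apply/matrixP => l q; rewrite [RHS]mxE; have /matrixP/(_ i q) := ACB (delta_mx j l).
  rewrite -!mulmxE [LHS]mxE [RHS]mxE (bigD1 l) //= big1 ?addr0 => [|h hl].
    rewrite mxE (bigD1 j) //= big1 ?addr0 => [|h hj]; last first.
      by rewrite mxE (negPf hj) mulr0.
    by rewrite mxE !eqxx mulr1 => /eqP; rewrite mulf_eq0 (negPf Aij) => /eqP.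
  rewrite mxE big1 ?mul0r // => h' _.
  by rewrite mxE (negPf hl) andbF mulr0.
have [a aX|u0|v0] := irr _ _ (closed u) (closed v).
- apply: mx_prime => C; have [c <-] := ev_surj (exist _ a aX) C.
  by rewrite -[geval _ _]/(ev u (exist _ a aX)) -[geval (qrepr v) a]/(ev v (exist _ a aX))
    -!evM uv ev0.
- by left; apply: ev_inj => x; rewrite ev0 /ev u0 //; apply: (svalP x).
- by right; apply: ev_inj => x; rewrite ev0 /ev v0 //; apply: (svalP x).
Qed.

End CoordinateRing.

(** * Rings of fractions of PI-degree n + 1 *)

Section UnitsByChoice.
Variable Q : nzRingType.

(** A ring with its invertible elements, decided classically. *)
Definition with_units : Type := Q.
HB.instance Definition _ := GRing.NzRing.on with_units.

Let invertible (x : with_units) : Prop := exists y, y * x = 1 /\ x * y = 1.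
Let unit_pred : {pred with_units} := fun x => `[< invertible x >].
Let inverse (x : with_units) : with_units :=
  if pselect (invertible x) is left e then sval (cid e) else x.

Let inverse_spec x : x \in unit_pred -> inverse x * x = 1 /\ x * inverse x = 1.
Proof.
by move=> /asboolP ux; rewrite /inverse; case: pselect => // e; case: (svalP (cid e)).
Qed.

Let unit_mulVr : {in unit_pred, left_inverse 1 inverse *%R}.
Proof. by move=> x /inverse_spec[]. Qed.
Let unit_divrr : {in unit_pred, right_inverse 1 inverse *%R}.
Proof. by move=> x /inverse_spec[]. Qed.
Let unit_P (x y : with_units) : y * x = 1 /\ x * y = 1 -> x \in unit_pred.
Proof. by move=> xy; apply/asboolP; exists y. Qed.
Let unit_out : {in [predC unit_pred], inverse =1 id}.
Proof.
move=> x; rewrite inE => /negP ux; rewrite /inverse; case: pselect => // e.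
by case: ux; apply/asboolP.
Qed.
HB.instance Definition _ := GRing.NzRing_hasMulInverse.Build with_units
  unit_mulVr unit_divrr unit_P unit_out.

Lemma with_units_unit (x y : with_units) : y * x = 1 -> x * y = 1 -> x \is a GRing.unit.
Proof. by move=> yx xy; apply/unitrP; exists y. Qed.

End UnitsByChoice.

Section Subfield.
Variables (K : fieldType) (S : {pred K}).
Hypothesis S_div : divring_closed S.

(** As for the ideals above, the proof is an argument. *)
Definition subfield_pred of divring_closed S : {pred K} := S.
HB.instance Definition _ := GRing.isDivringClosed.Build K (subfield_pred S_div) S_div.

Record subfield := Subfield { subfield_val :> K; _ : subfield_val \in subfield_pred S_div }.
HB.instance Definition _ := [isSub for subfield_val].
HB.instance Definition _ := [Choice of subfield by <:].
HB.instance Definition _ := [SubChoice_isSubUnitRing of subfield by <:].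
HB.instance Definition _ := [SubNzRing_isSubComNzRing of subfield by <:].
HB.instance Definition _ := [SubComUnitRing_isSubIntegralDomain of subfield by <:].
HB.instance Definition _ := [SubIntegralDomain_isSubField of subfield by <:].

Definition to_subfield (x : K) : subfield := insubd 0 x.

Lemma to_subfieldK x : x \in S -> val (to_subfield x) = x.
Proof. by move=> xS; rewrite /to_subfield insubdK. Qed.

End Subfield.

(** Let [R] be a ring of matrices over a field [K], some [d] elements of which
    form a basis over [K].  It has PI-degree [n + 1] as soon as the coordinates
    of its elements in that basis lie in a subfield [F] of [K] whose elements
    have denominators in [R]. *)
Section Fractions.
Variables (n : nat) (R : nzRingType) (K : fieldType).
Local Notation N := n.+1.
Local Notation d := (mxcells n).
Variables (J : {rmorphism R -> 'M[K]_N}) (F : {pred K}) (g : 'I_d -> R).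
Hypotheses (J_inj : injective J) (F_div : divring_closed F).
Let G (q : 'I_d) : 'M[K]_N := J (g q).
Let Y : 'M[K]_d := entry_mx G.
Hypothesis Y_unit : \det Y != 0.

Definition gcoord (A : 'M[K]_N) : 'rV[K]_d := entry_row A *m invmx Y.

Hypothesis R_coord : forall r q, gcoord (J r) 0 q \in F.
Hypothesis F_denominator : forall c : 'I_d -> K, (forall q, c q \in F) ->
  exists2 s, \det (J s) != 0 & forall q, exists r, J r = c q *: J s.

Let Yu : Y \in unitmx. Proof. by rewrite unitmxE unitfE. Qed.

Let entry_row_lin a A B : entry_row (a *: A + B : 'M[K]_N) = a *: entry_row A + entry_row B.
Proof. by apply/rowP => q; rewrite !mxE. Qed.

Let entry_row_inj : injective (@entry_row n K).
Proof.
move=> A B e; apply/matrixP => i j; have /rowP/(_ (cell i j)) := e.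
by rewrite !mxE cell_rowK cell_colK.
Qed.

Definition gcomb (c : 'rV[K]_d) : 'M[K]_N := \sum_q c 0 q *: G q.

Let entry_row_gcomb c : entry_row (gcomb c) = c *m Y.
Proof.
apply/rowP => q; rewrite !mxE summxE; apply: eq_bigr => l _.
by rewrite !mxE.
Qed.

Lemma gcombK : cancel gcomb gcoord.
Proof. by move=> c; rewrite /gcoord entry_row_gcomb mulmxK. Qed.

Lemma gcoordK : cancel gcoord gcomb.
Proof. by move=> A; apply: entry_row_inj; rewrite entry_row_gcomb mulmxKV. Qed.

Lemma gcoord_lin a A B : gcoord (a *: A + B) = a *: gcoord A + gcoord B.
Proof. by rewrite /gcoord entry_row_lin mulmxDl scalemxAl. Qed.

Lemma gcoord0 : gcoord 0 = 0.
Proof.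
by rewrite -[0](scale0r (0 : 'M[K]_N)) -[_ *: _]addr0 gcoord_lin scale0r add0r
  /gcoord (_ : entry_row 0 = 0) ?mul0mx //; apply/rowP => q; rewrite !mxE.
Qed.

Lemma gcoordZ a A : gcoord (a *: A) = a *: gcoord A.
Proof. by rewrite -[a *: A]addr0 gcoord_lin gcoord0 addr0. Qed.

Lemma gcoordD A B : gcoord (A + B) = gcoord A + gcoord B.
Proof. by rewrite -[A in LHS]scale1r gcoord_lin scale1r. Qed.

Lemma gcoord_sum I (r : seq I) (A : I -> 'M[K]_N) :
  gcoord (\sum_(i <- r) A i) = \sum_(i <- r) gcoord (A i).
Proof. exact: (big_morph gcoord gcoordD gcoord0). Qed.

Let F1 : 1 \in F. Proof. by case: F_div. Qed.
Let FB x y : x \in F -> y \in F -> x - y \in F.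
Proof. by case: F_div => _ h _; apply: h. Qed.
Let FV x y : x \in F -> y \in F -> x / y \in F.
Proof. by case: F_div => _ _ h; apply: h. Qed.
Let F0 : 0 \in F. Proof. by rewrite -(subrr 1) FB. Qed.
Let FD x y : x \in F -> y \in F -> x + y \in F.
Proof. by move=> xF yF; rewrite -[y]opprK FB // -sub0r FB. Qed.
Let FM x y : x \in F -> y \in F -> x * y \in F.
Proof. by move=> xF yF; rewrite -[y]invrK FV // -[y^-1]mul1r FV. Qed.
Let F_sum I (r : seq I) (c : I -> K) : (forall i, c i \in F) -> \sum_(i <- r) c i \in F.
Proof. by move=> cF; elim/big_ind: _ => //; apply: FD. Qed.

(** The [F]-span of [R], which will be its ring of fractions. *)
Definition frac_pred : {pred 'M[K]_N} := fun A => `[< forall q, gcoord A 0 q \in F >].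

Lemma frac_predP A : reflect (forall q, gcoord A 0 q \in F) (A \in frac_pred).
Proof. exact: asboolP. Qed.

Lemma frac_gcomb (c : 'rV[K]_d) : (forall q, c 0 q \in F) -> gcomb c \in frac_pred.
Proof. by move=> cF; apply/frac_predP => q; rewrite gcombK. Qed.

Lemma frac_J r : J r \in frac_pred.
Proof. by apply/frac_predP. Qed.

Lemma frac_subring : subring_closed frac_pred.
Proof.
split.
- by rewrite -(rmorph1 J) frac_J.
- move=> A B /frac_predP AF /frac_predP BF; apply/frac_predP => q.
  by rewrite addrC -scaleN1r gcoord_lin mxE [X in X + _]mxE mulN1r addrC FB.
- move=> A B /frac_predP AF /frac_predP BF; apply/frac_predP => q.
  rewrite -[A]gcoordK -[B]gcoordK mulr_suml gcoord_sum summxE; apply: F_sum => i.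
  rewrite mulr_sumr gcoord_sum summxE; apply: F_sum => l.
  rewrite -scalerAl -scalerAr !gcoordZ mxE [X in _ * X]mxE.
  by rewrite FM // FM // -rmorphM.
Qed.
HB.instance Definition _ := GRing.isSubringClosed.Build 'M[K]_N frac_pred frac_subring.

Record frac_elt := FracElt { frac_val :> 'M[K]_N; _ : frac_val \in frac_pred }.
HB.instance Definition _ := [isSub for frac_val].
HB.instance Definition _ := [Choice of frac_elt by <:].
HB.instance Definition _ := [SubChoice_isSubNzRing of frac_elt by <:].

Definition frac_ring : unitRingType := with_units frac_elt.
Local Notation fval := (fun q : frac_ring => frac_val (q : frac_elt)).

Definition frac_of A (AF : A \in frac_pred) : frac_ring := FracElt AF.

Let fvalB (x y : frac_ring) : fval (x - y) = fval x - fval y. Proof. by []. Qed.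
Let fvalD (x y : frac_ring) : fval (x + y) = fval x + fval y. Proof. by []. Qed.
Let fvalM (x y : frac_ring) : fval (x * y) = fval x * fval y. Proof. by []. Qed.
Let fval1 : fval 1 = 1. Proof. by []. Qed.
Let fval0 : fval 0 = 0. Proof. by []. Qed.
Let fval_inj (x y : frac_ring) : fval x = fval y -> x = y.
Proof. exact: (@val_inj _ _ frac_elt). Qed.
Let fvalP (x : frac_ring) : fval x \in frac_pred.
Proof. by case: x. Qed.
Let fval_sum I (r : seq I) (x : I -> frac_ring) :
  fval (\sum_(i <- r) x i) = \sum_(i <- r) fval (x i).
Proof. exact: (big_morph fval fvalD fval0). Qed.

Let j_fun (r : R) : frac_ring := frac_of (frac_J r).
Let j_zmod : zmod_morphism j_fun.
Proof. by move=> x y; apply: fval_inj; rewrite fvalB /= rmorphB. Qed.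
Let j_mon : monoid_morphism j_fun.
Proof.
split; first by apply: fval_inj; rewrite fval1 /= rmorph1.
by move=> x y; apply: fval_inj; rewrite fvalM /= rmorphM.
Qed.

Definition frac_inj : {rmorphism R -> frac_ring} := rmorphism_of_fun j_zmod j_mon.

Local Notation Fk := (subfield F_div).
Local Notation toF := (to_subfield F_div).

Let toFK x : x \in F -> val (toF x) = x.
Proof. exact: to_subfieldK. Qed.

Let valF (z : Fk) : val z \in F. Proof. by case: z. Qed.

Let map_toF m p (A : 'M[K]_(m, p)) : (forall i l, A i l \in F) ->
  map_mx val (map_mx toF A) = A.
Proof. by move=> AF; apply/matrixP => i l; rewrite !mxE toFK. Qed.

Lemma frac_scalar f : f \in F -> f%:M \in frac_pred.
Proof.
move=> fF; apply/frac_predP => q; rewrite -[f%:M]mulr1 -[f%:M * _]/(f%:M *m _).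
rewrite mul_scalar_mx gcoordZ mxE FM // -(rmorph1 J).
exact: R_coord.
Qed.

(** A common denominator of the coordinates is a denominator on both sides. *)
Lemma common_frac (A : frac_ring) : exists s, \det (J s) != 0 /\
  (exists a, fval A * J s = J a) /\ (exists a, J s * fval A = J a).
Proof.
have /frac_predP AF := fvalP A.
have [s s0 sP] := F_denominator AF.
have [r rE] := choice sP.
exists s; split=> //; split.
  exists (\sum_q g q * r q); rewrite rmorph_sum -[fval A]gcoordK mulr_suml.
  by apply: eq_bigr => q _; rewrite rmorphM /= rE -scalerAl -scalerAr.
exists (\sum_q r q * g q); rewrite rmorph_sum -[fval A]gcoordK mulr_sumr.
by apply: eq_bigr => q _; rewrite rmorphM /= rE -scalerAl -scalerAr.
Qed.

Lemma J_unit s : \det (J s) != 0 -> J s \is a GRing.unit.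
Proof. by move=> s0; rewrite -[_ \is a _]/(J s \in unitmx) unitmxE unitfE. Qed.

(** A regular element is invertible in the span: multiplication by it has a
    matrix with entries in [F], and a vector of its kernel with entries in [F]
    would give a zero divisor in [R]. *)
Lemma regular_frac_unit s : regular_elt s -> frac_inj s \is a GRing.unit.
Proof.
move=> [s_reg _].
pose L : 'M[K]_d := \matrix_q gcoord (J s * G q).
have LF q l : L q l \in F by rewrite mxE -rmorphM; apply: R_coord.
pose Lf : 'M[Fk]_d := map_mx toF L.
have LE : map_mx val Lf = L by apply: map_toF.
have sE (c : 'rV[K]_d) : gcoord (J s * gcomb c) = c *m L.
  rewrite mulr_sumr gcoord_sum mulmx_sum_row; apply: eq_bigr => q _.
  by rewrite -scalerAr gcoordZ rowK.
have [detL|detL] := eqVneq (\det Lf) 0.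
  have /det0P[v v0 vL] : \det Lf == 0 by rewrite detL.
  pose c := map_mx val v : 'rV[K]_d.
  have cF q : c 0 q \in F by rewrite mxE; apply: valF.
  pose A : frac_ring := frac_of (frac_gcomb cF).
  have sA : J s * gcomb c = 0.
    by rewrite -[LHS]gcoordK sE -LE -map_mxM vL map_mx0 /gcomb big1 // => q _;
      rewrite mxE scale0r.
  have [t [t0 [[a aE] _]]] := common_frac A.
  have a0 : a = 0.
    apply: s_reg; apply: J_inj; rewrite mulr0 rmorph0 rmorphM /= -aE mulrA.
    by rewrite [J s * _]sA mul0r.
  have : gcomb c = 0.
    apply: (mulIr (J_unit t0)); rewrite mul0r -[LHS]/(fval A * J t) aE a0.
    by rewrite rmorph0.
  move=> /(congr1 gcoord); rewrite gcombK gcoord0 => c0; case/eqP: v0.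
  by apply/rowP => q; have /rowP/(_ q) := c0; rewrite !mxE => vq; apply: val_inj.
have Lu : Lf \in unitmx by rewrite unitmxE unitfE.
have oneF q : gcoord 1 0 q \in F by rewrite -(rmorph1 J); apply: R_coord.
pose c : 'rV[K]_d := map_mx val (map_mx toF (gcoord 1) *m invmx Lf).
have cF q : c 0 q \in F by rewrite mxE; apply: valF.
have sA : J s * gcomb c = 1.
  rewrite -[LHS]gcoordK sE -LE -map_mxM mulmxKV // map_toF ?gcoordK // => i q.
  by rewrite (ord1 i).
apply: (with_units_unit (y := frac_of (frac_gcomb cF))).
  by apply: fval_inj; apply: mulmx1C.
exact: fval_inj.
Qed.

Lemma frac_total_ring : total_ring_of_fractions frac_inj.
Proof.
have reg s : \det (J s) != 0 -> regular_elt s.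
  move=> /J_unit us; split=> x y /(congr1 J).
    by rewrite !rmorphM => /(mulrI us) /J_inj.
  by rewrite !rmorphM => /(mulIr us) /J_inj.
split.
- by move=> x y /(congr1 (fun q : frac_ring => fval q)) /J_inj.
- exact: regular_frac_unit.
- move=> A; have [s [s0 [[a aE] _]]] := common_frac A.
  exists a, s; split; first exact: reg.
  have us := regular_frac_unit (reg s s0).
  by rewrite (_ : frac_inj a = A * frac_inj s) ?mulrK //; apply: fval_inj.
- move=> A; have [s [s0 [_ [a aE]]]] := common_frac A.
  exists a, s; split; first exact: reg.
  have us := regular_frac_unit (reg s s0).
  by rewrite (_ : frac_inj a = frac_inj s * A) ?mulKr //; apply: fval_inj.
Qed.

(** Over [K], the two-sided ideal generated by a nonzero matrix contains [1];
    since the span is defined over [F], so does the ideal it generates there. *)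
Lemma frac_simple : simple_ring frac_ring.
Proof.
move=> I A AI; apply/eqP/negP => /negP A0.
have [i [l Ail]] : exists i l, fval A i l != 0.
  by apply/matrix0Pn; apply: contraNneq A0 => e; apply/eqP/fval_inj.
pose z (t : 'I_#|{: 'I_d * 'I_d}|) : frac_ring :=
  frac_inj (g (enum_val t).1) * A * frac_inj (g (enum_val t).2).
have zI t : z t \in I by rewrite absorb_mulr // idealMr.
pose Z : 'M[K]_(_, d) := \matrix_t gcoord (fval (z t)).
have ZF t q : Z t q \in F by rewrite mxE; have /frac_predP := fvalP (z t).
have oneF q : gcoord 1 0 q \in F by rewrite -(rmorph1 J); apply: R_coord.
have sandwich (B C : 'M[K]_N) : (gcoord (B * fval A * C) <= Z)%MS.
  have -> : gcoord (B * fval A * C) = \sum_p \sum_q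
      (gcoord B 0 p * gcoord C 0 q) *: row (enum_rank (p, q)) Z.
    rewrite -{1}[B]gcoordK -{1}[C]gcoordK !mulr_suml gcoord_sum; apply: eq_bigr => p _.
    rewrite mulr_sumr gcoord_sum; apply: eq_bigr => q _.
    by rewrite rowK -!scalerAl -scalerAr !gcoordZ scalerA /z enum_rankK.
  by apply: summx_sub => p _; apply: summx_sub => q _; rewrite scalemx_sub ?row_sub.
have oneZ : (gcoord 1 <= Z)%MS.
  have -> : gcoord 1 = (fval A i l)^-1 *:
      \sum_h gcoord (delta_mx h i * fval A * delta_mx l h).
    rewrite -gcoord_sum -gcoordZ; congr gcoord; apply/matrixP => p q.
    have entry h : (delta_mx h i * fval A * delta_mx l h : 'M[K]_N) p q =
        (p == h)%:R * fval A i l * (q == h)%:R.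
      rewrite -!mulmxE mxE (bigD1 l) //= big1 ?addr0 => [|l' l'l]; last first.
        by rewrite [delta_mx l h _ _]mxE (negPf l'l) mulr0.
      rewrite [delta_mx l h _ _]mxE eqxx; congr (_ * _).
      rewrite mxE (bigD1 i) //= big1 ?addr0 => [|i' i'i]; last first.
        by rewrite mxE (negPf i'i) andbF mul0r.
      by rewrite mxE eqxx andbT.
    rewrite mxE [RHS]mxE summxE (bigD1 p) //= big1 => [|h hp]; last first.
      by rewrite entry eq_sym (negPf hp) !mul0r.
    by rewrite entry eqxx mul1r addr0 mulrA mulVf // mul1r eq_sym.
  by rewrite scalemx_sub // summx_sub // => h _; apply: sandwich.
have := oneZ; rewrite -(map_toF ZF) -[gcoord 1](map_toF (A := gcoord 1)); last first.
  by move=> p q; rewrite (ord1 p).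
rewrite map_submx => /submxP[u uE].
have uF t : val (u 0 t) \in F by apply: valF.
have : (1 : frac_ring) \in I.
  have -> : (1 : frac_ring) = \sum_t frac_of (frac_scalar (uF t)) * z t.
    apply: fval_inj; rewrite fval1 fval_sum -[1 in LHS]gcoordK.
    have -> : gcoord 1 = map_mx val u *m Z.
      rewrite -(map_toF ZF) -map_mxM -uE map_toF // => p q.
      by rewrite (ord1 p).
    rewrite mulmx_sum_row /gcomb.
    under eq_bigr do rewrite summxE scaler_suml.
    rewrite exchange_big; apply: eq_bigr => t _.
    rewrite fvalM /= -[_ * _]/(_ *m _) mul_scalar_mx -[X in _ = _ *: X]gcoordK /gcomb.
    rewrite scaler_sumr; apply: eq_bigr => q _.
    by rewrite scalerA !mxE.
  by apply: rpred_sum => t _; apply: idealMr; apply: zI.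
by rewrite idealr1.
Qed.

(** The basis [G] spans all the matrices over [K], so that a central element
    commutes with the matrix units. *)
Lemma frac_central_scalar (A : frac_ring) : central A <->
  exists2 f, f \in F & fval A = f%:M.
Proof.
split=> [AC|[f fF AE] B]; last first.
  by apply: fval_inj; rewrite !fvalM AE -!mulmxE mul_scalar_mx mul_mx_scalar.
have comm B : fval A * B = B * fval A.
  rewrite -[B]gcoordK mulr_sumr mulr_suml; apply: eq_bigr => q _.
  rewrite -scalerAl -scalerAr; congr (_ *: _).
  by have := AC (frac_inj (g q)); move/(congr1 (fun x : frac_ring => fval x)).
have AE : fval A = (fval A 0 0)%:M.
  have entry p q l m : (fval A * delta_mx l m) p q = fval A p l * (q == m)%:R.
    rewrite -mulmxE mxE (bigD1 l) //= big1 ?addr0 => [|h hl].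
      by rewrite mxE eqxx.
    by rewrite mxE (negPf hl) mulr0.
  have entry' p q l m : (delta_mx l m * fval A) p q = (p == l)%:R * fval A m q.
    rewrite -mulmxE mxE (bigD1 m) //= big1 ?addr0 => [|h hm].
      by rewrite mxE eqxx andbT.
    by rewrite mxE (negPf hm) andbF mul0r.
  apply/matrixP => p q; rewrite mxE.
  have /matrixP/(_ p 0) := comm (delta_mx q 0); rewrite entry entry' eqxx mulr1 => ->.
  by case: eqP; rewrite ?mul1r ?mul0r.
exists (fval A 0 0) => //.
have [q oneq] : exists q, gcoord 1 0 q != 0.
  apply/rV0Pn; apply/eqP => /(congr1 gcomb); rewrite gcoordK /gcomb big1.
    by move/eqP; rewrite oner_eq0.
  by move=> q _; rewrite mxE scale0r.
have oneF : gcoord 1 0 q \in F by rewrite -(rmorph1 J); apply: R_coord.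
rewrite -[fval A 0 0](mulfK oneq) FV //.
have /frac_predP/(_ q) := fvalP A.
by rewrite {1}AE -[_%:M]mulr1 -mulmxE mul_scalar_mx gcoordZ mxE.
Qed.

Lemma frac_dim : has_dim_over_center frac_ring d.
Proof.
exists (fun q => frac_inj (g q)); split.
  move=> A; have /frac_predP AF := fvalP A.
  exists (fun q => frac_of (frac_scalar (AF q))).
    by move=> q; apply/frac_central_scalar; exists (gcoord (fval A) 0 q).
  apply: fval_inj; rewrite fval_sum -[LHS]gcoordK; apply: eq_bigr => q _.
  by rewrite fvalM /= -[RHS]/(_ *m _) mul_scalar_mx.
move=> c cC c0.
have cE q : exists f, fval (c q) = f%:M.
  by have /frac_central_scalar[f _ ->] := cC q; exists f.
have [f fE] := choice cE.
have : gcomb (\row_q f q) = 0.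
  move/(congr1 (fun x : frac_ring => fval x)): c0; rewrite fval_sum => c0.
  rewrite -[RHS]c0; apply: eq_bigr => q _.
  by rewrite fvalM fE mxE -[RHS]/(_ *m _) mul_scalar_mx.
move=> /(congr1 gcoord); rewrite gcombK gcoord0 => /rowP f0 q.
apply: fval_inj; rewrite fE; have := f0 q; rewrite !mxE => ->.
by rewrite raddf0.
Qed.

Lemma PI_degree_of_matrices : has_PI_degree N R.
Proof.
exists frac_ring, frac_inj; split; first exact: frac_total_ring.
split; first exact: frac_simple.
by rewrite -(mxcellsE n); exact: frac_dim.
Qed.

End Fractions.

Section CommutativeUnits.
Variable Q : comNzRingType.
Lemma with_units_mulC : commutative (@GRing.mul (with_units Q)).
Proof. exact: (@mulrC Q). Qed.
HB.instance Definition _ := GRing.PzRing_hasCommutativeMul.Build (with_units Q) with_units_mulC.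
End CommutativeUnits.

Local Open Scope quotient_scope.

Section PolynomialFunctionDomain.
Variables (k : closedFieldType) (n : nat) (X : irr_nvariety k n).
Local Notation P := {mpoly k[ncoord n (nv_dim X)]}.

Definition fun_ideal : {pred P} := fun q => `[< forall a, X a -> q.@[coords a] = 0 >].

Lemma fun_idealP q : reflect (forall a, X a -> q.@[coords a] = 0) (q \in fun_ideal).
Proof. exact: asboolP. Qed.

Lemma fun_ideal_zmod : zmod_closed fun_ideal.
Proof.
split; first by apply/fun_idealP => a _; rewrite meval0.
move=> p q /fun_idealP pX /fun_idealP qX; apply/fun_idealP => a aX.
by rewrite mevalB pX // qX // subrr.
Qed.
HB.instance Definition _ := GRing.isZmodClosed.Build P fun_ideal fun_ideal_zmod.

Lemma fun_ideal_proper : 1 \notin fun_ideal /\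
  forall r, {in fun_ideal, forall p, r * p \in fun_ideal}.
Proof.
split.
  apply/negP => /fun_idealP e; case: (nv_irr X) => -[a /e].
  by rewrite meval1 => /eqP; rewrite oner_eq0.
move=> r p /fun_idealP pX; apply/fun_idealP => a aX.
by rewrite mevalM pX // mulr0.
Qed.
HB.instance Definition _ := isProperIdeal.Build P fun_ideal fun_ideal_proper.

Lemma fun_ideal_prime : prime_idealr_closed fun_ideal.
Proof.
move=> p q /fun_idealP pq; apply/orP.
have [pX|qX] : (forall a, X a -> p.@[coords a] = 0) \/ (forall a, X a -> q.@[coords a] = 0).
- by apply: irreducible_domain => a aX; rewrite -mevalM pq.
- by left; apply/fun_idealP.
- by right; apply/fun_idealP.
Qed.
HB.instance Definition _ := isPrimeIdealrClosed.Build P fun_ideal fun_ideal_prime.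

Definition poly_fun : Type := with_units {ideal_quot fun_ideal}.
HB.instance Definition _ := GRing.ComUnitRing.on poly_fun.

Lemma poly_fun_integral (x y : poly_fun) : x * y = 0 -> (x == 0) || (y == 0).
Proof. exact: (@Quotient.rquot_IdomainAxiom _ fun_ideal). Qed.
HB.instance Definition _ := GRing.ComUnitRing_isIntegral.Build poly_fun poly_fun_integral.

Definition fun_class (q : P) : poly_fun := \pi_{ideal_quot fun_ideal} q.

Definition fun_eval (x : nv_point X) (f : poly_fun) : k :=
  (repr (f : {ideal_quot fun_ideal})).@[coords (sval x)].

Lemma fun_eval_class x q : fun_eval x (fun_class q) = q.@[coords (sval x)].
Proof.
apply/eqP; rewrite -subr_eq0 -mevalB; apply/eqP.
suff /fun_idealP : repr (\pi_{ideal_quot fun_ideal} q) - q \in fun_ideal.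
  by apply; apply: (svalP x).
by rewrite Quotient.idealrBE reprK.
Qed.

Lemma fun_classK (f : poly_fun) : fun_class (repr (f : {ideal_quot fun_ideal})) = f.
Proof. exact: reprK. Qed.

Lemma fun_eval_inj (f g : poly_fun) : (forall x, fun_eval x f = fun_eval x g) -> f = g.
Proof.
move=> e; rewrite -[f]fun_classK -[g]fun_classK; apply/eqP.
rewrite /fun_class -[_ == _]/(_ == _ :> {ideal_quot fun_ideal}) -Quotient.idealrBE.
apply/fun_idealP => a aX; rewrite mevalB.
by apply/eqP; rewrite subr_eq0; apply/eqP/(e (exist _ a aX)).
Qed.

Lemma fun_class_morph : zmod_morphism fun_class /\ monoid_morphism fun_class.
Proof.
split; first by move=> p q; rewrite /fun_class Quotient.pi_add Quotient.pi_opp.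
split=> [|p q]; last by rewrite /fun_class Quotient.pi_mul.
by rewrite -[RHS]/(Quotient.one _) /Quotient.one -lock.
Qed.

End PolynomialFunctionDomain.

(** Cramer's rule for row vectors. *)
Lemma adj_row_det (A : comNzRingType) d (M : 'M[A]_d) (v : 'rV[A]_d) q :
  (v *m \adj M) 0 q = \det (\matrix_l (if l == q then v else row l M)).
Proof.
rewrite (expand_det_row _ q) mxE; apply: eq_bigr => l _.
rewrite [in RHS]mxE eqxx mxE; congr (_ * (_ * \det _)).
apply/matrixP => i j; rewrite !mxE.
by rewrite eq_sym (negPf (neq_lift q i)) mxE.
Qed.

Lemma frac_sub (F : fieldType) (a b c d : F) : b != 0 -> d != 0 ->
  a / b - c / d = (a * d - b * c) / (b * d).
Proof. by move=> b0 d0; field; rewrite b0 d0. Qed.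

Lemma frac_div (F : fieldType) (a b c d : F) : b != 0 -> c != 0 ->
  a / b / (c / d) = (a * d) / (b * c).
Proof. by move=> b0 c0; rewrite invf_div mulf_div. Qed.

Lemma det_exp_neq0 (F : fieldType) n (A : 'M[F]_n.+1) e :
  \det A != 0 -> \det (A ^+ e) != 0.
Proof.
move=> A0; elim: e => [|e IH]; first by rewrite expr0 det1 oner_neq0.
by rewrite exprS detM mulf_neq0.
Qed.

Section CoordinateRingDegree.
Variables (k : closedFieldType) (n : nat) (X : irr_nvariety k n).
Local Notation R := (PI_coordinate_ring X).
Local Notation N := n.+1.
Local Notation d := (mxcells n).
Local Notation D := (poly_fun X).
Local Notation K := {fraction D}.

Let fun_eval_zmod (x : nv_point X) : zmod_morphism (fun_eval x).
Proof.
have [B _] := fun_class_morph X.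
by move=> f g; rewrite -[f]fun_classK -[g]fun_classK -B !fun_eval_class mevalB.
Qed.
Let fun_eval_monoid (x : nv_point X) : monoid_morphism (fun_eval x).
Proof.
have [_ [one M]] := fun_class_morph X.
split; first by rewrite -one fun_eval_class meval1.
by move=> f g; rewrite -[f]fun_classK -[g]fun_classK -M !fun_eval_class mevalM.
Qed.
Let evalF (x : nv_point X) : {rmorphism D -> k} :=
  rmorphism_of_fun (fun_eval_zmod x) (fun_eval_monoid x).

Let evalF_inj (f g : D) : (forall x, evalF x f = evalF x g) -> f = g.
Proof. exact: fun_eval_inj. Qed.

Let mx_ext m p (A B : 'M[D]_(m, p)) :
  (forall x, map_mx (evalF x) A = map_mx (evalF x) B) -> A = B.
Proof.
move=> e; apply/matrixP => i j; apply: evalF_inj => x.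
by have /matrixP/(_ i j) := e x; rewrite !mxE.
Qed.

Definition fun_mx_of (r : R) : 'M[D]_N :=
  map_mx (@fun_class k n X) (subalg_val (qrepr r) : 'M_N).

Lemma fun_mx_eval r x : map_mx (evalF x) (fun_mx_of r) = ev r x.
Proof. by apply/matrixP => i j; rewrite !mxE; apply: fun_eval_class. Qed.

Let fun_mx_zmod : zmod_morphism fun_mx_of.
Proof.
move=> r s; apply: mx_ext => x.
by rewrite raddfB /= !fun_mx_eval -[ev _ x]/(ev_mor x _) rmorphB.
Qed.
Let fun_mx_monoid : monoid_morphism fun_mx_of.
Proof.
split; first by apply: mx_ext => x; rewrite fun_mx_eval map_mx1 ev1.
by move=> r s; apply: mx_ext => x; rewrite map_mxM !fun_mx_eval evM.
Qed.
Definition fun_mx : {rmorphism R -> 'M[D]_N} :=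
  rmorphism_of_fun fun_mx_zmod fun_mx_monoid.

Lemma fun_mxE r x : map_mx (evalF x) (fun_mx r) = ev r x.
Proof. exact: fun_mx_eval. Qed.

Definition frac_mx : {rmorphism R -> 'M[K]_N} := map_mx (@tofrac D) \o fun_mx.

Lemma frac_mx_inj : injective frac_mx.
Proof.
move=> r s /matrixP e; apply: ev_inj => x; rewrite -!fun_mxE; congr map_mx.
apply/matrixP => i j; apply/eqP; rewrite -tofrac_eq; apply/eqP.
by have := e i j; rewrite ![map_mx _ _ _ _]mxE.
Qed.

Variables (x0 : nv_point X) (g : 'I_N * 'I_N -> R).
Hypothesis gx0 : forall ij, ev (g ij) x0 = delta_mx ij.1 ij.2.

Let G (q : 'I_d) : R := g (cell_row q, cell_col q).

(** The Capelli coefficient is only the first matrix unit at [x0].  This sum is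
    [1] at [x0], hence generically invertible: its powers will be
    denominators. *)
Definition capelli_one : 'M[D]_N := \sum_i fun_mx (g (i, 0)) *
  altprod (fun l => fun_mx (g (0, cell_row l))) (fun l => fun_mx (g (cell_col l, 0)))
    (@unit_cell n D) * fun_mx (g (0, i)).
Local Notation C1 := capelli_one.

Lemma det_capelli_one : \det C1 != 0.
Proof.
suff e : map_mx (evalF x0) C1 = 1%:M.
  have := det_map_mx (evalF x0) C1; rewrite e det1.
  by apply: contra_eq_neq => ->; rewrite rmorph0 oner_neq0.
rewrite /C1 rmorph_sum /=.
have capE : map_mx (evalF x0) (altprod (fun l => fun_mx (g (0, cell_row l)))
    (fun l => fun_mx (g (cell_col l, 0))) (@unit_cell n D)) = delta_mx 0 0.
  rewrite -(altprod_unit_cells n k) [LHS]rmorph_altprod.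
  apply: eq_altprod => l /=.
  - by rewrite fun_mxE gx0 /unit_cell cell_rowK cell_colK.
  - by rewrite fun_mxE gx0 /unit_cell cell_rowK cell_colK.
  - by rewrite /unit_cell map_delta_mx.
rewrite [RHS](_ : _ = \sum_(i < N) (delta_mx i i : 'M[k]_N)); last first.
  apply/matrixP => i j; rewrite mxE summxE (bigD1 i) //= big1 => [|l li].
    by rewrite mxE eqxx addr0 eq_sym.
  by rewrite mxE eq_sym (negPf li).
apply: eq_bigr => i _.
rewrite !map_mxM capE !fun_mxE !gx0 /=.
by rewrite !mul_delta_mx.
Qed.

Lemma det_basis : \det (entry_mx (fun q => fun_mx (G q))) != 0.
Proof.
suff e : map_mx (evalF x0) (entry_mx (fun q => fun_mx (G q))) = 1%:M.
  have := det_map_mx (evalF x0) (entry_mx (fun q => fun_mx (G q))); rewrite e det1.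
  by apply: contra_eq_neq => ->; rewrite rmorph0 oner_neq0.
apply/matrixP => q l; rewrite 2!mxE.
have -> : evalF x0 (fun_mx (G q) (cell_row l) (cell_col l)) =
    map_mx (evalF x0) (fun_mx (G q)) (cell_row l) (cell_col l) by rewrite [RHS]mxE.
rewrite fun_mxE gx0 !mxE -[q in RHS]cellK /=.
by rewrite [in RHS]eq_sym cell_eq.
Qed.

(** The products of [e] determinants are such scalars, see [hrep_det] and
    [hrepM]. *)
Definition scalar_of_degree e (s : D) : Prop := exists u, fun_mx u = s *: C1 ^+ e.
Local Notation hrep := scalar_of_degree.

Lemma hrep1 : hrep 0 1.
Proof. by exists 1; rewrite rmorph1 scale1r expr0. Qed.

Lemma hrep0 : hrep 0 0.
Proof. by exists 0; rewrite rmorph0 scale0r. Qed.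

Lemma hrepB e s t : hrep e s -> hrep e t -> hrep e (s - t).
Proof. by move=> [u uE] [v vE]; exists (u - v); rewrite rmorphB scalerBl uE vE. Qed.

Lemma hrepM e f s t : hrep e s -> hrep f t -> hrep (e + f) (s * t).
Proof.
move=> [u uE] [v vE]; exists (u * v).
by rewrite rmorphM uE vE -scalerAl -scalerAr scalerA exprD.
Qed.

Lemma hrep_det (y : 'I_d -> R) : hrep 1 (\det (entry_mx (fun q => fun_mx (y q)))).
Proof.
exists (\sum_i g (i, 0) * altprod (fun l => g (0, cell_row l))
  (fun l => g (cell_col l, 0)) y * g (0, i)).
rewrite rmorph_sum expr1 /C1 scaler_sumr; apply: eq_bigr => i _.
rewrite !rmorphM rmorph_altprod.
rewrite (@altprod_det n D (fun_mx \o _) (fun_mx \o _) (fun_mx \o y)).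
by rewrite -scalerAr -scalerAl.
Qed.

(** The degrees must agree for the powers of [C1] to cancel in a quotient. *)
Definition invariant_frac : {pred K} := fun f =>
  `[< exists e s t, [/\ hrep e s, hrep e t, t != 0 & f = tofrac s / tofrac t] >].

Lemma tofrac_neq0 (t : D) : t != 0 -> tofrac t != 0.
Proof. by rewrite tofrac_eq0. Qed.

Lemma invariant_divring : divring_closed invariant_frac.
Proof.
split.
- apply/asboolP; exists 0%N, 1, 1; split; rewrite ?oner_neq0 //; try exact: hrep1.
  by rewrite tofrac1 divr1.
- move=> _ _ /asboolP[e [s [t [sE tE t0 ->]]]] /asboolP[e' [s' [t' [sE' tE' t0' ->]]]].
  apply/asboolP; exists (e + e')%N, (s * t' - t * s'), (t * t'); split.
  + by apply: hrepB; apply: hrepM.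
  + exact: hrepM.
  + by rewrite mulf_neq0.
  + rewrite tofracB !tofracM.
    exact: frac_sub (tofrac_neq0 t0) (tofrac_neq0 t0').
- move=> _ _ /asboolP[e [s [t [sE tE t0 ->]]]] /asboolP[e' [s' [t' [sE' tE' t0' ->]]]].
  apply/asboolP; have [->|s0'] := eqVneq s' 0.
    exists 0%N, 0, 1; split; rewrite ?oner_neq0 //; [exact: hrep0 | exact: hrep1 |].
    by rewrite tofrac0 !mul0r invr0 mulr0.
  exists (e + e')%N, (s * t'), (t * s'); split; try exact: hrepM.
    by rewrite mulf_neq0.
  rewrite !tofracM.
  exact: frac_div (tofrac_neq0 t0) (tofrac_neq0 s0').
Qed.

Lemma invariant_common (c : 'I_d -> K) : (forall q, c q \in invariant_frac) ->
  exists e t, [/\ hrep e t, t != 0 & forall q, exists2 s, hrep e s & c q * tofrac t = tofrac s].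
Proof.
move=> cF.
suff [e [t [tE t0 tP]]] : exists e t, [/\ hrep e t, t != 0 & forall q, q \in enum 'I_d ->
    exists2 s, hrep e s & c q * tofrac t = tofrac s].
  by exists e, t; split=> // q; apply: tP; rewrite mem_enum.
elim: (enum _) => [|i r [e [t [tE t0 tP]]]].
  by exists 0%N, 1; split; rewrite ?oner_neq0 //; exact: hrep1.
have /asboolP[e' [s' [t' [sE' tE' t0' cE]]]] := cF i.
exists (e + e')%N, (t * t'); split; [exact: hrepM | by rewrite mulf_neq0 |].
move=> q; rewrite inE => /orP[/eqP->|/tP[s sE cs]].
  exists (t * s'); first exact: hrepM.
  by rewrite cE !tofracM mulrCA divfK ?tofrac_neq0.
exists (s * t'); first exact: hrepM.
by rewrite !tofracM mulrA cs.
Qed.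

(** By Cramer's rule, the coordinates of an element in the basis [G] are
    quotients of determinants of elements of the ring. *)
Lemma coord_ring_PI_degree_at : has_PI_degree N R.
Proof.
have J_entry (y : 'I_d -> R) :
    entry_mx (fun q => frac_mx (y q)) = map_mx (@tofrac D) (entry_mx (fun q => fun_mx (y q))).
  by apply/matrixP => q l; rewrite !mxE.
have Y0 : \det (entry_mx (fun q => frac_mx (G q))) != 0.
  by rewrite J_entry det_map_mx tofrac_neq0 // det_basis.
apply: (@PI_degree_of_matrices n R K frac_mx invariant_frac G frac_mx_inj
  invariant_divring Y0) => [r q|c cF].
  have Yu : entry_mx (fun q => frac_mx (G q)) \in unitmx by rewrite unitmxE unitfE.
  rewrite /gcoord /invmx Yu -scalemxAr mxE adj_row_det.
  have -> : (\matrix_l (if l == q then entry_row (frac_mx r)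
      else row l (entry_mx (fun q => frac_mx (G q))))) =
      entry_mx (fun l => frac_mx (if l == q then r else G l)).
    by apply/matrixP => l l'; rewrite !mxE; case: (l == q); rewrite !mxE.
  apply/asboolP; exists 1%N.
  exists (\det (entry_mx (fun l => fun_mx (if l == q then r else G l)))).
  exists (\det (entry_mx (fun q => fun_mx (G q)))).
  split; [exact: hrep_det | exact: hrep_det | exact: det_basis |].
  by rewrite mulrC -!det_map_mx -!J_entry.
have [e [t [[s sE] t0 tP]]] := invariant_common cF.
have CK0 : \det (map_mx (@tofrac D) C1) != 0.
  by rewrite det_map_mx tofrac_neq0 // det_capelli_one.
have JE u s' : fun_mx u = s' *: C1 ^+ e ->
    frac_mx u = tofrac s' *: map_mx (@tofrac D) (C1 ^+ e).
  by move=> uE; rewrite /= uE map_mxZ.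
exists s.
  rewrite (JE _ _ sE) detZ; apply: mulf_neq0.
    exact: expf_neq0 (tofrac_neq0 t0).
  have -> : map_mx (@tofrac D) (C1 ^+ e) = map_mx (@tofrac D) C1 ^+ e.
    exact: rmorphXn.
  exact: det_exp_neq0 CK0.
move=> q; have [s' [u uE] cs] := tP q.
by exists u; rewrite (JE _ _ uE) (JE _ _ sE) scalerA cs.
Qed.

End CoordinateRingDegree.

Lemma coord_ring_object (k : closedFieldType) (n : nat) (X : irr_nvariety k n) :
  PIn_object n (PI_coordinate_ring X).
Proof.
split.
- exact: coord_ring_fin_generated.
- exact: coord_ring_prime.
- exact: coord_ring_PI.
- have [[a aX] _] := nv_irr X; pose x0 : nv_point X := exist _ a aX.
  have [g gE] := choice (fun ij : 'I_n.+1 * 'I_n.+1 => ev_surj x0 (delta_mx ij.1 ij.2)).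
  exact: (coord_ring_PI_degree_at gE).
Qed.

(** * The equivalence *)

Theorem mainTheorem1 (k : closedFieldType) (n : nat) :
  exists (objP : forall X : irr_nvariety k n,
            PIn_object n (PI_coordinate_ring X))
         (morP : forall (X Y : irr_nvariety k n) (f : regular_map X Y),
            PIn_morphism n (pullback f)),
    is_equivalence (coordinate_functor objP morP).
Proof.
exists (@coord_ring_object k n), (@pullback_morphism k n).
exact: coordinate_equivalence.
Qed.
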